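(* Let $E=\mathbb C/(\mathbb Z+\tau\mathbb Z)$ with $\mathrm{Im}\,\tau>0$, $m,n\in\mathbb N$, $\xi\in\mathbb C$, and $X=E^n$. Then the Haldane--Rezayi space has the following description: $$\mathsf V_{m,n,\xi}\cong\Gamma\bigl(X,\mathcal W_{m,n,\xi}(-m[\Sigma])\bigr),$$ where $\Sigma=\bigcup_{1\le p<q\le n}\Sigma_{pq}$, $\Sigma_{pq}=\{(z_1,\dots,z_n)\in X: z_p=z_q\}$; that is, inside $\Gamma(X,\mathcal W_{m,n,\xi})$, $\mathsf V_{m,n,\xi}$ is the subspace of holomorphic sections vanishing to order at least $m$ along each $\Sigma_{pq}$.
   Context: For $\alpha,\beta\in\mathbb R$, $\vartheta[\alpha,\beta](z|\tau)=\sum_{k\in\mathbb Z}\exp(\pi i\tau(k+\alpha)^2+2\pi i(k+\alpha)(z+\beta))$ and $\vartheta(z)=\vartheta[\frac12,\frac12](z|\tau)$. For $1\le j\le m$, $$\Phi_j(z_1,\dots,z_n)=\vartheta\Bigl[\frac{j-1}m,0\Bigr](mw+\xi\,|\,m\tau)\Bigl(\prod_{p<q}\vartheta(z_p-z_q)\Bigr)^m,\qquad w=z_1+\dots+z_n,$$ and $\mathsf V_{m,n,\xi}=\langle\Phi_1,\dots,\Phi_m\rangle_{\mathbb C}$. With $\varphi(z)=\exp(-\pi i\tau-2\pi iz)$, $\mathcal L_{k,\xi}$ is the holomorphic line bundle on $E$ whose sections are functions $f$ on $\mathbb C$ with $f(z+1)=f(z)$, $f(z+\tau)=\exp(-2\pi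 i\xi)\varphi(z)^kf(z)$; $\mathcal L^\sharp_{k,\xi}$ is defined by the same rules with an additional factor $-1$ on the right-hand side of both. $\mathcal W_{m,n,\xi}=\mathcal L_{mn,\xi}\boxtimes\dots\boxtimes\mathcal L_{mn,\xi}$ ($n$ factors) on $X$ if $(-1)^{m(n-1)}=1$, and $\mathcal W_{m,n,\xi}=\mathcal L^\sharp_{mn,\xi}\boxtimes\dots\boxtimes\mathcal L^\sharp_{mn,\xi}$ if $(-1)^{m(n-1)}=-1$. One has $\mathsf V_{m,n,\xi}\subset\Gamma(X,\mathcal W_{m,n,\xi})$. *)

(* Defs.v *)
(* Complex numbers are R[i] for R : realType; as a space over
   itself (for limits and derivatives) C is R[i]^o, and C^n is 'rV[R[i]]_n. *)
From HB Require Import structures.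
From mathcomp Require Import all_boot all_order all_algebra.
From mathcomp Require Import all_classical all_reals all_analysis.
From mathcomp Require Import summability.
From mathcomp Require Import complex.

Set Implicit Arguments.
Unset Strict Implicit.
Unset Printing Implicit Defensive.

Import Order.TTheory GRing.Theory Num.Theory.
Import numFieldNormedType.Exports.

Local Open Scope classical_set_scope.
Local Open Scope ring_scope.
Local Open Scope complex_scope.

Definition cexp (R : realType) (z : R[i]) : R[i] :=
  (expR (complex.Re z) * cos (complex.Im z)) +i*
  (expR (complex.Re z) * sin (complex.Im z)).

(* the constant pi * i *)
Definition ipi (R : realType) : R[i] := 0 +i* pi.

(* The sum over int is the library's unconditional sum: the limit of the finite
   partial sums along the filter of finite sets of indices. *)
Definition theta_char (R : realType) (alpha beta : R) (z tau : R[i]) : R[i] :=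
  summability.sum (fun k : int =>
    cexp (ipi R * tau * (k%:~R + alpha%:C) ^+ 2
          + 2 * ipi R * (k%:~R + alpha%:C) * (z + beta%:C)) : R[i]^o).

Definition theta (R : realType) (tau z : R[i]) : R[i] :=
  theta_char 2^-1 2^-1 z tau.

(* The index j : 'I_m is the j - 1 of the usual indexing by 1, ..., m. *)
Definition Phi (R : realType) (m n : nat) (xi tau : R[i]) (j : 'I_m)
    (z : 'rV[R[i]]_n) : R[i] :=
  theta_char (j%:R / m%:R) 0 (m%:R * (\sum_(p < n) z 0 p) + xi) (m%:R * tau)
  * (\prod_(p < n) \prod_(q < n | (p < q)%N) theta tau (z 0 p - z 0 q)) ^+ m.

Definition haldane_rezayi (R : realType) (m n : nat) (xi tau : R[i]) :
    set ('rV[R[i]]_n -> R[i]) :=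
  [set f | exists c : 'I_m -> R[i],
     forall z, f z = \sum_(j < m) c j * Phi xi tau j z].

(* Complex Frechet differentiability: the scalars of both spaces are R[i]. *)
Definition holomorphic_at (R : realType) (n : nat) (f : 'rV[R[i]]_n -> R[i])
    (a : 'rV[R[i]]_n) : Prop :=
  \forall z \near (a : 'rV[R[i]^o]_n),
    differentiable (f : 'rV[R[i]^o]_n -> R[i]^o) z.

Definition holomorphic (R : realType) (n : nat) (f : 'rV[R[i]]_n -> R[i]) : Prop :=
  forall a, holomorphic_at f a.

(* A line bundle on E = C / (Z + tau Z) given by its multipliers: its sections
   are the f with f (z + 1) = mult_1 z * f z, f (z + tau) = mult_tau z * f z. *)
Record multipliers (R : realType) := Multipliers {
  mult_1 : R[i] -> R[i];
  mult_tau : R[i] -> R[i]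
}.

Definition phi (R : realType) (tau z : R[i]) : R[i] :=
  cexp (- (ipi R * tau) - 2 * ipi R * z).

Definition bundle_L (R : realType) (tau : R[i]) (k : nat) (xi : R[i]) :
    multipliers R :=
  Multipliers (fun=> 1) (fun z => cexp (- (2 * ipi R * xi)) * phi tau z ^+ k).

Definition bundle_Lsharp (R : realType) (tau : R[i]) (k : nat) (xi : R[i]) :
    multipliers R :=
  Multipliers (fun=> -1)
    (fun z => - (cexp (- (2 * ipi R * xi)) * phi tau z ^+ k)).

(* Global sections over E ^ n of the n-fold external tensor power of a line
   bundle on E, as functions on the universal cover C^n: translating the i-th
   coordinate multiplies by the multiplier of the i-th factor. *)
Definition box_power_sections (R : realType) (n : nat) (tau : R[i])
    (L : multipliers R) : set ('rV[R[i]]_n -> R[i]) :=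
  [set f | holomorphic f /\
     forall (i : 'I_n) (z : 'rV[R[i]]_n),
       f (z + delta_mx 0 i) = mult_1 L (z 0 i) * f z /\
       f (z + tau *: delta_mx 0 i) = mult_tau L (z 0 i) * f z].

(* n.-1 is the genuine n - 1, as n is positive where this is used *)
Definition bundle_W_factor (R : realType) (m n : nat) (xi tau : R[i]) :
    multipliers R :=
  if (-1) ^+ (m * n.-1) == 1 :> int then bundle_L tau (m * n) xi
  else bundle_Lsharp tau (m * n) xi.

Definition sections_W (R : realType) (m n : nat) (xi tau : R[i]) :
    set ('rV[R[i]]_n -> R[i]) :=
  box_power_sections tau (bundle_W_factor m n xi tau).

Definition lattice (R : realType) (tau : R[i]) : set R[i] :=
  [set l | exists a b : int, l = a%:~R + b%:~R * tau].

(* the preimage in C^n of the divisor z_p = z_q of E ^ n *)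
Definition Sigma (R : realType) (n : nat) (tau : R[i]) (p q : 'I_n) :
    set 'rV[R[i]]_n :=
  [set z | lattice tau (z 0 p - z 0 q)].

(* Near a point a of Sigma tau p q, this is an equation of Sigma tau p q. *)
Definition Sigma_eqn (R : realType) (n : nat) (p q : 'I_n)
    (a z : 'rV[R[i]]_n) : R[i] :=
  (z 0 p - z 0 q) - (a 0 p - a 0 q).

Definition vanishes_to_order (R : realType) (n : nat) (tau : R[i]) (p q : 'I_n)
    (m : nat) (f : 'rV[R[i]]_n -> R[i]) : Prop :=
  forall a, Sigma tau p q a ->
    exists g : 'rV[R[i]]_n -> R[i], holomorphic_at g a /\
      \forall z \near (a : 'rV[R[i]^o]_n), f z = Sigma_eqn p q a z ^+ m * g z.

(* Global sections of W(- m [Sigma]): the sections of W that are, near every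
   point, holomorphic multiples of the local equation of the divisor m [Sigma],
   where Sigma is the union of the Sigma_pq, p < q. *)
Definition sections_W_twist (R : realType) (m n : nat) (xi tau : R[i]) :
    set ('rV[R[i]]_n -> R[i]) :=
  [set f | sections_W m xi tau f /\
     forall a, exists g : 'rV[R[i]]_n -> R[i], holomorphic_at g a /\
       \forall z \near (a : 'rV[R[i]^o]_n),
         f z = (\prod_(p < n) \prod_(q < n | (p < q)%N && (a \in Sigma tau p q))
                  Sigma_eqn p q a z) ^+ m * g z].

(* Main.v *)
(* Divide a section f of W that vanishes to order m along the Sigma_pq by
   D = (prod_(p < q) theta (z_p - z_q)) ^ m. The zeros of theta are simple and
   form the lattice, and a generic line in the direction e_p - e_q meets the
   hypersurfaces theta (z_a - z_b) = 0 one at a time, so that f / D extends to an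
   entire function on such a line. The multipliers of f and D cancel in that
   direction, hence this function is doubly periodic, hence constant; by density
   f = G (z_1 + ... + z_n) * D for an entire G. Then G is quasi-periodic of degree
   m, and comparing Fourier coefficients shows that it is a combination of the m
   functions theta[j / m, 0](m w + xi | m tau).

   The zeros of theta are controlled by a lower bound for |theta| obtained as a
   limit of the finite Jacobi triple product (the q-binomial theorem). The
   vanishing of an entire periodic function whose Fourier coefficients vanish
   follows from Goursat's lemma: contour shifts reduce it to f 0 = 0; on the reals
   f - f 0 = (e^(2 pi i x) - 1) g for a continuous periodic g, whose coefficients
   of index > 0, resp. <= 0, are all equal, hence zero by Riemann-Lebesgue. *)
Require Import Defs.
From mathcomp Require Import all_boot all_order all_algebra.
From mathcomp Require Import all_classical all_reals all_analysis.
From mathcomp Require Import finmap summability complex ring lra zify.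

Set Implicit Arguments.
Unset Strict Implicit.
Unset Printing Implicit Defensive.

Import Order.TTheory GRing.Theory Num.Theory.
Import numFieldNormedType.Exports.
Local Open Scope classical_set_scope.
Local Open Scope ring_scope.
Local Open Scope complex_scope.
Local Notation Re := complex.Re.
Local Notation Im := complex.Im.

(** * The modulus and complex differentiability *)

(** At a point where several [Sigma] meet, vanishing along each of them gives one factorization per
    pair, and merging these into divisibility by the product would need unique factorization of
    germs or a Hartogs extension. Both are avoided: the quotient is extended only along lines, and
    its invariance is then stated without division, as f (z + e) * disc z = f z * disc (z + e), an
    identity between functions continuous everywhere, so that it passes from generic z to all z.
    Holomorphy is used only as complex differentiability: no power series, no Cauchy formula, no
    Liouville theorem. Constancy of a doubly periodic entire function is read off its Fourier
    coefficients, which translation by tau multiplies by exp (2 pi i k tau); the same rule yields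
    the recursion in degree m. For theta a lower bound suffices: the limit of the central q-binomial
    coefficients is never computed, only their boundedness and mutual closeness matter. Zeros are
    simple because near 0 a single factor of the product is small. *)

Definition cabs (R : realType) (z : R[i]) : R := Normc.normc z.

Section Modulus.
Variable R : realType.
Implicit Types (x y z w : R[i]) (r s : R).

(** The norm of [R[i]] is itself valued in [R[i]]; the real-valued [cabs] makes estimates accessible
    to [lra] and to real inequalities. *)
Lemma normC_cabs z : `|z| = (cabs z)%:C. Proof. by []. Qed.
Lemma cabsM x y : cabs (x * y) = cabs x * cabs y. Proof. exact: Normc.normcM. Qed.
Lemma cabsV x : cabs x^-1 = (cabs x)^-1. Proof. exact: Normc.normcV. Qed.
Lemma cabs0 : cabs (0 : R[i]) = 0. Proof. exact: Normc.normc0. Qed.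
Lemma cabs1 : cabs (1 : R[i]) = 1. Proof. exact: Normc.normc1. Qed.
Lemma cabsN x : cabs (- x) = cabs x. Proof. exact: normcN. Qed.
Lemma cabsB x y : cabs (x - y) = cabs (y - x).
Proof. by rewrite -cabsN opprB. Qed.
Lemma cabs_ge0 x : 0 <= cabs x.
Proof. by case: x => a b; rewrite /cabs /= sqrtr_ge0. Qed.
Lemma cabs_eq0 x : (cabs x == 0) = (x == 0).
Proof. by apply/eqP/eqP => [/Normc.eq0_normc//|->]; exact: cabs0. Qed.
Lemma cabs_gt0 x : (0 < cabs x) = (x != 0).
Proof. by rewrite lt0r cabs_ge0 andbT cabs_eq0. Qed.
Lemma ler_cabsD x y : cabs (x + y) <= cabs x + cabs y.
Proof. exact: le_normcD. Qed.
Lemma ler_cabsB x y : cabs (x - y) <= cabs x + cabs y.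
Proof. by rewrite -(cabsN y); exact: ler_cabsD. Qed.
Lemma lerB_cabs x y : cabs x - cabs y <= cabs (x - y).
Proof. by rewrite lerBlDr -{1}(subrK y x) ler_cabsD. Qed.
Lemma cabsX x n : cabs (x ^+ n) = cabs x ^+ n.
Proof. by elim: n => [|n IH]; rewrite ?expr0 ?cabs1// !exprS cabsM IH. Qed.
Lemma cabs_prod (I : Type) (s : seq I) (P : pred I) (F : I -> R[i]) :
  cabs (\prod_(i <- s | P i) F i) = \prod_(i <- s | P i) cabs (F i).
Proof. exact: (big_morph _ cabsM cabs1). Qed.
Lemma ler_cabs_sum (I : Type) (s : seq I) (P : pred I) (F : I -> R[i]) :
  cabs (\sum_(i <- s | P i) F i) <= \sum_(i <- s | P i) cabs (F i).
Proof.
elim/big_rec2: _ => [|i y x _ IH]; first by rewrite cabs0.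
by rewrite (le_trans (ler_cabsD _ _))// lerD2l.
Qed.
Lemma cabs_real r : cabs r%:C = `|r|.
Proof. by rewrite /cabs /= expr0n/= addr0 sqrtr_sqr. Qed.
Lemma cabs_Re z : `|Re z| <= cabs z.
Proof.
by case: z => a b; rewrite /cabs /= -sqrtr_sqr ler_wsqrtr// lerDl sqr_ge0.
Qed.
Lemma cabs_Im z : `|Im z| <= cabs z.
Proof.
by case: z => a b; rewrite /cabs /= -sqrtr_sqr ler_wsqrtr// lerDr sqr_ge0.
Qed.
Lemma cabs_le_ReIm z : cabs z <= `|Re z| + `|Im z|.
Proof.
case: z => a b; rewrite {1}(_ : a +i* b = a%:C + b%:C * 'i); last by simpc.
rewrite (le_trans (ler_cabsD _ _))// cabsM !cabs_real /= lerD2l.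
by rewrite /cabs /= expr0n/= expr1n add0r sqrtr1 mulr1.
Qed.

Lemma Re_add x y : Re (x + y) = Re x + Re y. Proof. by case: x; case: y. Qed.
Lemma Im_add x y : Im (x + y) = Im x + Im y. Proof. by case: x; case: y. Qed.
Lemma Re_mul x y : Re (x * y) = Re x * Re y - Im x * Im y.
Proof. by case: x; case: y. Qed.
Lemma Im_mul x y : Im (x * y) = Re x * Im y + Im x * Re y.
Proof. by case: x; case: y. Qed.
Lemma Re_opp x : Re (- x) = - Re x. Proof. by case: x. Qed.
Lemma Im_opp x : Im (- x) = - Im x. Proof. by case: x. Qed.
Lemma complex_eq x y : Re x = Re y -> Im x = Im y -> x = y.
Proof. by case: x; case: y => a b c d /= -> ->. Qed.
Lemma Re_nat n : Re (n%:R : R[i]) = n%:R.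
Proof. by rewrite -(rmorph_nat (real_complex R)). Qed.
Lemma Im_nat n : Im (n%:R : R[i]) = 0.
Proof. by rewrite -(rmorph_nat (real_complex R)). Qed.
Lemma Re_int (k : int) : Re (k%:~R : R[i]) = k%:~R.
Proof. by rewrite -(rmorph_int (real_complex R)). Qed.
Lemma Im_int (k : int) : Im (k%:~R : R[i]) = 0.
Proof. by rewrite -(rmorph_int (real_complex R)). Qed.
Definition ReImE := (Re_nat, Im_nat, Re_int, Im_int,
  Re_add, Im_add, Re_mul, Im_mul, Re_opp, Im_opp).
Lemma cabs_nat n : cabs (n%:R : R[i]) = n%:R.
Proof. by rewrite -(rmorph_nat (real_complex R)) cabs_real ger0_norm. Qed.

(** Radii of balls in [R[i]] are positive elements of [R[i]], hence have imaginary part 0; here they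
    are exchanged for real radii. *)
Lemma nearC_cabs (z : R[i]) (P : R[i] -> Prop) :
  (\forall w \near (z : R[i]^o), P w) <->
  exists2 d : R, 0 < d & forall w, cabs (w - z) < d -> P w.
Proof.
split=> [/nbhs_ballP[e /= e0 H]|[d d0 H]].
  move: e0 H; case: e => e ei.
  rewrite ltcE /= => /andP[/eqP ->]; rewrite complexr0 => e0 H.
  exists e => // w wz; apply: H; rewrite -ball_normE /= distrC normC_cabs.
  by rewrite ltcR.
apply/nbhs_ballP; exists d%:C => /=; first by rewrite ltcR.
move=> w; rewrite -ball_normE /= distrC normC_cabs ltcR; exact: H.
Qed.

(** The difference quotient multiplied out: h = 0 needs no exclusion, and a quadratic remainder
    gives the estimate at once. *)
Definition is_cderiv (f : R[i] -> R[i]) z a := forall e : R, 0 < e ->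
  exists2 d : R, 0 < d &
    forall h, cabs h < d -> cabs (f (z + h) - f z - a * h) <= e * cabs h.

Lemma differentiableC (f : R[i] -> R[i]) z :
  differentiable (f : R[i]^o -> R[i]^o) (z : R[i]^o) <-> exists a, is_cderiv f z a.
Proof.
split=> [/derivable1_diffP/cvg_ex[a]|[a H]].
  move=> /cvgrPdist_le H; exists a => e e0.
  have /H : 0 < e%:C by rewrite ltcR.
  move=> /nbhs_ballP[d /=]; case: d => d di.
  rewrite ltcE /= => /andP[/eqP ->]; rewrite complexr0 => d0 {}H.
  exists d => // h hd; have [->|h0] := eqVneq h 0.
    by rewrite addr0 mulr0 !subrr cabs0 mulr0.
  have := H h; rewrite /ball /= add0r normrN normC_cabs ltcR => /(_ hd h0).
  rewrite /GRing.scale /= mulr1 normC_cabs lecR => H1.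
  rewrite -[X in cabs X]opprK cabsN.
  have -> : - (f (z + h) - f z - a * h) = h * (a - h^-1 * (f (h + z) - f z)).
    by rewrite mulrBr mulrA divff// mul1r (addrC h) mulrC; ring.
  by rewrite cabsM mulrC ler_wpM2r// cabs_ge0.
apply/derivable1_diffP/cvg_ex; exists a; apply/cvgrPdist_le => -[e ei].
rewrite ltcE /= => /andP[/eqP ->]; rewrite complexr0 => e0; have [d d0 {}H] := H e e0.
apply/nbhs_ballP; exists d%:C => /=; first by rewrite ltcR.
move=> h; rewrite /ball /= add0r normrN normC_cabs ltcR => hd h0.
rewrite /GRing.scale /= mulr1 normC_cabs lecR.
have h0' : 0 < cabs h by rewrite cabs_gt0.
rewrite -(ler_pM2r h0') (le_trans _ (H h hd))//.
rewrite -cabsM mulrBl mulrAC mulVf// mul1r cabsB le_eqVlt (addrC h).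
by apply/orP; left; apply/eqP.
Qed.

Lemma is_cderiv_quad (f : R[i] -> R[i]) z a (K : R) :
  (forall h, cabs h < 1 -> cabs (f (z + h) - f z - a * h) <= K * cabs h ^+ 2) ->
  is_cderiv f z a.
Proof.
move=> H e e0; have K1 : 0 < `|K| + 1 by rewrite ltr_wpDl.
exists (Num.min 1 (e / (`|K| + 1))); first by rewrite lt_min ltr01 divr_gt0.
move=> h; rewrite lt_min => /andP[h1 h2]; rewrite (le_trans (H h h1))//.
rewrite expr2 mulrA ler_wpM2r ?cabs_ge0//.
rewrite (le_trans (ler_wpM2r (cabs_ge0 _) (ler_norm K)))//.
move: h2; rewrite ltr_pdivlMr// => /ltW h2; rewrite (le_trans _ h2)// mulrC.
by rewrite ler_wpM2l ?cabs_ge0// lerDl.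
Qed.

End Modulus.

(** * The complex exponential *)

Section RealToComplexDerivative.
Variable R : realType.
Implicit Types (G H g h : R -> R[i]) (c w z : R[i]).

(** Derivatives are taken componentwise, so that the real mean value theorem and the real
    fundamental theorem of calculus apply. *)
Definition rcderiv G g := forall x : R,
  is_derive x (1 : R) (fun t => Re (G t)) (Re (g x)) /\
  is_derive x (1 : R) (fun t => Im (G t)) (Im (g x)).

Lemma rcderiv_ext G H g h :
  (forall x, G x = H x) -> (forall x, g x = h x) -> rcderiv G g -> rcderiv H h.
Proof. by move=> /funext -> /funext ->. Qed.

Lemma rcderivD G H g h :
  rcderiv G g -> rcderiv H h -> rcderiv (fun t => G t + H t) (fun t => g t + h t).
Proof.
move=> dG dH x; have [? ?] := dG x; have [? ?] := dH x.
split; rewrite ReImE.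
  by rewrite (_ : (fun t => _) = (fun t => Re (G t)) \+ (fun t => Re (H t)));
    [exact: is_deriveD|apply/funext => t; rewrite /= ReImE].
by rewrite (_ : (fun t => _) = (fun t => Im (G t)) \+ (fun t => Im (H t)));
  [exact: is_deriveD|apply/funext => t; rewrite /= ReImE].
Qed.

Lemma rcderivM G H g h : rcderiv G g -> rcderiv H h ->
  rcderiv (fun t => G t * H t) (fun t => g t * H t + G t * h t).
Proof.
move=> dG dH x; have [? ?] := dG x; have [? ?] := dH x.
split.
  rewrite (_ : (fun t => _) = (fun t => Re (G t)) \* (fun t => Re (H t))
     \- (fun t => Im (G t)) \* (fun t => Im (H t))); last first.
    by apply/funext => t; rewrite /= ReImE.
  by apply: is_derive_eq; rewrite !ReImE /GRing.scale /=; ring.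
rewrite (_ : (fun t => _) = (fun t => Re (G t)) \* (fun t => Im (H t))
   \+ (fun t => Im (G t)) \* (fun t => Re (H t))); last first.
  by apply/funext => t; rewrite /= ReImE.
by apply: is_derive_eq; rewrite !ReImE /GRing.scale /=; ring.
Qed.

Lemma rcderiv_cst c : rcderiv (fun=> c) (fun=> 0).
Proof. by move=> x; split; exact: is_derive_cst. Qed.

Lemma rcderivZ c G g : rcderiv G g -> rcderiv (fun t => c * G t) (fun t => c * g t).
Proof.
move=> dG; have := rcderivM (rcderiv_cst c) dG.
by apply: rcderiv_ext => // t; rewrite mul0r add0r.
Qed.

Lemma rcderivB G H g h :
  rcderiv G g -> rcderiv H h -> rcderiv (fun t => G t - H t) (fun t => g t - h t).
Proof.
move=> dG dH; have := rcderivD dG (rcderivZ (-1) dH).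
by apply: rcderiv_ext => t; rewrite mulN1r.
Qed.

Lemma rcderiv_id : rcderiv (fun t => t%:C) (fun=> 1).
Proof. by move=> x; split; [exact: is_derive_id|exact: is_derive_cst]. Qed.

Lemma rcderiv_shift G g (s : R) :
  rcderiv G g -> rcderiv (fun t => G (t + s)) (fun t => g (t + s)).
Proof.
move=> dG x; have [? ?] := dG (x + s).
have ? : is_derive x (1 : R) (fun t : R => t + s) 1.
  by rewrite -[X in is_derive _ _ _ X]addr0; apply: is_deriveD.
split.
  rewrite (_ : (fun t => _) = (fun t => Re (G t)) \o (fun t : R => t + s))//.
  by apply: is_derive_eq (is_derive1_comp _ _) _ => /=; rewrite ?mulr1 ?mul1r.
rewrite (_ : (fun t => _) = (fun t => Im (G t)) \o (fun t : R => t + s))//.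
by apply: is_derive_eq (is_derive1_comp _ _) _ => /=; rewrite ?mulr1 ?mul1r.
Qed.

(** The mean value theorem fails for complex values; it is applied to both components, which costs
    the factor 2. *)
Lemma rcderiv_bound G g (a b M : R) : rcderiv G g -> a <= b ->
  (forall x, a <= x <= b -> cabs (g x) <= M) -> cabs (G b - G a) <= 2 * M * (b - a).
Proof.
move=> dG ab gM.
have H (F f : R -> R) : (forall x, is_derive x (1 : R) F (f x)) ->
    (forall x, a <= x <= b -> `|f x| <= M) -> `|F b - F a| <= M * (b - a).
  move=> dF fM; have cF : continuous F.
    move=> x; have [dFx _] := dF x.
    by apply: differentiable_continuous; apply/derivable1_diffP.
  have [] := @MVT_segment R F f a b ab (fun x _ => dF x).
  - by apply: continuous_subspaceT; exact: cF.
  move=> c; rewrite in_itv /= => cab ->; rewrite normrM.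
  by rewrite (ger0_norm (_ : 0 <= b - a)) ?subr_ge0// ler_wpM2r ?subr_ge0 ?fM.
rewrite (le_trans (cabs_le_ReIm _))// -mulrA mulr_natl mulr2n !ReImE lerD//.
  apply: (H (fun t => Re (G t)) (fun t => Re (g t))) => [x|x xab]; first by case: (dG x).
  by rewrite (le_trans (cabs_Re _))// gM.
apply: (H (fun t => Im (G t)) (fun t => Im (g t))) => [x|x xab]; first by case: (dG x).
by rewrite (le_trans (cabs_Im _))// gM.
Qed.

Lemma rcderiv0_cst G : rcderiv G (fun=> 0) -> forall x y, G x = G y.
Proof.
move=> dG x y; wlog xy : x y / x <= y.
  by move=> H; have [/H->//|/ltW/H->] := leP x y.
have := @rcderiv_bound G _ x y 0 dG xy.
rewrite mulr0 mul0r => /(_ _)/wrap[]; first by move=> *; rewrite cabs0.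
move=> H; apply/esym/eqP; rewrite -subr_eq0 -cabs_eq0.
by rewrite eq_le H cabs_ge0.
Qed.

(** Makes the integral defined below by antiderivatives independent of their choice. *)
Lemma rcderiv_eq G H g : rcderiv G g -> rcderiv H g ->
  forall x y, G y - G x = H y - H x.
Proof.
move=> dG dH x y; have := rcderivB dG dH.
move=> /(rcderiv_ext (fun=> erefl) (fun=> subrr _)) /rcderiv0_cst/(_ x y) E.
by rewrite -(subrK (H y) (G y)) -E; ring.
Qed.

End RealToComplexDerivative.

(** * Algebra, Taylor remainders and periods of the exponential *)

Section ComplexExponential.
Variable R : realType.
Implicit Types (w z : R[i]).

Lemma cexpD z w : cexp (z + w) = cexp z * cexp w.
Proof.
by apply: complex_eq; rewrite /cexp !ReImE /= !expRD ?cosD ?sinD; ring.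
Qed.

Lemma cexp0 : cexp (0 : R[i]) = 1.
Proof. by rewrite /cexp /= expR0 cos0 sin0 mulr0 mulr1. Qed.

Lemma cabs_cexp z : cabs (cexp z) = expR (Re z).
Proof.
by rewrite /cabs /= !exprMn -mulrDr cos2Dsin2 mulr1 sqrtr_sqr ger0_norm ?expR_ge0.
Qed.

Lemma cexp_neq0 z : cexp z != 0.
Proof. by rewrite -cabs_gt0 cabs_cexp expR_gt0. Qed.

Lemma cexpN z : cexp (- z) = (cexp z)^-1.
Proof.
apply: (mulfI (cexp_neq0 z)); rewrite -cexpD subrr cexp0 divff//.
exact: cexp_neq0.
Qed.

Lemma cexpB z w : cexp (z - w) = cexp z / cexp w.
Proof. by rewrite cexpD cexpN. Qed.

Lemma cexpMn z n : cexp (n%:R * z) = cexp z ^+ n.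
Proof.
elim: n => [|n IH]; first by rewrite mul0r cexp0.
by rewrite -addn1 natrD mulrDl mul1r cexpD IH addn1 exprSr.
Qed.

Lemma rcderiv_cexp w z :
  rcderiv (fun t => cexp (t%:C * w + z)) (fun t => w * cexp (t%:C * w + z)).
Proof.
have aff (a b x : R) : is_derive x (1 : R) (fun t : R => t * a + b) a.
  have E : (fun t : R => t * a + b) = (fun t : R => a *: t) \+ cst b.
    by apply/funext => t /=; rewrite mulrC.
  rewrite E; apply: is_derive_eq; rewrite addr0.
  by rewrite /GRing.scale /= mulr1.
move=> x; split.
  rewrite (_ : (fun t => _) = (expR \o (fun t : R => t * Re w + Re z))
       \* (cos \o (fun t : R => t * Im w + Im z))); last first.
    by apply/funext => t /=; rewrite !ReImE /= !(mul0r, subr0, addr0).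
  have ? := aff (Re w) (Re z) x; have ? := aff (Im w) (Im z) x.
  apply: is_derive_eq.
  by rewrite !ReImE /= !ReImE /= /GRing.scale /= !(mul0r, subr0, addr0); ring.
rewrite (_ : (fun t => _) = (expR \o (fun t : R => t * Re w + Re z))
     \* (sin \o (fun t : R => t * Im w + Im z))); last first.
  by apply/funext => t /=; rewrite !ReImE /= !(mul0r, subr0, addr0).
have ? := aff (Re w) (Re z) x; have ? := aff (Im w) (Im z) x.
apply: is_derive_eq.
by rewrite !ReImE /= !ReImE /= /GRing.scale /= !(mul0r, subr0, addr0); ring.
Qed.

(** Each remainder, as a function of t, vanishes at 0 and has w times the previous one as
    derivative; each application of [rcderiv_bound] contributes a factor 2 |w|, whence 2, 4, 8. The
    constants are not sharp. *)
Lemma cexp_remainder w (t : R) : 0 <= t <= 1 ->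
  let E := expR (cabs w) in
  [/\ cabs (cexp (t%:C * w) - 1) <= 2 * cabs w * E,
      cabs (cexp (t%:C * w) - 1 - t%:C * w) <= 4 * cabs w ^+ 2 * E &
      cabs (cexp (t%:C * w) - 1 - t%:C * w - (t%:C * w) ^+ 2 / 2)
        <= 8 * cabs w ^+ 3 * E].
Proof.
move=> t01 E.
have E0 : 0 <= E by exact: expR_ge0.
have bnd (F f : R -> R[i]) (M : R) : F 0 = 0 -> 0 <= M ->
    (forall s : R, 0 <= s <= 1 -> cabs (f s) <= M) ->
    rcderiv F f -> forall s : R, 0 <= s <= 1 -> cabs (F s) <= 2 * M.
  move=> F0 M0 fM dF s /andP[s0 s1].
  have := @rcderiv_bound _ F f 0 s M dF s0; rewrite F0 !subr0.
  move=> /(_ _)/wrap[x /andP[x0 xs]|H]; first by rewrite fM// x0 (le_trans xs).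
  by rewrite (le_trans H)// ler_piMr// mulr_ge0.
have dlin : rcderiv (fun s : R => s%:C * w) (fun=> w).
  have := rcderivZ w (@rcderiv_id R).
  by apply: rcderiv_ext => s; rewrite ?mulr1 1?mulrC.
have d0 : rcderiv (fun s : R => cexp (s%:C * w)) (fun s => w * cexp (s%:C * w)).
  by have := rcderiv_cexp w 0; apply: rcderiv_ext => s; rewrite addr0.
have dsq : rcderiv (fun s : R => (s%:C * w) ^+ 2 / 2) (fun s => w * (s%:C * w)).
  have := rcderivZ 2^-1 (rcderivM dlin dlin); apply: rcderiv_ext => s; first by rewrite -expr2 mulrC.
  by field.
have b0 (s : R) : 0 <= s <= 1 -> cabs (cexp (s%:C * w)) <= E.
  move=> /andP[s0 s1]; rewrite cabs_cexp ler_expR.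
  rewrite ReImE /= mul0r subr0 (le_trans (ler_norm _))// normrM ger0_norm//.
  by rewrite (le_trans _ (cabs_Re w))// ler_piMl.
have b1 (s : R) : 0 <= s <= 1 -> cabs (cexp (s%:C * w) - 1) <= 2 * (cabs w * E).
  apply: (bnd (fun s => cexp (s%:C * w) - 1) (fun s => w * cexp (s%:C * w))).
  - by rewrite mul0r cexp0 subrr.
  - by rewrite mulr_ge0 ?cabs_ge0.
  - by move=> u u01; rewrite cabsM ler_wpM2l ?cabs_ge0 ?b0.
  - by have := rcderivB d0 (rcderiv_cst 1); apply: rcderiv_ext => u; rewrite ?subr0.
have b2 (s : R) : 0 <= s <= 1 ->
    cabs (cexp (s%:C * w) - 1 - s%:C * w) <= 2 * (cabs w * (2 * (cabs w * E))).
  apply: (bnd (fun s => cexp (s%:C * w) - 1 - s%:C * w)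
    (fun s => w * (cexp (s%:C * w) - 1))).
  - by rewrite mul0r cexp0 subrr subr0.
  - by rewrite !mulr_ge0 ?cabs_ge0.
  - by move=> u u01; rewrite cabsM ler_wpM2l ?cabs_ge0 ?b1.
  - have := rcderivB (rcderivB d0 (rcderiv_cst 1)) dlin; apply: rcderiv_ext => u //.
    by rewrite subr0 mulrBr mulr1.
split.
- by rewrite -mulrA b1.
- by have := b2 t t01; congr (_ <= _); ring.
have -> : 8 * cabs w ^+ 3 * E = 2 * (cabs w * (2 * (cabs w * (2 * (cabs w * E))))) by ring.
apply: (bnd (fun s => cexp (s%:C * w) - 1 - s%:C * w - (s%:C * w) ^+ 2 / 2)
  (fun s => w * (cexp (s%:C * w) - 1 - s%:C * w))) => //.
- by rewrite mul0r cexp0 subrr subr0 expr0n mul0r subr0.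
- by rewrite !mulr_ge0 ?cabs_ge0.
- by move=> u u01; rewrite cabsM ler_wpM2l ?cabs_ge0 ?b2.
- have := rcderivB (rcderivB (rcderivB d0 (rcderiv_cst 1)) dlin) dsq.
  by apply: rcderiv_ext => u //; rewrite subr0; ring.
Qed.

Lemma cexp_taylor2 w :
  cabs (cexp w - 1 - w) <= 4 * cabs w ^+ 2 * expR (cabs w).
Proof.
have [|_ H _] := @cexp_remainder w 1; first by rewrite ler01 lexx.
by move: H; rewrite mul1r.
Qed.

Lemma cexp_taylor3 w :
  cabs (cexp w - 1 - w - w ^+ 2 / 2) <= 8 * cabs w ^+ 3 * expR (cabs w).
Proof.
have [|_ _ H] := @cexp_remainder w 1; first by rewrite ler01 lexx.
by move: H; rewrite mul1r.
Qed.

Lemma is_cderiv_cexp z : is_cderiv (@cexp R) z (cexp z).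
Proof.
apply: (@is_cderiv_quad _ _ _ _ (cabs (cexp z) * (4 * expR 1))) => h h1.
have -> : cexp (z + h) - cexp z - cexp z * h = cexp z * (cexp h - 1 - h).
  by rewrite cexpD; ring.
rewrite cabsM -mulrA ler_wpM2l ?cabs_ge0//.
rewrite (le_trans (cexp_taylor2 h))// mulrAC ler_wpM2r ?exprn_ge0 ?cabs_ge0//.
by rewrite ler_wpM2l// ler_expR ltW.
Qed.

Lemma differentiable_cexp z : differentiable (@cexp R : R[i]^o -> R[i]^o) (z : R[i]^o).
Proof. by apply/differentiableC; exists (cexp z); exact: is_cderiv_cexp. Qed.

Lemma cabs_2ipi w : cabs (2 * ipi R * w) = 2 * pi * cabs w.
Proof.
rewrite !cabsM cabs_nat; congr (_ * _ * _).
by rewrite /cabs /= expr0n /= add0r sqrtr_sqr ger0_norm// pi_ge0.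
Qed.

Lemma cexp2pii_int (k : int) : cexp (2 * ipi R * k%:~R) = 1.
Proof.
have P n : cexp (2 * ipi R * n%:R) = 1.
  rewrite mulrC cexpMn (_ : cexp _ = 1) ?expr1n// /cexp !ReImE /=.
  rewrite !(mul0r, mulr0, subrr, addr0, add0r, oppr0) expR0 !mul1r.
  by rewrite mulr_natl cos2pi sin2pi.
case: k => n; first exact: P.
by rewrite NegzE mulrNz mulrN cexpN P invr1.
Qed.

Lemma cexp_eq1 z : cexp z = 1 -> exists k : int, z = 2 * ipi R * k%:~R.
Proof.
move=> z1; have rez : Re z = 0.
  apply/(@expR_inj R); rewrite expR0 -cabs_cexp z1; exact: cabs1.
move: z1; case: z rez => a b /= ->.
rewrite /cexp /= expR0 !mul1r => -[cb sb].
pose k := Num.floor (b / (2 * pi)).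
have pi0 : 0 < 2 * pi :> R by rewrite mulr_gt0// pi_gt0.
have cE : cos (b - k%:~R * (2 * pi)) = 1 /\ sin (b - k%:~R * (2 * pi)) = 0.
  have := congr1 (fun w => cexp (0 +i* b) / w) (cexp2pii_int k).
  rewrite -cexpB divr1 {2}/cexp /= expR0 !mul1r cb sb.
  rewrite /cexp !ReImE /=.
  rewrite !(mul0r, mulr0, subrr, addr0, add0r, oppr0, subr0) expR0 !mul1r.
  by rewrite [2 * pi * _]mulrC => -[-> ->].
set r := b - _ in cE; case: cE => cr sr.
have r0 : 0 <= r.
  by rewrite subr_ge0 -ler_pdivlMr// /k; exact: Num.Theory.floor_le.
have r1 : r < 2 * pi.
  rewrite ltrBlDr -[X in X + _]mul1r -mulrDl -ltr_pdivrMr//.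
  by rewrite addrC -(intrD _ k 1); exact: Num.Theory.floorD1_gt.
suff r00 : r = 0.
  exists k; apply: complex_eq; rewrite !ReImE /=.
    by rewrite !(mul0r, mulr0, subrr, addr0, add0r, oppr0).
  rewrite !(mul0r, mulr0, subrr, addr0, add0r, oppr0) mulrC.
  by apply/eqP; rewrite -subr_eq0 -/r r00.
(* The cosine is injective on [0, pi]; on (pi, 2 pi) the sine does not vanish. *)
have [rpi|rpi] := leP r pi.
  apply: (@cos_inj R); rewrite ?cos0// in_itv /=; last by rewrite lexx pi_ge0.
  by rewrite r0.
have : 0 < sin (r - pi).
  by rewrite sin_gt0_pi// subr_gt0 rpi/=; lra.
by rewrite sinB cospi sinpi mulrN1 mulr0 subr0 sr oppr0 ltxx.
Qed.

End ComplexExponential.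

(** * Closure rules for complex differentiability *)

Section ComplexDifferentiability.
Variable R : realType.

(** The domain is any normed module, so that the same rules serve functions on C and on C^n. *)
Definition cdiff (V : normedModType R[i]) (f : V -> R[i]) (z : V) : Prop :=
  differentiable (f : V -> R[i]^o) z.

Variable V : normedModType R[i].
Implicit Types (f g : V -> R[i]) (z : V).

Lemma cdiff_cst (c : R[i]) z : cdiff (fun _ : V => c) z.
Proof. exact: (@differentiable_cst _ V (R[i]^o)). Qed.

Lemma cdiffD f g z : cdiff f z -> cdiff g z -> cdiff (fun w => f w + g w) z.
Proof. exact: (@differentiableD _ V (R[i]^o)). Qed.

Lemma cdiffB f g z : cdiff f z -> cdiff g z -> cdiff (fun w => f w - g w) z.
Proof. exact: (@differentiableB _ V (R[i]^o)). Qed.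

Lemma cdiffM f g z : cdiff f z -> cdiff g z -> cdiff (fun w => f w * g w) z.
Proof. exact: (@differentiableM _ V). Qed.

Lemma cdiffV f z : cdiff f z -> f z != 0 -> cdiff (fun w => (f w)^-1) z.
Proof. exact: (@differentiableV _ V). Qed.

Lemma cdiffX f z n : cdiff f z -> cdiff (fun w => f w ^+ n) z.
Proof.
move=> df; elim: n => [|n IH]; first exact: cdiff_cst.
rewrite (_ : (fun w => _) = (fun w => f w * f w ^+ n)); first exact: cdiffM.
by apply/funext => w; rewrite exprS.
Qed.

Lemma cdiff_sum (I : Type) (s : seq I) (P : pred I) (F : I -> V -> R[i]) z :
  (forall i, P i -> cdiff (F i) z) -> cdiff (fun w => \sum_(i <- s | P i) F i w) z.
Proof.
move=> dF; elim: s => [|i s IH].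
  by rewrite (_ : (fun w => _) = (fun=> 0)); [exact: cdiff_cst|apply/funext => w; rewrite big_nil].
case Pi : (P i).
  rewrite (_ : (fun w => _) = (fun w => F i w + \sum_(i <- s | P i) F i w)).
    by apply: cdiffD => //; exact: dF.
  by apply/funext => w; rewrite big_cons Pi.
rewrite (_ : (fun w => _) = (fun w => \sum_(i <- s | P i) F i w))//.
by apply/funext => w; rewrite big_cons Pi.
Qed.

Lemma cdiff_prod (I : Type) (s : seq I) (P : pred I) (F : I -> V -> R[i]) z :
  (forall i, P i -> cdiff (F i) z) -> cdiff (fun w => \prod_(i <- s | P i) F i w) z.
Proof.
move=> dF; elim: s => [|i s IH].
  by rewrite (_ : (fun w => _) = (fun=> 1)); [exact: cdiff_cst|apply/funext => w; rewrite big_nil].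
case Pi : (P i).
  rewrite (_ : (fun w => _) = (fun w => F i w * \prod_(i <- s | P i) F i w)).
    by apply: cdiffM => //; exact: dF.
  by apply/funext => w; rewrite big_cons Pi.
rewrite (_ : (fun w => _) = (fun w => \prod_(i <- s | P i) F i w))//.
by apply/funext => w; rewrite big_cons Pi.
Qed.

Lemma cdiff_comp (W : normedModType R[i]) (h : W -> V) f (z : W) :
  differentiable h z -> cdiff f (h z) -> cdiff (fun w => f (h w)) z.
Proof. exact: (@differentiable_comp _ W V (R[i]^o)). Qed.

Lemma cdiff_cexp f z : cdiff f z -> cdiff (fun w => cexp (f w)) z.
Proof.
move=> df; apply: (@differentiable_comp _ V (R[i]^o) (R[i]^o) f (@cexp R)) => //.
exact: differentiable_cexp.
Qed.

Lemma cdiff_comp1 (h : R[i] -> R[i]) f z : cdiff f z ->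
  cdiff (h : R[i]^o -> R[i]) (f z : R[i]^o) -> cdiff (fun w => h (f w)) z.
Proof. exact: (@differentiable_comp _ V (R[i]^o) (R[i]^o) f h). Qed.

Lemma cdiff_continuous f z : cdiff f z -> {for z, continuous (f : V -> R[i]^o)}.
Proof. exact: differentiable_continuous. Qed.

Lemma cdiff_id (z : R[i]^o) : cdiff (fun w : R[i]^o => (w : R[i])) z.
Proof. by rewrite /cdiff. Qed.

End ComplexDifferentiability.

Section OneComplexVariable.
Variable R : realType.

Lemma is_cderiv_near (f g : R[i] -> R[i]) z a (d : R) : 0 < d ->
  (forall w, cabs (w - z) < d -> f w = g w) -> is_cderiv f z a -> is_cderiv g z a.
Proof.
move=> d0 fg H e e0; have [d' d'0 {}H] := H e e0.
exists (Num.min d d') => [|h]; first by rewrite lt_min d0.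
rewrite lt_min => /andP[h1 h2]; have := H h h2.
by rewrite !fg// ?subrr ?cabs0// addrC addKr.
Qed.

Lemma near_cdiff1 (f g : R[i]^o -> R[i]) (z : R[i]^o) :
  (\forall w \near z, f w = g w) -> cdiff f z -> cdiff g z.
Proof.
move=> /nearC_cabs[d d0 fg] /differentiableC[a H]; apply/differentiableC; exists a.
exact: is_cderiv_near fg H.
Qed.

End OneComplexVariable.

(** * Unconditional sums *)

Section UnconditionalSums.
Variable R : realType.
Implicit Types (t : int -> R[i]) (u : int -> R) (s : R[i]) (A B : {fset int}).

(** Convergence along finite subsets with real tolerances; [has_sum_sum] links it to the sum in
    [theta_char]. *)
Definition has_sum t s := forall e : R, 0 < e -> exists A, forall B, (A `<=` B)%fset ->
  cabs (\sum_(k <- B) t k - s) <= e.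

(** Summability of a nonnegative majorant without naming its limit. *)
Definition bounded_sums u (M : R) := (forall k, 0 <= u k) /\
  forall B, \sum_(k <- B) u k <= M.

Lemma has_sum_sum t s :
  has_sum t s -> summability.sum (fun k => t k : R[i]^o) = s.
Proof.
move=> ts; have FF := @totally_filter int.
apply: (@cvg_lim (R[i]^o) (@norm_hausdorff _ (R[i]^o))).
suff : partial_sum (fun k => t k : R[i]^o) @ totally --> (s : R[i]^o) by [].
apply/cvgrPdist_le => -[e ei]; rewrite ltcE /= => /andP[/eqP ->].
rewrite complexr0 => e0; have [A HA] := ts e e0.
exists A => //= B AB; rewrite normC_cabs lecR cabsB /partial_sum.
by have := HA B AB; rewrite big_seq_fsetE.
Qed.

Lemma has_sum_uniq t s s' : has_sum t s -> has_sum t s' -> s = s'.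
Proof. by move=> /has_sum_sum <- /has_sum_sum <-. Qed.

Lemma has_sum_ext t t' s : t =1 t' -> has_sum t s -> has_sum t' s.
Proof. by move=> /funext ->. Qed.

Lemma has_sumD t t' s s' :
  has_sum t s -> has_sum t' s' -> has_sum (fun k => t k + t' k) (s + s').
Proof.
move=> ts ts' e e0; have e20 : 0 < e / 2 by rewrite divr_gt0.
have [A HA] := ts _ e20; have [A' HA'] := ts' _ e20.
exists (A `|` A')%fset => B; rewrite fsubUset => /andP[AB AB'].
rewrite big_split /= opprD addrACA (le_trans (ler_cabsD _ _))//.
by rewrite [leRHS]splitr lerD ?HA ?HA'.
Qed.

Lemma has_sumZ (c : R[i]) t s : has_sum t s -> has_sum (fun k => c * t k) (c * s).
Proof.
move=> ts e e0; have c0 : 0 < cabs c + 1 by rewrite ltr_wpDl ?cabs_ge0.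
have [|A HA] := ts (e / (cabs c + 1)); first by rewrite divr_gt0.
exists A => B /HA; rewrite -mulr_sumr -mulrBr cabsM ler_pdivlMr// => /(le_trans _); apply.
by rewrite mulrC ler_wpM2l ?cabs_ge0// lerDl.
Qed.

Lemma has_sumB t t' s s' :
  has_sum t s -> has_sum t' s' -> has_sum (fun k => t k - t' k) (s - s').
Proof.
move=> ts /(has_sumZ (-1)) ts'; rewrite -mulN1r.
by apply: has_sum_ext (has_sumD ts ts') => k; rewrite mulN1r.
Qed.

(** The source of the functional equations of theta: translating or reflecting the summation index
    changes nothing. *)
Lemma has_sum_reindex t s (f g : int -> int) : cancel f g -> cancel g f ->
  has_sum t s -> has_sum (fun k => t (f k)) s.
Proof.
move=> fK gK ts e e0; have [A HA] := ts e e0.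
exists [fset g k | k in A]%fset => B AB.
have -> : \sum_(k <- B) t (f k) = \sum_(k <- [fset f k | k in B]%fset) t k.
  by rewrite big_imfset//= => x y _ _; exact: can_inj fK _ _.
apply: HA; apply/fsubsetP => k kA; apply/imfsetP; exists (g k); rewrite ?gK//=.
by apply: (fsubsetP AB); apply/imfsetP; exists k.
Qed.

Lemma has_sum_finite t A : (forall k, k \notin A -> t k = 0) ->
  has_sum t (\sum_(k <- A) t k).
Proof.
move=> t0 e e0; exists A => B AB; rewrite (big_fset_incl _ AB) ?subrr ?cabs0 ?ltW//.
by move=> k kB kA; rewrite t0.
Qed.

Lemma has_sum_bound t u M s : bounded_sums u M ->
  (forall k, cabs (t k) <= u k) -> has_sum t s -> cabs s <= M.
Proof.
move=> [u0 uM] tu ts; apply/ler_addgt0Pr => e e0; have [A HA] := ts e e0.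
have /HA : (A `<=` A)%fset by [].
set S := \sum_(k <- A) t k => H; rewrite -(subrK S s) (le_trans (ler_cabsD _ _))//.
rewrite addrC lerD//; last by rewrite cabsB.
by rewrite (le_trans (ler_cabs_sum _ _ _))// (le_trans _ (uM A))// ler_sum.
Qed.

Lemma sum_fsetU (V : nmodType) (t : int -> V) A B :
  \sum_(k <- (A `|` B)%fset) t k =
    \sum_(k <- A) t k + \sum_(k <- (B `\` A)%fset) t k.
Proof.
rewrite (@big_fsetID _ _ _ _ (mem A)) /=; congr (_ + _); apply: eq_fbigl => k.
  by rewrite !inE /=; case: (k \in A); rewrite ?andbF.
by rewrite !inE /=; case: (k \in A); rewrite ?andbF ?andbT.
Qed.

Lemma sum_fset_le u A B : (forall k, 0 <= u k) -> (A `<=` B)%fset ->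
  \sum_(k <- A) u k <= \sum_(k <- B) u k.
Proof.
move=> u0 /fsetUidPr <-; rewrite sum_fsetU lerDl.
exact: sumr_ge0.
Qed.

Lemma has_sum_ge0 u M : bounded_sums u M ->
  exists s, has_sum (fun k => (u k)%:C) s.
Proof.
move=> [u0 uM]; pose E := [set \sum_(k <- B) u k | B in [set: {fset int}]].
have supE : has_sup E.
  by split; [exists (\sum_(k <- fset0%fset) u k); exists fset0%fset|exists M => _ [B _ <-]].
exists (sup E)%:C => e e0; have [_ [A _ <-] HA] := sup_adherent e0 supE.
exists A => B AB; rewrite -rmorph_sum -rmorphB cabs_real ler_norml.
have H1 : \sum_(k <- B) u k <= sup E by apply: sup_upper_bound => //; exists B.
have H2 := sum_fset_le u0 AB; rewrite lerBlDr.
have H3 : sup E <= sup E by [].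
apply/andP; split; first by rewrite lerNl opprB; lra.
by lra.
Qed.

Lemma bounded_sums_le u u' M : (forall k, 0 <= u' k <= u k) ->
  bounded_sums u M -> bounded_sums u' M.
Proof.
move=> uu [u0 uM]; split=> [k|B]; first by case/andP: (uu k).
by rewrite (le_trans _ (uM B))// ler_sum// => k _; case/andP: (uu k).
Qed.

Lemma bounded_sumsZ u M (c : R) : 0 <= c -> bounded_sums u M ->
  bounded_sums (fun k => c * u k) (c * M).
Proof.
move=> c0 [u0 uM]; split=> [k|B]; first by rewrite mulr_ge0.
by rewrite -mulr_sumr ler_wpM2l.
Qed.

Lemma has_sum_exists t u M : bounded_sums u M ->
  (forall k, cabs (t k) <= u k) -> exists s, has_sum t s.
Proof.
move=> uM tu.
have re (x : int -> R) : (forall k, `|x k| <= u k) ->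
    exists s, has_sum (fun k => (x k)%:C) s.
  move=> xu.
  (* x = (x + |x|) - |x| is a difference of nonnegative families with bounded sums. *)
  have xB : bounded_sums (fun k => `|x k|) M.
    by apply: bounded_sums_le uM => k; rewrite normr_ge0 xu.
  have xP : bounded_sums (fun k => x k + `|x k|) (2 * M).
    apply: bounded_sums_le (bounded_sumsZ (ler0n _ 2) uM) => k.
    have := xu k; have := ler_norm (x k); have := ler_norm (- x k); rewrite normrN.
    by move=> ? ? ?; apply/andP; split; lra.
  have [s1 H1] := has_sum_ge0 xP; have [s2 H2] := has_sum_ge0 xB.
  exists (s1 - s2); apply: has_sum_ext (has_sumB H1 H2) => k.
  by rewrite -rmorphB addrK.
have [s1 H1] := re _ (fun k => le_trans (cabs_Re (t k)) (tu k)).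
have [s2 H2] := re _ (fun k => le_trans (cabs_Im (t k)) (tu k)).
exists (s1 + 'i * s2); apply: has_sum_ext (has_sumD H1 (has_sumZ 'i H2)) => k.
by rewrite -complexE.
Qed.

(** If A approximates the sum within e / 2, so does A with B added; the sum over B is the difference
    of the two. *)
Lemma bounded_sums_tail u M (e : R) : bounded_sums u M -> 0 < e ->
  exists A, forall B, [disjoint A & B]%fset -> \sum_(k <- B) u k <= e.
Proof.
move=> uM e0; have [s us] := has_sum_ge0 uM; have [u0 _] := uM.
have e20 : 0 < e / 2 by rewrite divr_gt0.
have [A HA] := us _ e20; exists A => B AB.
have := HA (A `|` B)%fset (fsubsetUl _ _); have := HA A (fsubset_refl _).
have -> : \sum_(k <- (A `|` B)%fset) (u k)%:C
    = \sum_(k <- A) (u k)%:C + \sum_(k <- B) (u k)%:C.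
  rewrite sum_fsetU; congr (_ + _); apply: eq_fbigl => k; rewrite !inE.
  by case: (boolP (k \in A)) => //= /(fdisjointP AB)/negPf ->.
move=> H1 H2.
have : cabs (\sum_(k <- B) (u k)%:C) <= e.
  set a := \sum_(k <- A) _ in H1 H2; set b := \sum_(k <- B) _ in H2 *.
  have -> : b = (a + b - s) - (a - s) by ring.
  by rewrite (le_trans (ler_cabsB _ _))// [leRHS]splitr lerD.
by rewrite -rmorph_sum cabs_real ger0_norm// sumr_ge0.
Qed.

(** Tannery's theorem, dominated convergence for series. The shares e / 3 go to a finite set
    carrying all but a small part of the majorant, to the remaining terms, and to the distance of a
    finite partial sum from the sum. *)
Lemma has_sum_dominated_cvg0 (v : nat -> int -> R[i]) (s : nat -> R[i]) u M :
  bounded_sums u M -> (forall N k, cabs (v N k) <= u k) ->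
  (forall k (e : R), 0 < e ->
     exists N0, forall N, (N0 <= N)%N -> cabs (v N k) <= e) ->
  (forall N, has_sum (v N) (s N)) ->
  forall e : R, 0 < e -> exists N0, forall N, (N0 <= N)%N -> cabs (s N) <= e.
Proof.
move=> uM vu v0 vs e e0; have e30 : 0 < e / 3 by rewrite divr_gt0.
have [A HA] := bounded_sums_tail uM e30.
have [N0 HN0] : exists N0, forall N, (N0 <= N)%N ->
    cabs (\sum_(k <- A) v N k) <= e / 3.
  (* One N0 for the finitely many k in A; the successor of the size keeps the share positive when A
     is empty. *)
  have [N0 H] : exists N0, forall N, (N0 <= N)%N ->
      forall k, k \in A -> cabs (v N k) <= e / 3 / (size A).+1%:R.
    have := divr_gt0 e30 (ltr0Sn R (size A)); set d := _ / _ => d0.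
    suff [N0 H] : exists N0, forall N, (N0 <= N)%N ->
        forall k, k \in (A : seq int) -> cabs (v N k) <= d by exists N0.
    elim: (A : seq int) => [|a l [N1 H1]]; first by exists 0%N.
    have [N2 H2] := v0 a d d0.
    exists (maxn N1 N2) => N; rewrite geq_max => /andP[n1 n2] k.
    by rewrite inE => /orP[/eqP ->|]; [exact: H2|exact: H1].
  exists N0 => N /H {}H; rewrite (le_trans (ler_cabs_sum _ _ _))//.
  rewrite big_seq (le_trans (ler_sum _ H))// -big_seq.
  rewrite big_const_seq iter_addr_0 count_predT -[leLHS]mulr_natr -[leLHS]mulrA.
  rewrite ler_piMr ?(ltW e30)// [leLHS]mulrC ler_pdivrMr ?ltr0Sn// mul1r ler_nat.
  exact: leqnSn.
exists N0 => N /HN0 H1; have [B HB] := vs N _ e30.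
have {}HB := HB _ (fsubsetUr A B).
set S := \sum_(k <- _) v N k in HB.
have E : S = \sum_(k <- A) v N k + \sum_(k <- (B `\` A)%fset) v N k.
  exact: sum_fsetU.
have H2 : cabs (\sum_(k <- (B `\` A)%fset) v N k) <= e / 3.
  rewrite (le_trans (ler_cabs_sum _ _ _))//.
  rewrite (le_trans (ler_sum _ (fun k _ => vu N k)))// HA//.
  by apply/fdisjointP => k kA; rewrite in_fsetD kA.
have : cabs S <= e / 3 + e / 3 by rewrite E (le_trans (ler_cabsD _ _))// lerD.
have := ler_cabsB S (S - s N); rewrite opprB addrC subrK => H3 H4.
by lra.
Qed.

Lemma bounded_sums_geom (r : R) : 0 <= r < 1 ->
  bounded_sums (fun k : int => r ^+ `|k|%N) (2 / (1 - r)).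
Proof.
move=> /andP[r0 r1]; have r1' : 0 < 1 - r by rewrite subr_gt0.
split=> [k|B]; first exact: exprn_ge0.
have [N BN] : exists N, forall k, k \in B -> (`|k|%N < N)%N.
  exists (\max_(k <- B) `|k|%N).+1 => k kB.
  by rewrite ltnS (big_rem _ (kB : k \in (B : seq int)))/= leq_maxl.
(* [L] contains every index of B. [Negz n] is -(n + 1), so its term r^(n + 1) is at most r^n, and
   each half is bounded by a geometric series. *)
pose L := [seq Posz n | n <- iota 0 N] ++ [seq Negz n | n <- iota 0 N].
have uL : uniq L.
  rewrite cat_uniq !map_inj_uniq ?iota_uniq//=; try by move=> ? ? [].
  rewrite andbT; apply/hasPn => k /mapP[n _ ->]; apply/negP => /mapP[n' _].
  by [].
have BL k : k \in B -> k \in L.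
  move=> /BN; rewrite mem_cat; case: k => n /=; rewrite ?NegzE => H.
    by apply/orP; left; apply: map_f; rewrite mem_iota.
  apply/orP; right; rewrite -NegzE; apply: map_f; rewrite mem_iota /=.
  by rewrite add0n ltnW.
have le1 : \sum_(k <- B) r ^+ `|k| <= \sum_(k <- L) r ^+ `|k|.
  rewrite (perm_big (seq.filter (mem B) L)) /=; last first.
    apply: uniq_perm; rewrite ?fset_uniq ?filter_uniq// => k.
    by rewrite mem_filter /=; apply/idP/andP => [kB|[]//]; split=> //; exact: BL.
  rewrite big_filter [leRHS](bigID (mem B)) /= lerDl sumr_ge0// => k _.
  exact: exprn_ge0.
have geo : \sum_(n <- iota 0 N) r ^+ n <= (1 - r)^-1.
  have -> : iota 0 N = index_iota 0 N by rewrite /index_iota subn0.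
  rewrite big_mkord -(ler_pM2l r1') mulfV ?gt_eqF// -[1 - r]opprB mulNr -subrX1 opprB.
  by rewrite lerBlDr lerDl exprn_ge0.
rewrite (le_trans le1)// big_cat !big_map /= mulr_natl mulr2n lerD//.
rewrite (le_trans _ geo)// ler_sum// => n _.
by rewrite exprS ler_piMl// ?exprn_ge0// ltW.
Qed.

End UnconditionalSums.

(** * The theta series *)

Section ThetaSeries.
Variable R : realType.
Implicit Types (z w tau : R[i]) (alpha beta : R).

Definition theta_term alpha beta z tau (k : int) : R[i] :=
  cexp (ipi R * tau * (k%:~R + alpha%:C) ^+ 2
        + 2 * ipi R * (k%:~R + alpha%:C) * (z + beta%:C)).

Lemma half_real : (2^-1 : R)%:C = 2^-1.
Proof. by rewrite fmorphV rmorph_nat. Qed.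

(** The Gaussian factor beats exp (B |k + alpha|); this extra exponential later absorbs the powers
    of k + alpha and the exponentials produced by Taylor expansion in z. *)
Lemma theta_term_dominated alpha beta tau z (B : R) :
  0 < Im tau -> 0 <= B -> exists u M, bounded_sums u M /\
    forall k : int, cabs (theta_term alpha beta z tau k)
      * expR (B * cabs (k%:~R + alpha%:C)) <= u k.
Proof.
move=> tau0 B0; pose y := Im z.
(* 2 pi |y| and B collect the linear growth in |s|; the extra 1 leaves exp (- |s|), hence a
   geometric majorant. Completing the square bounds C |s| - pi Im tau s^2 by the first term of the
   exponent in [K]. *)
pose C := 2 * pi * `|y| + B + 1.
pose K := expR (C ^+ 2 / (4 * (pi * Im tau)) + `|alpha|).
have e1 : 0 <= expR (- 1 : R) < 1 by rewrite expR_ge0 expR_lt1 oppr_lt0 ltr01.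
exists (fun k => K * expR (-1) ^+ `|k|%N), (K * (2 / (1 - expR (-1)))).
split; first by apply: bounded_sumsZ; [exact: expR_ge0|exact: bounded_sums_geom].
move=> k; rewrite cabs_cexp -expRD -expRM_natl -expRD ler_expR.
have -> : cabs (k%:~R + alpha%:C) = `|k%:~R + alpha|.
  by rewrite -(rmorph_int (real_complex R)) -rmorphD cabs_real.
rewrite -(rmorph_int (real_complex R)) -rmorphD /=.
set s := k%:~R + alpha.
rewrite expr2 !ReImE /= !(mulr0, mul0r, add0r, addr0, subr0, oppr0, sub0r).
rewrite -/y mulNr -[X in X <= _]addrA.
have p0 : 0 < pi * Im tau by rewrite mulr_gt0// pi_gt0.
have H1 : - (2 * pi * s * y) <= 2 * pi * `|y| * `|s|.
  rewrite -!mulrA -mulrN ler_wpM2l// -mulrN ler_wpM2l ?pi_ge0//.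
  by rewrite -normrM mulrC -normrN ler_norm.
have H2 : C * `|s| - pi * Im tau * (s * s) <= C ^+ 2 / (4 * (pi * Im tau)).
  rewrite ler_pdivlMr; last exact: mulr_gt0.
  have -> : s * s = `|s| ^+ 2 by rewrite real_normK ?num_real// expr2.
  have : 0 <= (C - 2 * (pi * Im tau) * `|s|) ^+ 2 by rewrite sqr_ge0.
  by lra.
have H3 : (`|k|%N)%:R <= `|s| + `|alpha|.
  have -> : (`|k|%N)%:R = `|k%:~R| :> R by rewrite -intr_norm natr_absz.
  by rewrite -[X in `|X| <= _](addrK alpha) -/s ler_normB.
rewrite [in X in X - _]/C in H2; move: H1 H2 H3.
by lra.
Qed.

Lemma exprn_le_expR (x : R) n : 0 <= x -> x ^+ n <= expR (n%:R * x).
Proof.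
move=> x0; rewrite expRM_natl lerXn2r ?nnegrE ?expR_ge0//.
by rewrite (le_trans _ (expR_ge1Dx _))// lerDr.
Qed.

(* Second-order Taylor expansion, with a cubic remainder: enough to divide by a
   simple zero and keep a differentiable quotient. *)
Definition taylor2 (f : R[i] -> R[i]) z (a b : R[i]) := exists K : R,
  forall h, cabs h <= 1 ->
    cabs (f (z + h) - f z - a * h - b * h ^+ 2) <= K * cabs h ^+ 3.

(** The series is expanded term by term, the Taylor remainders of the exponential being dominated
    uniformly for |h| <= 1. *)
Lemma theta_term_taylor alpha beta tau z : 0 < Im tau ->
  has_sum (theta_term alpha beta z tau) (theta_char alpha beta z tau) /\
  exists a b, taylor2 (fun w => theta_char alpha beta w tau) z a b.
Proof.
move=> tau0; pose f w := theta_char alpha beta w tau.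
pose a k : R[i] := 2 * ipi R * (k%:~R + alpha%:C).
have hs w : has_sum (theta_term alpha beta w tau) (f w).
  have [u [M [uM tu]]] := @theta_term_dominated alpha beta tau w 0 tau0 (lexx _).
  have [|s ts] := @has_sum_exists _ (theta_term alpha beta w tau) _ _ uM.
    by move=> k; have := tu k; rewrite mul0r expR0 mulr1.
  by rewrite /f /theta_char (has_sum_sum ts).
split; first exact: hs.
(* |a k| is 2 pi |k + alpha|. Of the four copies of |a k| in the exponent, three absorb |a k|^3 and
   one absorbs exp |a k h|. *)
have [|u [M [uM tu]]] := @theta_term_dominated alpha beta tau z (4 * (2 * pi)) tau0.
  by rewrite !mulr_ge0// pi_ge0.
pose t k := theta_term alpha beta z tau k.
have thE h k : theta_term alpha beta (z + h) tau k = t k * cexp (a k * h).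
  by rewrite -cexpD; congr cexp; rewrite /a; ring.
have hs0 : has_sum t (f z) by exact: hs.
have {}tu k : cabs (t k) * expR (4 * cabs (a k)) <= u k.
  by rewrite /a cabs_2ipi mulrA; exact: tu.
clearbody t a.
have ta n k : (n <= 3)%N -> cabs (t k * a k ^+ n) <= u k.
  move=> n3; rewrite (le_trans _ (tu k))// cabsM cabsX ler_wpM2l ?cabs_ge0//.
  rewrite (le_trans (exprn_le_expR _ (cabs_ge0 _)))// ler_expR.
  by rewrite ler_wpM2r ?cabs_ge0// ler_nat (leq_trans n3).
have [L1 H1] := has_sum_exists uM (fun k => @ta 1%N k isT).
have [L2 H2] := has_sum_exists uM (fun k => @ta 2%N k isT).
exists L1, (2^-1 * L2), (8 * M) => h h1.
have := has_sumB (has_sumB (has_sumB (hs (z + h)) hs0) (has_sumZ h H1))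
  (has_sumZ (h ^+ 2 / 2) H2).
have -> : f (z + h) - f z - h * L1 - h ^+ 2 / 2 * L2 =
  f (z + h) - f z - L1 * h - 2^-1 * L2 * h ^+ 2 by ring.
rewrite (_ : 8 * M * cabs h ^+ 3 = 8 * cabs h ^+ 3 * M); last by ring.
apply: has_sum_bound.
  by apply: bounded_sumsZ uM; rewrite mulr_ge0 ?exprn_ge0 ?cabs_ge0.
move=> k.
rewrite thE.
have -> : t k * cexp (a k * h) - t k - h * (t k * a k ^+ 1)
   - h ^+ 2 / 2 * (t k * a k ^+ 2)
  = t k * (cexp (a k * h) - 1 - a k * h - (a k * h) ^+ 2 / 2)
  by move: (a k) (t k) (cexp _) => A T E; field.
rewrite cabsM.
have H := cexp_taylor3 (a k * h).
rewrite (le_trans (ler_wpM2l (cabs_ge0 _) H))//.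
rewrite cabsM exprMn.
have -> : cabs (t k) * (8 * (cabs (a k) ^+ 3 * cabs h ^+ 3) * expR (cabs (a k) * cabs h))
  = 8 * cabs h ^+ 3 * (cabs (t k) * (cabs (a k) ^+ 3 * expR (cabs (a k) * cabs h))) by ring.
rewrite ler_wpM2l ?mulr_ge0 ?exprn_ge0 ?cabs_ge0//.
rewrite (le_trans _ (tu k))// ler_wpM2l ?cabs_ge0//.
rewrite (_ : 4 * _ = 3 * cabs (a k) + cabs (a k)); last by ring.
rewrite expRD ler_pM ?exprn_ge0 ?cabs_ge0 ?expR_ge0//.
  by apply: (@exprn_le_expR _ 3); exact: cabs_ge0.
by rewrite ler_expR ler_piMr ?cabs_ge0.
Qed.

Lemma theta_char_has_sum alpha beta tau z : 0 < Im tau ->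
  has_sum (theta_term alpha beta z tau) (theta_char alpha beta z tau).
Proof. by move=> tau0; have [] := theta_term_taylor alpha beta z tau0. Qed.

Lemma taylor2_is_cderiv f z a b : taylor2 f z a b -> is_cderiv f z a.
Proof.
move=> [K H]; apply: (@is_cderiv_quad _ _ _ _ (`|K| + cabs b)) => h h1.
have -> : f (z + h) - f z - a * h =
  (f (z + h) - f z - a * h - b * h ^+ 2) + b * h ^+ 2 by ring.
rewrite (le_trans (ler_cabsD _ _))// mulrDl lerD ?cabsM ?cabsX//.
rewrite (le_trans (H h (ltW h1)))// (le_trans (ler_wpM2r _ (ler_norm _)))//.
  by rewrite exprn_ge0 ?cabs_ge0.
rewrite ler_wpM2l// exprS ler_piMl ?exprn_ge0 ?cabs_ge0//.
exact: ltW.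
Qed.

Lemma theta_char_differentiable alpha beta tau z : 0 < Im tau ->
  cdiff (fun w : R[i]^o => theta_char alpha beta w tau) z.
Proof.
move=> tau0; have [_ [a [b /taylor2_is_cderiv H]]] := theta_term_taylor alpha beta z tau0.
by apply/differentiableC; exists a.
Qed.

Lemma theta_char_add1 alpha beta tau z : 0 < Im tau ->
  theta_char alpha beta (z + 1) tau =
    cexp (2 * ipi R * alpha%:C) * theta_char alpha beta z tau.
Proof.
move=> tau0; apply: has_sum_uniq (theta_char_has_sum _ _ _ tau0) _.
apply: has_sum_ext (has_sumZ _ (theta_char_has_sum _ _ _ tau0)) => k.
rewrite /theta_term -[LHS]mul1r -{1}(cexp2pii_int R k) -!cexpD; congr cexp; ring.
Qed.

(** Completing the square in the exponent: adding tau to z amounts to raising the index k by 1. *)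
Lemma theta_char_addtau alpha beta tau z : 0 < Im tau ->
  theta_char alpha beta (z + tau) tau =
    cexp (- (ipi R * tau) - 2 * ipi R * (z + beta%:C)) * theta_char alpha beta z tau.
Proof.
move=> tau0; apply: has_sum_uniq (theta_char_has_sum _ _ _ tau0) _.
have := has_sum_reindex (addrK 1) (subrK 1)
  (theta_char_has_sum alpha beta z tau0).
move=> /(has_sumZ (cexp (- (ipi R * tau) - 2 * ipi R * (z + beta%:C)))).
apply: has_sum_ext => k; rewrite /theta_term -cexpD; congr cexp.
by rewrite rmorphD /=; ring.
Qed.

(** The index change k to -1 - k sends k + 1/2 to its opposite; the characteristic beta = 1/2 then
    leaves exp (2 pi i (k + 1/2)) = -1. *)
Lemma theta_opp tau z : 0 < Im tau -> theta tau (- z) = - theta tau z.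
Proof.
move=> tau0; apply: has_sum_uniq (theta_char_has_sum _ _ _ tau0) _.
pose f (k : int) : int := - 1 - k.
have fK : cancel f f by move=> k; rewrite /f; ring.
have := has_sum_reindex fK fK (theta_char_has_sum (2^-1) (2^-1) z tau0).
move=> /(has_sumZ (-1)); rewrite mulN1r; apply: has_sum_ext => k.
have -> : -1 = cexp (ipi R).
  by apply: complex_eq; rewrite /cexp /= expR0 ?cospi ?sinpi !mul1r// oppr0.
rewrite /theta_term -[LHS]mul1r -{1}(cexp2pii_int R k) -!cexpD; congr cexp.
by rewrite /f half_real !(rmorphD, rmorphN) /=; field.
Qed.

(** A translation of z moves alpha and beta to 1/2 up to a nonvanishing factor, so the zeros of
    [theta] decide those of every [theta_char]. *)
Lemma theta_char_theta alpha beta tau z : 0 < Im tau ->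
  theta_char alpha beta z tau =
  cexp (ipi R * tau * (alpha%:C - 2^-1) ^+ 2
        + 2 * ipi R * (alpha%:C - 2^-1) * (z + beta%:C))
  * theta tau (z + beta%:C - 2^-1 + (alpha%:C - 2^-1) * tau).
Proof.
move=> tau0; apply: has_sum_uniq (theta_char_has_sum _ _ _ tau0) _.
apply: has_sum_ext (has_sumZ _ (theta_char_has_sum _ _ _ tau0)) => k.
by rewrite /theta_term -!cexpD half_real; congr cexp; field.
Qed.

End ThetaSeries.

(** * q-products and q-binomial coefficients *)

Section InfiniteProducts.
Variable R : realType.
Implicit Types (y : nat -> R[i]) (r K : R).

Lemma sum_geom_le r n : 0 <= r < 1 -> \sum_(j < n) r ^+ j <= (1 - r)^-1.
Proof.
move=> /andP[r0 r1]; have r1' : 0 < 1 - r by rewrite subr_gt0.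
rewrite -(ler_pM2l r1') mulfV ?gt_eqF// -[1 - r]opprB mulNr -subrX1 opprB.
by rewrite lerBlDr lerDl exprn_ge0.
Qed.

Lemma exprn_small r (e : R) : 0 <= r < 1 -> 0 < e ->
  exists N, forall n, (N <= n)%N -> r ^+ n <= e.
Proof.
move=> /andP[r0 r1] e0; have : `|r| < 1 by rewrite ger0_norm.
move=> /cvg_expr /cvgrPdist_le /(_ e e0) [N _ H]; exists N => n Nn.
by have := H n Nn; rewrite sub0r normrN ger0_norm// exprn_ge0.
Qed.

Lemma prod_1B_upper y r K : 0 <= r < 1 -> 0 <= K ->
  (forall j, cabs (y j) <= K * r ^+ j) ->
  forall n, cabs (\prod_(j < n) (1 - y j)) <= expR (K / (1 - r)).
Proof.
move=> r01 K0 yK n; rewrite cabs_prod.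
have : \prod_(j < n) cabs (1 - y j) <= expR (\sum_(j < n) K * r ^+ j).
  rewrite expR_sum; apply: ler_prod => j _; rewrite cabs_ge0 /=.
  rewrite (le_trans (ler_cabsB _ _))// cabs1 (le_trans _ (expR_ge1Dx _))//.
  by rewrite lerD2l.
move=> /le_trans; apply; rewrite ler_expR -mulr_sumr ler_wpM2l//.
exact: sum_geom_le.
Qed.

Lemma prod_1B_weierstrass (a : nat -> R) n : (forall j, 0 <= a j <= 1) ->
  1 - \sum_(j < n) a j <= \prod_(j < n) (1 - a j).
Proof.
move=> a01; elim: n => [|n IH]; first by rewrite !big_ord0 subr0.
rewrite !big_ord_recr /=; have /andP[a0 a1] := a01 n.
have P1 : \prod_(j < n) (1 - a j) <= 1.
  by apply: prodr_ile1 => j _; have /andP[? ?] := a01 j; rewrite subr_ge0; apply/andP; split=> //; lra.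
set P := \prod_(j < n) _ in IH P1 *; set S := \sum_(j < n) _ in IH *.
have : P * a n <= a n by rewrite ler_piMl.
by lra.
Qed.

(** From some index J on, the |y j| sum to at most 1/2 and the Weierstrass inequality bounds the
    tail product below by 1/2; the finitely many earlier factors are nonzero. *)
Lemma prod_1B_lower y r K : 0 <= r < 1 -> 0 <= K ->
  (forall j, cabs (y j) <= K * r ^+ j) -> (forall j, y j != 1) ->
  exists2 d : R, 0 < d & forall n, d <= cabs (\prod_(j < n) (1 - y j)).
Proof.
move=> r01 K0 yK y1; have /andP[r0 r1] := r01.
have r1' : 0 < 1 - r by rewrite subr_gt0.
(* Chosen so that K r^J / (1 - r) <= 1/2; K + 1 avoids a division by 0. *)
have [J HJ] := @exprn_small r ((1 - r) / (2 * (K + 1))) r01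
  (divr_gt0 r1' (mulr_gt0 (ltr0Sn R 1) (ltr_wpDl K0 ltr01))).
have tail n : \sum_(j < n) K * r ^+ (J + j) <= 2^-1.
  under eq_bigr do rewrite exprD mulrA.
  rewrite -mulr_sumr; have := sum_geom_le n r01; have := HJ J (leqnn _).
  set S := \sum_(j < n) _; rewrite ler_pdivlMr; last by rewrite mulr_gt0// ltr_wpDl.
  move=> H1; rewrite -[leRHS]mul1r ler_pdivlMr// => H2.
  have S0 : 0 <= S by apply: sumr_ge0 => j _; exact: exprn_ge0.
  have rJ0 : 0 <= r ^+ J by exact: exprn_ge0.
  have : r ^+ J * (2 * (K + 1)) * S <= 1 by rewrite (le_trans _ H2)// mulrC ler_wpM2l.
  have : 0 <= r ^+ J * S by rewrite mulr_ge0.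
  by lra.
have term j : K * r ^+ (J + j) <= 1.
  have := tail j.+1; rewrite big_ord_recr /= => H.
  have : 0 <= \sum_(i < j) K * r ^+ (J + i).
    by apply: sumr_ge0 => i _; rewrite mulr_ge0 ?exprn_ge0.
  by lra.
pose b j := cabs (1 - y j); have b0 j : 0 < b j by rewrite cabs_gt0 subr_eq0 eq_sym.
(* The minima with 1 make [c] a lower bound for the shorter partial products too. *)
pose c := \prod_(j < J) Num.min 1 (b j).
have c0 : 0 < c by apply: prodr_gt0 => j _; rewrite lt_min ltr01 b0.
exists (c / 2); first by rewrite divr_gt0.
move=> n; rewrite cabs_prod.
have [nJ|/ltnW Jn] := leqP n J.
  rewrite (@le_trans _ _ c)//; first by rewrite ler_pdivrMr// ler_peMr ?ltW// ltr1n.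
  rewrite /c -(subnKC nJ) big_split_ord /= -[leRHS]mulr1.
  apply: ler_pM.
  - by apply: prodr_ge0 => j _; rewrite le_min ler01 ltW.
  - by apply: prodr_ge0 => j _; rewrite le_min ler01 ltW.
  - by apply: ler_prod => j _; rewrite le_min ler01 (ltW (b0 _)) ge_min lexx orbT.
  - by apply: prodr_ile1 => j _; rewrite le_min ler01 (ltW (b0 _)) ge_min lexx.
rewrite -(subnKC Jn) big_split_ord /=; apply: ler_pM => //; first exact: ltW.
  by apply: ler_prod => j _; rewrite le_min ler01 (ltW (b0 _)) ge_min lexx orbT.
set n' := (n - J)%N.
apply: (@le_trans _ _ (\prod_(j < n') (1 - K * r ^+ (J + j)))).
  have := @prod_1B_weierstrass (fun j => K * r ^+ (J + j)) n'.
  move=> /(_ _)/wrap[] => [j|]; first by rewrite term andbT mulr_ge0 ?exprn_ge0.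
  by have := tail n'; lra.
apply: ler_prod => j _; rewrite subr_ge0 term /=.
have := lerB_cabs 1 (y (J + j)%N); rewrite cabs1; have := yK (J + j)%N.
by lra.
Qed.

End InfiniteProducts.

Section QBinomial.
Variable (F : fieldType) (q : F).

(** Gaussian binomial coefficients, by the q-Pascal rule that arises when the last factor of the
    q-binomial product is multiplied out. Where the subtraction in the exponent truncates, the
    coefficient beside it is 0. *)
Fixpoint qbinom (n i : nat) : F :=
  match n, i with
  | _, 0%N => 1
  | 0%N, _.+1 => 0
  | n'.+1, i'.+1 => qbinom n' i'.+1 + q ^+ (n' - i') * qbinom n' i'
  end.

(** The q-Pochhammer symbol (q; q)_n. *)
Definition qpoch (n : nat) : F := \prod_(j < n) (1 - q ^+ j.+1).

Lemma qbinom0 n : qbinom n 0 = 1. Proof. by case: n. Qed.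

Lemma qbinom_small n i : (n < i)%N -> qbinom n i = 0.
Proof.
elim: n i => [|n IH] [|i]//= ni; rewrite ?IH ?mulr0 ?addr0//.
by rewrite leqW.
Qed.

(** The factorial formula without division, valid even at roots of unity. The induction rests on (1
    - q^(n-i)) + q^(n-i) (1 - q^(i+1)) = 1 - q^(n+1). *)
Lemma qbinom_qpoch n i : (i <= n)%N ->
  qbinom n i * qpoch i * qpoch (n - i) = qpoch n.
Proof.
have S m : qpoch m.+1 = qpoch m * (1 - q ^+ m.+1) by rewrite /qpoch big_ord_recr.
have Q0 : qpoch 0 = 1 by rewrite /qpoch big_ord0.
elim: n i => [|n IH] [|i] //= ni; rewrite ?Q0 ?mulr1 ?mul1r ?subn0// subSS.
have := ni; rewrite ltnS leq_eqVlt => /orP[/eqP ->|lin].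
  rewrite subnn expr0 qbinom_small// add0r mul1r S Q0 mulr1 mulrA.
  by have := IH n (leqnn n); rewrite subnn Q0 mulr1 => ->.
have H1 := IH i (ltnW lin); have H2 := IH i.+1 lin.
have E : (n - i)%N = (n - i.+1).+1 by rewrite subnS prednK// subn_gt0.
rewrite !mulrDl.
have -> : qbinom n i.+1 * qpoch i.+1 * qpoch (n - i)
   = qpoch n * (1 - q ^+ (n - i)) by rewrite {1}E (S (n - i.+1)%N) mulrA H2 -E.
have -> : q ^+ (n - i) * qbinom n i * qpoch i.+1 * qpoch (n - i)
   = q ^+ (n - i) * (1 - q ^+ i.+1) * qpoch n by rewrite (S i) -[in RHS]H1; ring.
rewrite S -[n.+1](subnK (leqW (ltnW lin : (i <= n)%N) : (i <= n.+1)%N)).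
have -> : (n.+1 - i + i = (n - i) + i.+1)%N by rewrite subSn ?(ltnW lin)// addSnnS.
by rewrite exprD; ring.
Qed.

(** The q-binomial theorem, with [s i] in the place of s 0 X^i q^(i(i-1)/2). Only the recurrence is
    kept, so that theta terms, with their half-integral characteristic, can be inserted directly. *)
Lemma gauss_qbinom (s : nat -> F) X n : (forall i, s i.+1 = X * q ^+ i * s i) ->
  \sum_(i < n.+1) qbinom n i * s i = s 0 * \prod_(j < n) (1 + X * q ^+ j).
Proof.
move=> sS; elim: n => [|n IH].
  by rewrite big_ord1 big_ord0 mul1r mulr1.
rewrite [X in s 0 * X]big_ord_recr /= mulrA -IH big_ord_recl /= mul1r.
under eq_bigr => i _ do rewrite /bump /= add1n mulrDl.
rewrite big_split /= addrA.
have -> : s 0 + \sum_(i < n.+1) qbinom n i.+1 * s i.+1 = \sum_(i < n.+1) qbinom n i * s i.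
  rewrite big_ord_recr /= qbinom_small// mul0r addr0 [RHS]big_ord_recl qbinom0 mul1r.
  by congr (_ + _); apply: eq_bigr => i _.
rewrite mulrDr mulr1; congr (_ + _); rewrite mulr_suml; apply: eq_bigr => i _.
have := ltn_ord i; rewrite ltnS => li; rewrite sS add0n.
have -> : q ^+ n = q ^+ (n - i) * q ^+ i by rewrite -exprD subnK.
by ring.
Qed.

End QBinomial.

(** * Bounds and limits of q-Pochhammer symbols and q-binomial coefficients *)

Section QPochhammerBounds.
Variables (R : realType) (q : R[i]).
Hypothesis q1 : cabs q < 1.
Let r := cabs q.
Let r01 : 0 <= r < 1. Proof. by rewrite /r cabs_ge0. Qed.

Lemma qpoch_bounds : exists m M : R, [/\ 0 < m, 0 < M &
  forall n, m <= cabs (qpoch q n) <= M].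
Proof.
have yK j : cabs (q ^+ j.+1) <= r * r ^+ j by rewrite cabsX exprS.
have r0 : 0 <= r by case/andP: r01.
have [|m m0 mP] := @prod_1B_lower R (fun j => q ^+ j.+1) r r r01 r0 yK.
  move=> j; apply/eqP => /(congr1 (@cabs R)); rewrite cabsX cabs1 => E.
  by have := exprn_ilt1 j.+1 r0 q1; rewrite E ltxx.
exists m, (expR (r / (1 - r))); split=> // [|n]; first exact: expR_gt0.
by rewrite mP; exact: (prod_1B_upper r01 r0 yK).
Qed.

(** Consecutive values differ by (q; q)_n q^(n+1), at most M r^n in modulus; the increments are
    summed geometrically. *)
Lemma qpoch_cauchy (e : R) : 0 < e -> exists N, forall a b,
  (N <= a)%N -> (N <= b)%N -> cabs (qpoch q a - qpoch q b) <= e.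
Proof.
move=> e0; have [m [M [m0 M0 mM]]] := qpoch_bounds.
have /andP[r0 r1] := r01; have r1' : 0 < 1 - r by rewrite subr_gt0.
have step n p : cabs (qpoch q (n + p) - qpoch q n) <= M / (1 - r) * (r ^+ n - r ^+ (n + p)).
  elim: p => [|p IH]; first by rewrite addn0 !subrr cabs0 mulr0.
  rewrite addnS; have -> : qpoch q (n + p).+1 = qpoch q (n + p) * (1 - q ^+ (n + p).+1).
    by rewrite /qpoch big_ord_recr.
  rewrite (_ : _ - _ = (qpoch q (n + p) - qpoch q n) - qpoch q (n + p) * q ^+ (n + p).+1); last by ring.
  rewrite (le_trans (ler_cabsB _ _))//.
  have H : cabs (qpoch q (n + p) * q ^+ (n + p).+1) <= M * r ^+ (n + p).
    rewrite cabsM cabsX; apply: ler_pM; rewrite ?cabs_ge0 ?exprn_ge0 ?cabs_ge0//.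
      by case/andP: (mM (n + p)%N).
    by rewrite exprS ler_piMl ?exprn_ge0// ltW.
  rewrite (le_trans (lerD IH H))//.
  have -> : M * r ^+ (n + p) = M / (1 - r) * (r ^+ (n + p) - r ^+ (n + p).+1).
    by rewrite exprS; field; rewrite gt_eqF.
  by rewrite -mulrDr subrKA.
have [|N HN] := @exprn_small R r (e * (1 - r) / M) r01; first by rewrite divr_gt0// mulr_gt0.
exists N => a b; wlog ba : a b / (b <= a)%N.
  move=> H Na Nb; have [/H->//|/ltnW/H] := leqP b a.
  by rewrite cabsB; apply.
move=> Na Nb; rewrite -(subnKC ba) (le_trans (step _ _))//.
rewrite (@le_trans _ _ (M / (1 - r) * r ^+ b))//.
  by rewrite ler_wpM2l ?divr_ge0 ?(ltW M0) ?(ltW r1')// gerBl exprn_ge0.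
have := HN b Nb; rewrite ler_pdivlMr// => H.
by rewrite mulrAC ler_pdivrMr// mulrC.
Qed.

Lemma qbinom_bound : exists2 M : R, 0 < M & forall n i, cabs (qbinom q n i) <= M.
Proof.
have [m [M [m0 M0 mM]]] := qpoch_bounds.
exists (M / m / m); first by rewrite !divr_gt0.
move=> n i; have [ni|ni] := leqP i n; last first.
  by rewrite qbinom_small// cabs0 !divr_ge0 ?ltW.
have := congr1 (@cabs R) (qbinom_qpoch q ni); rewrite !cabsM.
have /andP[m1 M1] := mM i; have /andP[m2 M2] := mM (n - i)%N.
have /andP[m3 M3] := mM n => E.
rewrite !ler_pdivlMr//.
rewrite -E in M3; apply: le_trans M3.
by rewrite ler_pM ?mulr_ge0 ?cabs_ge0 ?(ltW m0)// ler_pM ?cabs_ge0 ?(ltW m0).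
Qed.

(* All central coefficients [2N, N + k] have the same limit 1 / (q; q). *)
Lemma qbinom_central_cvg (j : nat) (e : R) : 0 < e -> exists N0, forall N,
  (N0 <= N)%N -> cabs (qbinom q (N + N) (N + j) - qbinom q (N + N) N) <= e /\
   cabs (qbinom q (N + N) (N - j) - qbinom q (N + N) N) <= e.
Proof.
move=> e0; have [m [M [m0 M0 mM]]] := qpoch_bounds.
have main : exists N0, forall N a b, (N0 <= a)%N -> (N0 <= b)%N -> (N0 <= N)%N ->
    (a + b = N + N)%N -> cabs (qbinom q (N + N) a - qbinom q (N + N) N) <= e.
  have K0 : 0 < 2 * M * M / m ^+ 4 by rewrite divr_gt0 ?mulr_gt0// exprn_gt0.
  have [N0 H0] := qpoch_cauchy (divr_gt0 e0 K0); exists N0 => N a b Na Nb NN ab.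
  have E1 := qbinom_qpoch q (leq_addl N N).
  have aN : (a <= N + N)%N by rewrite -ab leq_addr.
  have E2 := qbinom_qpoch q aN; have bE : (N + N - a = b)%N by rewrite -ab addKn.
  rewrite bE in E2; rewrite addnK in E1.
  have nz n : qpoch q n != 0.
    by rewrite -cabs_gt0 (lt_le_trans m0)//; case/andP: (mM n).
  (* Up to the factor (q; q)_2N, the numerator is (q; q)_N^2 - (q; q)_a (q; q)_b, split into two
     Cauchy differences. *)
  have -> : qbinom q (N + N) a - qbinom q (N + N) N =
    qpoch q (N + N) * (qpoch q N * (qpoch q N - qpoch q b)
       + qpoch q b * (qpoch q N - qpoch q a))
      / (qpoch q N * qpoch q N * qpoch q a * qpoch q b).
    have -> : qbinom q (N + N) a = qpoch q (N + N) / (qpoch q a * qpoch q b).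
      by rewrite -E2; field; rewrite !nz.
    have -> : qbinom q (N + N) N = qpoch q (N + N) / (qpoch q N * qpoch q N).
      by rewrite -E1; field; rewrite !nz.
    by field; rewrite !nz.
  rewrite cabsM cabsV ler_pdivrMr; last by rewrite cabs_gt0 !mulf_neq0.
  have /andP[a1 a2] := mM N; have /andP[b1 b2] := mM a; have /andP[c1 c2] := mM b.
  have /andP[d1 d2] := mM (N + N)%N.
  have m4 : m ^+ 4 <= cabs (qpoch q N * qpoch q N * qpoch q a * qpoch q b).
    rewrite !cabsM (_ : m ^+ 4 = m * m * m * m); last by ring.
    by rewrite !ler_pM ?mulr_ge0 ?(ltW m0).
  rewrite (@le_trans _ _ (e * m ^+ 4))//; last by rewrite ler_wpM2l ?(ltW e0).
  rewrite cabsM (@le_trans _ _ (M * (M * (e / (2 * M * M / m ^+ 4)) + M * (e / (2 * M * M / m ^+ 4)))))//.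
    apply: ler_pM; rewrite ?cabs_ge0// (le_trans (ler_cabsD _ _))// !cabsM.
    by rewrite lerD// ler_pM ?cabs_ge0 ?H0.
  by rewrite le_eqVlt; apply/orP; left; apply/eqP; field; rewrite !gt_eqF.
have [N0 H0] := main; exists (N0 + j)%N => N NN.
have jN : (j <= N)%N by rewrite (leq_trans _ NN)// leq_addl.
have H1 : (N0 <= N - j)%N by rewrite leq_subRL// addnC.
have H2 : (N0 <= N)%N by rewrite (leq_trans _ NN)// leq_addr.
by split; [apply: (H0 _ _ (N - j)%N)|apply: (H0 _ _ (N + j)%N)] => //; lia.
Qed.

End QPochhammerBounds.

(** * The finite Jacobi product and a lower bound for theta *)

Section ThetaZeros.
Variables (R : realType) (tau : R[i]).
Hypothesis tau0 : 0 < Im tau.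
Implicit Types (z h : R[i]).

(** The square of the classical nome exp (pi i tau). *)
Let q : R[i] := cexp (2 * ipi R * tau).
Let X z : R[i] := cexp (2 * ipi R * z).
Let t z (k : int) : R[i] := theta_term 2^-1 2^-1 z tau k.

Lemma Re_2ipi z : Re (2 * ipi R * z) = - (2 * pi * Im z).
Proof. by rewrite !ReImE /=; ring. Qed.

Lemma cabs_nome : cabs q < 1.
Proof. by rewrite cabs_cexp Re_2ipi expR_lt1 oppr_lt0 !mulr_gt0// pi_gt0. Qed.

Lemma theta_term_rec z k : t z (k + 1) = - X z * cexp (2 * ipi R * tau * (k + 1)%:~R) * t z k.
Proof.
rewrite mulNr -mulN1r.
have -> : -1 = cexp (ipi R).
  by apply: complex_eq; rewrite /cexp /= expR0 ?cospi ?sinpi !mul1r// oppr0.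
rewrite /t /theta_term -!cexpD half_real; congr cexp.
by rewrite !rmorphD /=; field.
Qed.

Lemma cexp_tau_nat n : cexp (2 * ipi R * tau * n%:R) = q ^+ n.
Proof. by rewrite mulrC cexpMn. Qed.

(** Finite form of the Jacobi triple product. By [theta_term_rec] the terms from -N to N satisfy the
    recurrence of the q-binomial theorem, started at -N. From the N factors with nonpositive powers
    of q the leading monomial is extracted, which moves t (-N) to t 0. *)
Lemma jacobi_finite z N :
  \sum_(i < (N + N).+1) qbinom q (N + N) i * t z (i%:Z - N%:Z) =
  t z 0 * \prod_(j < N) (1 - q ^+ j / X z) * \prod_(j < N) (1 - q ^+ j.+1 * X z).
Proof.
have qn0 : q != 0 by exact: cexp_neq0.
have Xn0 : X z != 0 by exact: cexp_neq0.
have qXn0 n : q ^+ n != 0 by rewrite expf_neq0.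
rewrite (@gauss_qbinom _ q (fun i => t z (i%:Z - N%:Z)) (- X z * q / q ^+ N)); last first.
  move=> i; rewrite (_ : i.+1%:Z - N%:Z = i%:Z - N%:Z + 1); last by rewrite intS; ring.
  rewrite theta_term_rec; congr (_ * _).
  have -> : cexp (2 * ipi R * tau * (i%:Z - N%:Z + 1)%:~R) = q ^+ i / q ^+ N * q.
    rewrite -!cexp_tau_nat -cexpB /q -cexpD; congr cexp.
    by rewrite !(rmorphD, rmorphN) /=; ring.
  by ring.
rewrite big_split_ord /= mulrA; congr (_ * _); last first.
  apply: eq_bigr => j _; rewrite exprD exprS; field.
  by rewrite qXn0.
rewrite sub0r; elim: N => [|N IH]; first by rewrite !big_ord0 oppr0.
rewrite [in RHS]big_ord_recr /= mulrA -IH.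
rewrite big_ord_recl /= expr0 mulr1.
have -> : t z (- N%:Z) = - X z * (q ^+ N)^-1 * t z (- N.+1%:Z).
  have := theta_term_rec z (- N.+1%:Z); rewrite (_ : - N.+1%:Z + 1 = - N%:Z); last by rewrite intS; ring.
  by move=> ->; rewrite -cexp_tau_nat -cexpN; congr (_ * cexp _ * _); rewrite rmorphN /=; ring.
have -> : \prod_(i < N) (1 + - X z * q / q ^+ N.+1 * q ^+ bump 0 i) =
  \prod_(j < N) (1 + - X z * q / q ^+ N * q ^+ j).
  by apply: eq_bigr => j _; rewrite /bump /= add1n !exprS; field; rewrite qXn0 qn0.
set P := \prod_(j < N) _; rewrite exprS; field.
by rewrite Xn0 qXn0 qn0.
Qed.

(** Weighted by [2N, N + k], the theta terms add up to the finite product. The weights are bounded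
    and approach [2N, N], so the product differs from [2N, N] times theta by a quantity tending to
    0. The range N + 1 keeps at least one factor of each kind, so that 1 - 1 / X can be isolated. *)
Lemma theta_lower_bound : exists2 M : R, 0 < M & forall z (d : R),
  (forall N, d <= cabs (\prod_(j < N.+1) (1 - q ^+ j / X z) *
                        \prod_(j < N.+1) (1 - q ^+ j.+1 * X z))) ->
  cabs (t z 0) * d <= M * cabs (theta tau z).
Proof.
have [M M0 HM] := qbinom_bound cabs_nome; exists M => // z d Hd.
(* The weight of t k in the product of order N; it is 0 outside -N <= k <= N, below by this
   definition and above because [qbinom] vanishes there. *)
pose A N (k : int) := if (0 <= k + N%:Z)%R then qbinom q (N + N) `|(k + N%:Z)%R|%N else 0.
have cA N k : cabs (A N k) <= M.
  by rewrite /A; case: ifP => // _; rewrite cabs0 ltW.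
pose P N := t z 0 * \prod_(j < N) (1 - q ^+ j / X z) * \prod_(j < N) (1 - q ^+ j.+1 * X z).
have hP N : has_sum (fun k => A N k * t z k) (P N).
  pose t' (k : int) := A N (k - N%:Z) * t z (k - N%:Z).
  pose S : {fset int} := [fset Posz i | i in iota 0 (N + N).+1]%fset.
  have H : has_sum t' (\sum_(k <- S) t' k).
    apply: has_sum_finite => k kS; rewrite /t' /A subrK.
    case: ifP => [|_]; last by rewrite mul0r.
    case: k kS => // n nS _; rewrite qbinom_small ?mul0r//= ltnNge -ltnS.
    apply: contra nS => nN; have ni : n \in iota 0 (N + N).+1 by rewrite mem_iota.
    by apply/imfsetP; exists n.
  have -> : P N = \sum_(k <- S) t' k.
    rewrite big_imfset; last by move=> ? ? _ _ [].
    rewrite /P -jacobi_finite (perm_big (iota 0 (N + N).+1)); last first.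
      by apply: uniq_perm; rewrite ?iota_uniq ?enum_finmem_uniq// => i; rewrite enum_finmemE.
    have -> : iota 0 (N + N).+1 = index_iota 0 (N + N).+1 by rewrite /index_iota subn0.
    rewrite big_mkord.
    by apply: eq_bigr => i _; rewrite /t' /A subrK.
  have := has_sum_reindex (addrK N%:Z) (subrK N%:Z) H.
  by apply: has_sum_ext => k; rewrite /t' addrK.
have ht := theta_char_has_sum 2^-1 2^-1 z tau0; rewrite -/(t z) in ht.
have [u [M' [uM tu]]] := theta_term_dominated 2^-1 2^-1 z tau0 (lexx 0).
have {}tu k : cabs (t z k) <= u k by have := tu k; rewrite mul0r expR0 mulr1.
have lim e : 0 < e -> exists N0, forall N, (N0 <= N)%N ->
    cabs (P N - qbinom q (N + N) N * theta tau z) <= e.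
  apply: (@has_sum_dominated_cvg0 R
     (fun N k => A N k * t z k - qbinom q (N + N) N * t z k) _ _ _
     (bounded_sumsZ (_ : 0 <= 2 * M) uM)).
  - by rewrite mulr_ge0// ltW.
  - move=> N k; rewrite -mulrBl cabsM ler_pM ?cabs_ge0//.
    by rewrite (le_trans (ler_cabsB _ _))// mulr_natl mulr2n lerD.
  - move=> k e' e'0; have tk : 0 < cabs (t z k) + 1 by rewrite ltr_wpDl ?cabs_ge0.
    have [N0 H0] := qbinom_central_cvg cabs_nome `|k|%N (divr_gt0 e'0 tk).
    exists (N0 + `|k|)%N => N NN; have [|H1 H2] := H0 N; first by rewrite (leq_trans _ NN)// leq_addr.
    have kN : (`|k| <= N)%N by rewrite (leq_trans _ NN)// leq_addl.
    rewrite -mulrBl cabsM.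
    suff : cabs (A N k - qbinom q (N + N) N) <= e' / (cabs (t z k) + 1).
      rewrite ler_pdivlMr// => /(le_trans _); apply.
      by rewrite ler_wpM2l ?cabs_ge0// lerDl.
    rewrite /A; case: k {tk H0 NN} kN H1 H2 => n /= nN H1 H2; first by rewrite addnC.
    rewrite (_ : (Negz n + N%:Z)%R = (N - n.+1)%N%:Z) //.
    by rewrite NegzE addrC subzn.
  - by move=> N; apply: has_sumB (hP N) _; exact: has_sumZ ht.
apply/ler_addgt0Pr => e e0; have [N0 H0] := lim e e0.
have := H0 N0.+1 (leqnSn _).
set c := qbinom _ _ _ => H1.
have : cabs (t z 0) * d <= cabs (P N0.+1).
  by rewrite /P -mulrA [leRHS]cabsM ler_wpM2l ?cabs_ge0.
have := ler_cabsD (P N0.+1 - c * theta tau z) (c * theta tau z); rewrite subrK (cabsM c).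
have : cabs c * cabs (theta tau z) <= M * cabs (theta tau z).
  by rewrite ler_wpM2r ?cabs_ge0 ?HM.
by lra.
Qed.

End ThetaZeros.

(** * The zeros of theta *)

Section ThetaZeroSet.
Variables (R : realType) (tau : R[i]).
Hypothesis tau0 : 0 < Im tau.
Implicit Types (z h w : R[i]).

(** A factor of the product vanishes only if exp (2 pi i z) is a power of q, which puts z in the
    lattice; otherwise both products stay away from 0. *)
Lemma theta_neq0 z : ~ lattice tau z -> theta tau z != 0.
Proof.
move=> zL; have [M M0 HM] := theta_lower_bound tau0.
set q := cexp (2 * ipi R * tau) in HM; set x := cexp (2 * ipi R * z).
have q1 : cabs q < 1 := cabs_nome tau0.
have r01 : 0 <= cabs q < 1 by rewrite cabs_ge0.
have zero (a : int) : cexp (2 * ipi R * (a%:~R * tau)) != x.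
  apply/eqP => E; apply: zL.
  have : cexp (2 * ipi R * (z - a%:~R * tau)) = 1.
    by rewrite mulrBr cexpB -/x E divff// cexp_neq0.
  move=> /cexp_eq1[k /mulfI E']; exists k, a; rewrite -E' ?subrK//.
  apply/eqP => /(congr1 (@Im R)); rewrite !ReImE /= => /eqP.
  by rewrite mul0r addr0 mulf_eq0 pnatr_eq0 /= gt_eqF// pi_gt0.
have qE j : q ^+ j = cexp (2 * ipi R * (j%:Z%:~R * tau)).
  by rewrite mulrCA -cexpMn.
have [||d1 d10 H1] := @prod_1B_lower R (fun j => q ^+ j / x) (cabs q) (cabs x^-1) r01 (cabs_ge0 _).
- by move=> j; rewrite cabsM cabsX mulrC.
- move=> j; rewrite -subr_eq0 -[X in _ - X](divff (cexp_neq0 _ : x != 0)) -mulrBl.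
  by rewrite mulf_neq0 ?invr_neq0 ?cexp_neq0// subr_eq0 qE zero.
have [||d2 d20 H2] := @prod_1B_lower R (fun j => q ^+ j.+1 * x) (cabs q) (cabs q * cabs x) r01
  (mulr_ge0 (cabs_ge0 _) (cabs_ge0 _)).
- by move=> j; rewrite cabsM cabsX exprS mulrAC.
- move=> j; apply/eqP => E; have /eqP := zero (- j.+1%:Z); apply.
  have qj0 : q ^+ j.+1 != 0 by rewrite qE cexp_neq0.
  apply: (mulfI qj0); rewrite E qE -cexpD.
  by rewrite rmorphN mulNr mulrN subrr cexp0.
rewrite -cabs_gt0 -(pmulr_rgt0 _ M0) (lt_le_trans _ (HM z (d1 * d2) _))//.
  by rewrite !mulr_gt0// cabs_gt0 cexp_neq0.
by move=> N; rewrite cabsM; apply: ler_pM; rewrite ?(ltW d10) ?(ltW d20).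
Qed.

Lemma theta0 : theta tau 0 = 0.
Proof.
apply/eqP; have /eqP := theta_opp 0 tau0; rewrite oppr0 -addr_eq0 -mulr2n.
by rewrite mulrn_eq0.
Qed.

(** Near 0 only the factor 1 - 1 / X of the product is small, of size about 2 pi |h|; the others are
    bounded below uniformly in h. *)
Lemma theta_lower_near0 : exists c d : R, [/\ 0 < c, 0 < d &
  forall h, cabs h < d -> c * cabs h <= cabs (theta tau h)].
Proof.
have [M M0 HM] := theta_lower_bound tau0.
set q := cexp (2 * ipi R * tau) in HM; set r := cabs q.
(* For |h| < Im tau / 2, X and 1 / X are at most exp (pi Im tau) in modulus, while [rho * r] is
   still less than 1. *)
pose rho := expR (pi * Im tau).
have q1 : r < 1 := cabs_nome tau0.
have rE : r = expR (- (2 * pi * Im tau)) by rewrite /r cabs_cexp Re_2ipi.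
have r01 : 0 <= r < 1 by rewrite cabs_ge0.
have p0 : 0 < pi * Im tau by rewrite mulr_gt0// pi_gt0.
have rr1 : rho * r < 1 by rewrite rE -expRD expR_lt1; lra.
(* A real majorant independent of h: [prod_1B_lower] applied to it gives a constant uniform in h. *)
pose y j : R[i] := (rho * r * r ^+ j)%:C.
have yb j : 0 <= rho * r * r ^+ j < 1.
  rewrite !mulr_ge0 ?exprn_ge0 ?expR_ge0 ?cabs_ge0//= (le_lt_trans _ rr1)//.
  rewrite ler_piMr ?mulr_ge0 ?expR_ge0 ?cabs_ge0// exprn_ile1 ?cabs_ge0//.
  exact: ltW.
have [||d d0 Hd] := @prod_1B_lower R y r (rho * r) r01 (mulr_ge0 (expR_ge0 _) (cabs_ge0 _)).
- by move=> j; rewrite cabs_real ger0_norm//; case/andP: (yb j).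
- move=> j; apply/eqP => /(congr1 (@Re R)) /= E.
  by have /andP[_] := yb j; rewrite E ltxx.
have prodb (f : nat -> R[i]) N : (forall j, cabs (f j) <= rho * r * r ^+ j) ->
    d <= cabs (\prod_(j < N) (1 - f j)).
  move=> fb; rewrite (le_trans (Hd N))// !cabs_prod ler_prod// => j _.
  rewrite cabs_ge0 andTb; have := lerB_cabs 1 (f j); rewrite cabs1.
  rewrite (_ : 1 - y j = (1 - rho * r * r ^+ j)%:C); last by rewrite rmorphB.
  have /andP[y0 y1] := yb j; rewrite cabs_real ger0_norm; last by rewrite subr_ge0 ltW.
  by have := fb j; lra.
pose A : R := expR (Re (ipi R * tau / 4)) * expR (- pi).
have A0 : 0 < A by rewrite mulr_gt0 ?expR_gt0.
have pi0 := pi_gt0 R.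
pose e1 : R := expR 1.
have e10 : 0 < e1 := expR_gt0 _.
have E8 : 0 < 8 * e1 + 1 by rewrite ltr_wpDl// mulr_ge0// ltW.
have E8' : 0 < 2 * pi * (8 * e1 + 1) by rewrite !mulr_gt0.
(* In order: for the bound [rho]; for |Im h| <= 1, used in the constant [A]; for the quadratic
   remainder of the exponential to stay below half of the linear term. *)
pose dd : R := Num.min (Im tau / 2) (Num.min 1 (1 / (2 * pi * (8 * e1 + 1)))).
exists (A * d * d * pi / M), dd; split.
- by apply: divr_gt0 => //; do 3 (apply: mulr_gt0 => //).
- by rewrite !lt_min ltr01 !divr_gt0.
move=> h; rewrite !lt_min => /and3P[h1 h2 h3].
set w := 2 * ipi R * h.
have wE : cabs w = 2 * pi * cabs h by rewrite cabs_2ipi.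
have Ew : cabs w * (8 * e1 + 1) <= 1.
  by move: h3; rewrite ltr_pdivlMr// => /ltW; rewrite wE; lra.
have w1 : cabs w <= 1.
  have : 0 <= cabs w * (8 * e1) by rewrite !mulr_ge0 ?cabs_ge0// ltW.
  by move: Ew; lra.
have xb : cabs (cexp w) <= rho /\ cabs (cexp w)^-1 <= rho.
  rewrite -cexpN !cabs_cexp !ler_expR Re_opp.
  have : `|Re w| <= pi * Im tau.
    rewrite (le_trans (cabs_Re _))// wE.
    have : 0 <= pi * (Im tau / 2 - cabs h) by rewrite mulr_ge0 ?ltW// subr_gt0.
    by lra.
  by rewrite ler_norml => /andP[? ?]; split; lra.
have [xb1 xb2] := xb.
have expw : cabs w / 2 <= cabs (1 - 1 / cexp w).
  have H := cexp_taylor2 (- w); rewrite cabsN cexpN in H.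
  rewrite div1r; set v := (cexp w)^-1 in H *.
  have : cabs w <= cabs (1 - v) + cabs (v - 1 - - w).
    rewrite -[X in X <= _](_ : cabs ((1 - v) + (v - 1 - - w)) = _); last by congr cabs; ring.
    exact: ler_cabsD.
  have : 4 * cabs w ^+ 2 * expR (cabs w) <= 4 * cabs w ^+ 2 * e1.
    by rewrite ler_wpM2l ?mulr_ge0 ?exprn_ge0 ?cabs_ge0// ler_expR.
  have : 0 <= cabs w * (1 - cabs w * (8 * e1 + 1)) by rewrite mulr_ge0 ?cabs_ge0// subr_ge0.
  have : 0 <= cabs w ^+ 2 by rewrite exprn_ge0 ?cabs_ge0.
  by lra.
have tb : A <= cabs (theta_term 2^-1 2^-1 h tau 0).
  rewrite /theta_term half_real mulr0z add0r cabs_cexp /A -expRD ler_expR.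
  rewrite (_ : ipi R * tau * 2^-1 ^+ 2 = ipi R * tau / 4); last by field.
  rewrite Re_add lerD2l.
  rewrite (_ : 2 * ipi R * 2^-1 * (h + 2^-1) = ipi R * h + ipi R / 2); last by field.
  rewrite (_ : Re (ipi R * h + ipi R / 2) = - (pi * Im h)); last first.
    rewrite Re_add (_ : ipi R / 2 = (2^-1)%:C * ipi R); last by rewrite half_real mulrC.
    by rewrite !ReImE /=; ring.
  rewrite lerN2 ger_pMr//.
  by rewrite (le_trans (ler_norm _))// (le_trans (cabs_Im _))// ltW.
have := HM h (pi * cabs h * d * d).
rewrite -/w => /(_ _)/wrap[N|H].
  rewrite big_ord_recl /= expr0 -mulrA !cabsM -!mulrA mulrA; apply: ler_pM.
  - by rewrite mulr_ge0 ?cabs_ge0// ltW.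
  - by rewrite mulr_ge0 ?ltW.
  - by rewrite (le_trans _ expw)// wE; lra.
  have qv v j : cabs v <= rho -> cabs (q ^+ j.+1 * v) <= rho * r * r ^+ j.
    move=> vr; rewrite cabsM cabsX -/r exprS [leLHS]mulrC -[leRHS]mulrA.
    by rewrite ler_wpM2r ?mulr_ge0 ?exprn_ge0 ?cabs_ge0.
  apply: ler_pM; rewrite ?(ltW d0)//.
    by apply: (@prodb (fun j => q ^+ j.+1 / cexp w)) => j; exact: qv.
  by apply: (@prodb (fun j => q ^+ j.+1 * cexp w)) => j; exact: qv.
rewrite mulrAC ler_pdivrMr// [leRHS]mulrC (le_trans _ H)//.
rewrite (_ : A * d * d * pi * cabs h = A * (pi * cabs h * d * d)); last by ring.
by rewrite ler_wpM2r// !mulr_ge0 ?cabs_ge0// ltW.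
Qed.

(** The cubic Taylor remainder makes theta / z differentiable at 0. Its value there, the derivative
    of theta, is nonzero: otherwise theta would be O (h^2), against [theta_lower_near0]. *)
Lemma theta_factor0 : exists u : R[i] -> R[i],
  [/\ forall z : R[i]^o, cdiff (u : R[i]^o -> R[i]) z,
      u 0 != 0 & forall z, theta tau z = z * u z].
Proof.
have [_ [a [b [K HK]]]] := theta_term_taylor 2^-1 2^-1 0 tau0.
have {}HK h : cabs h <= 1 -> cabs (theta tau h - a * h - b * h ^+ 2) <= K * cabs h ^+ 3.
  by move=> /HK; rewrite add0r -/(theta tau 0) -/(theta tau h) theta0 subr0.
pose u z := if z == 0 then a else theta tau z / z.
exists u; split.
- move=> z; have [->|z0] := eqVneq z 0.
    apply/differentiableC; exists b; apply: (@is_cderiv_quad _ _ _ _ K) => h h1.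
    rewrite add0r /u eqxx; have [->|h0] := eqVneq h 0.
      by rewrite mulr0 !subrr cabs0 expr0n mulr0.
    have ch0 : 0 < cabs h by rewrite cabs_gt0.
    rewrite -(ler_pM2r ch0) -cabsM -mulrA -exprSr.
    rewrite (_ : _ * h = theta tau h - a * h - b * h ^+ 2); last by field.
    exact: HK (ltW h1).
  have cz0 : 0 < cabs z by rewrite cabs_gt0.
  apply: (@near_cdiff1 R (fun w => theta tau w / w)).
    apply/nearC_cabs; exists (cabs z) => // w wz; rewrite /u.
    by case: eqP wz => // ->; rewrite sub0r cabsN ltxx.
  by apply: cdiffM; [exact: theta_char_differentiable|exact: cdiffV (cdiff_id z) z0].
- rewrite /u eqxx; apply/eqP => a0.
  have [c [d [c0 d0 Hc]]] := theta_lower_near0.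
  have K1 : 0 < `|K| + cabs b + 1 by rewrite ltr_wpDl ?addr_ge0 ?cabs_ge0.
  (* Small enough for (|K| + |b|) x^2 to be less than c x, a contradiction when a = 0. *)
  pose x := Num.min (1 / 2) (Num.min (d / 2) (c / (2 * (`|K| + cabs b + 1)))).
  have x0 : 0 < x by rewrite !lt_min !divr_gt0 ?mulr_gt0.
  have /and3P[x1 x2 x3] : [&& x <= 1 / 2, x <= d / 2 & x <= c / (2 * (`|K| + cabs b + 1))].
    by rewrite -!le_min.
  have cx : cabs x%:C = x by rewrite cabs_real ger0_norm ?ltW.
  have := HK x%:C; rewrite a0 cx mul0r subr0 => /(_ _)/wrap[|H1]; first by lra.
  have := Hc x%:C; rewrite cx => /(_ _)/wrap[|H2]; first by lra.
  have := ler_cabsD (theta tau x%:C - b * x%:C ^+ 2) (b * x%:C ^+ 2).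
  rewrite subrK cabsM cabsX cx => H3.
  move: x3; rewrite ler_pdivlMr ?mulr_gt0// => x3.
  have H4 : K * x ^+ 3 <= `|K| * x ^+ 2.
    rewrite (le_trans (ler_wpM2r _ (ler_norm _))) ?exprn_ge0 ?(ltW x0)//.
    by rewrite ler_wpM2l// exprS ler_piMl ?exprn_ge0 ?(ltW x0)//; lra.
  have : 0 <= x * (c - x * (2 * (`|K| + cabs b + 1))) by rewrite mulr_ge0 ?(ltW x0)// subr_ge0.
  have : 0 < c * x by rewrite mulr_gt0.
  have : 0 <= x ^+ 2 by rewrite exprn_ge0 ?(ltW x0).
  by lra.
- move=> z; rewrite /u; case: eqP => [->|/eqP z0]; first by rewrite theta0 mul0r.
  by rewrite mulrC divfK.
Qed.

(** The l that admit such a law form an additive group containing 1 and tau. *)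
Lemma theta_lattice l : lattice tau l ->
  exists A B, forall z, theta tau (z + l) = cexp (A + B * z) * theta tau z.
Proof.
pose S l := exists A B, forall z, theta tau (z + l) = cexp (A + B * z) * theta tau z.
have S0 : S 0 by exists 0, 0 => z; rewrite mul0r !addr0 cexp0 mul1r.
have SD l1 l2 : S l1 -> S l2 -> S (l1 + l2).
  move=> [A1 [B1 H1]] [A2 [B2 H2]]; exists (A1 + A2 + B2 * l1), (B1 + B2) => z.
  by rewrite addrA H2 H1 mulrA -cexpD; congr (cexp _ * _); ring.
have SN l1 : S l1 -> S (- l1).
  move=> [A1 [B1 H1]]; exists (B1 * l1 - A1), (- B1) => z.
  rewrite -[in RHS](subrK l1 z) H1 mulrA -cexpD subrK.
  have -> : B1 * l1 - A1 + - B1 * z + (A1 + B1 * (z - l1)) = 0 by ring.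
  by rewrite cexp0 mul1r.
have Sn l1 n : S l1 -> S (l1 *+ n).
  by move=> H; elim: n => [|n IH]; rewrite ?mulr0n// mulrS; exact: SD.
have Sz l1 (k : int) : S l1 -> S (l1 *~ k).
  by move=> H; case: k => n; [exact: Sn|rewrite NegzE mulrNz; apply: SN; exact: Sn].
have S1 : S 1.
  exists (2 * ipi R * 2^-1%:C), 0 => z.
  by rewrite mul0r addr0 /theta theta_char_add1.
have St : S tau.
  exists (- (ipi R * tau) - 2 * ipi R * 2^-1%:C), (- (2 * ipi R)) => z.
  by rewrite /theta theta_char_addtau//; congr (cexp _ * _); ring.
move=> [a [b ->]]; apply: SD; first exact: Sz.
by rewrite mulrzl; exact: Sz.
Qed.

Lemma theta_lattice0 l : lattice tau l -> theta tau l = 0.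
Proof.
by move=> /theta_lattice[A [B /(_ 0)]]; rewrite add0r theta0 mulr0.
Qed.

Lemma theta_eq0 z : theta tau z = 0 <-> lattice tau z.
Proof.
split=> [/eqP|]; last exact: theta_lattice0.
by apply: contraTP => /theta_neq0.
Qed.

Lemma theta_factor l : lattice tau l -> exists u : R[i] -> R[i],
  [/\ forall z : R[i]^o, cdiff (u : R[i]^o -> R[i]) z,
      u l != 0 & forall z, theta tau z = (z - l) * u z].
Proof.
move=> /theta_lattice[A [B H]]; have [u [du u0 Hu]] := theta_factor0.
exists (fun z => cexp (A + B * (z - l)) * u (z - l)); split.
- move=> z.
  have dsub : cdiff (fun w : R[i]^o => w - l) z.
    exact: cdiffB (cdiff_id z) (cdiff_cst _ _).
  apply: cdiffM; last exact: (@cdiff_comp1 _ (R[i]^o) u (fun w => w - l)).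
  by apply: cdiff_cexp; apply: cdiffD (cdiff_cst _ _) (cdiffM (cdiff_cst _ _) dsub).
- by rewrite subrr mulf_neq0 ?cexp_neq0.
- by move=> z; rewrite -{1}(subrK l z) H Hu; ring.
Qed.

End ThetaZeroSet.

(** * Integrals of continuous complex-valued functions *)

Section Antiderivatives.
Variable R : realType.
Implicit Types (g h : R -> R[i]) (a b c d : R).

Lemma antiderivative_above (g : R -> R) (a : R) : continuous g ->
  exists G : R -> R, forall x : R, a < x -> is_derive x (1 : R) G (g x).
Proof.
move=> cg; pose F x := (\int[lebesgue_measure]_(t in `[a, x]) (g t))%R.
exists F => x ax; have xu : x < x + 1 by rewrite ltrDl.
have intg : lebesgue_measure.-integrable `[a, x + 1] (EFin \o g).
  apply: continuous_compact_integrable; first exact: segment_compact.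
  exact: continuous_subspaceT.
have [dF F'] := continuous_FTC1_closed xu intg ax (cg x).
by apply: DeriveDef => //; rewrite -derive1E.
Qed.

(** Integration from a base point gives an antiderivative only to its right. Reflecting the variable
    gives one to the left; both are normalized at 0, agree on (-1, 1), and are glued at 0. *)
Lemma antiderivative (g : R -> R) : continuous g ->
  exists G : R -> R, forall x : R, is_derive x (1 : R) G (g x).
Proof.
move=> cg; have [G1 H1] := antiderivative_above (-1) cg.
have cgN : continuous (g \o -%R).
  by move=> x; apply: continuous_comp; [exact: opp_continuous|exact: cg].
have [G2 H2] := antiderivative_above (-1) cgN.
pose K1 (x : R) := G1 x - G1 0; pose K2 (x : R) := - (G2 (- x) - G2 0).
have dK1 (x : R) : -1 < x -> is_derive x (1 : R) K1 (g x).
  move=> /H1 ?; rewrite -[X in is_derive _ _ _ X]subr0.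
  exact: (@is_deriveB _ _ _ G1 (cst (G1 0))).
have dK2 (x : R) : x < 1 -> is_derive x (1 : R) K2 (g x).
  rewrite -ltrN2 => /H2 ?; have ? : is_derive x (1 : R) (-%R : R -> R) (- 1).
    exact: is_deriveNid.
  have ? := @is_derive1_comp _ G2 -%R x _ _ _ _.
  rewrite (_ : K2 = (- ((G2 \o -%R) - cst (G2 0)))); last by apply/funext.
  by apply: is_derive_eq; rewrite /= opprK subr0 mulrN1 opprK.
have K12 (x : R) : -1 < x < 1 -> K1 x = K2 x.
  move=> /andP[x1 x2].
  have dD (y : R) : -1 < y < 1 -> is_derive y (1 : R) (K1 - K2) 0.
    by move=> /andP[/dK1 ? /dK2 ?]; apply: is_derive_eq; rewrite subrr.
  have D0 : (K1 - K2) 0 = 0.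
    by rewrite /K1 /K2 !fctE oppr0 !subrr oppr0 subrr.
  have aux (u v : R) : -1 < u -> v < 1 -> u <= v -> (K1 - K2) u = (K1 - K2) v.
    move=> u1 v1 uv; have [||c _] := @MVT_segment R (K1 - K2) (cst 0) u v uv.
    - move=> y; rewrite in_itv /= => /andP[uy yv]; apply: dD.
      by rewrite (lt_trans u1 uy) (lt_trans yv v1).
    - apply: continuous_in_subspaceT; move=> y /set_mem; rewrite /= in_itv /= => /andP[uy yv].
      apply: differentiable_continuous; apply/derivable1_diffP.
      by apply: ex_derive; apply: dD; rewrite (lt_le_trans u1 uy) (le_lt_trans yv v1).
    - by rewrite mul0r => /eqP; rewrite subr_eq0 => /eqP.
  suff : (K1 - K2) x = 0 by move=> /eqP; rewrite !fctE subr_eq0 => /eqP.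
  by rewrite -D0; have [x0|/ltW x0] := leP x 0; [|apply/esym]; exact: aux.
pose K (x : R) := if 0 <= x then K1 x else K2 x.
exists K => x; have [x0|x0] := ltP x 0.
  apply: (@near_eq_is_derive _ _ _ K2 K); last by apply: dK2; lra.
  near=> t; rewrite /K leNgt; have -> // : t < 0.
  by near: t; exact: lt_nbhsl.
apply: (@near_eq_is_derive _ _ _ K1 K); last by apply: dK1; lra.
near=> t; have t1 : -1 < t by near: t; apply: lt_nbhsr; lra.
rewrite /K; case: leP => // t0; rewrite -K12// t1 /=; lra.
Unshelve. all: by end_near. Qed.

Definition ccont g := forall x e, 0 < e ->
  exists2 d : R, 0 < d & forall t, `|t - x| < d -> cabs (g t - g x) <= e.

Lemma rcderiv_exists g : ccont g -> exists G, rcderiv G g.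
Proof.
move=> cg.
have cont (p : R[i] -> R) : (forall z w, p (z - w) = p z - p w) ->
    (forall z, `|p z| <= cabs z) -> continuous (fun t => p (g t)).
  move=> pB pc x; apply/cvgrPdist_le => e e0; have [d d0 H] := cg x e e0.
  apply/nbhs_ballP; exists d => //= t; rewrite /ball /= distrC => /H.
  by rewrite distrC -pB; apply: le_trans; exact: pc.
have [] := antiderivative (cont (@Re R) _ (@cabs_Re R)).
  by move=> z w; rewrite Re_add Re_opp.
move=> G1 H1; have [] := antiderivative (cont (@Im R) _ (@cabs_Im R)).
  by move=> z w; rewrite Im_add Im_opp.
by move=> G2 H2; exists (fun t => G1 t +i* G2 t) => x; split => /=.
Qed.

(** The integral as increment of a chosen antiderivative; 0 is a default for integrands without one,
    and by [rcderiv_exists] continuous integrands have one. *)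
Definition cint g a b : R[i] :=
  if pselect (exists G, rcderiv G g) is left h
  then projT1 (cid h) b - projT1 (cid h) a else 0.

Lemma cintE G g a b : rcderiv G g -> cint g a b = G b - G a.
Proof.
move=> dG; rewrite /cint; case: pselect => [h|[]]; last by exists G.
by case: (cid h) => H dH /=; exact: rcderiv_eq dH dG _ _.
Qed.

Lemma ccontD g h : ccont g -> ccont h -> ccont (fun t => g t + h t).
Proof.
move=> cg ch x e e0; have e20 : 0 < e / 2 by rewrite divr_gt0.
have [d1 d10 H1] := cg x _ e20; have [d2 d20 H2] := ch x _ e20.
exists (Num.min d1 d2) => [|t]; first by rewrite lt_min d10.
rewrite lt_min => /andP[/H1 {}H1 /H2 {}H2]; rewrite opprD addrACA.
by rewrite (le_trans (ler_cabsD _ _))// [leRHS]splitr lerD.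
Qed.

Lemma ccontZ (k : R[i]) g : ccont g -> ccont (fun t => k * g t).
Proof.
move=> cg x e e0; have k0 : 0 < cabs k + 1 by rewrite ltr_wpDl ?cabs_ge0.
have [d d0 H] := cg x _ (divr_gt0 e0 k0); exists d => // t /H.
rewrite -mulrBr cabsM ler_pdivlMr// => /(le_trans _); apply.
by rewrite mulrC ler_wpM2l ?cabs_ge0// lerDl.
Qed.

Lemma ccont_shift g (s : R) : ccont g -> ccont (fun t => g (t + s)).
Proof.
move=> cg x e e0; have [d d0 H] := cg (x + s) e e0; exists d => // t td.
by apply: H; rewrite opprD addrACA subrr addr0.
Qed.

Lemma cint_chasles g a b c : ccont g -> cint g a c = cint g a b + cint g b c.
Proof.
by move=> /rcderiv_exists[G dG]; rewrite !(cintE _ _ dG) [RHS]addrC subrKA.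
Qed.

Lemma cintD g h a b : ccont g -> ccont h ->
  cint (fun t => g t + h t) a b = cint g a b + cint h a b.
Proof.
move=> /rcderiv_exists[G dG] /rcderiv_exists[H dH].
by rewrite (cintE _ _ dG) (cintE _ _ dH) (cintE _ _ (rcderivD dG dH)); ring.
Qed.

Lemma cintZ k g a b : ccont g -> cint (fun t => k * g t) a b = k * cint g a b.
Proof.
move=> /rcderiv_exists[G dG].
by rewrite (cintE _ _ dG) (cintE _ _ (rcderivZ k dG)); ring.
Qed.

Lemma cint_bound g a b (M : R) : ccont g -> a <= b ->
  (forall x, a <= x <= b -> cabs (g x) <= M) ->
  cabs (cint g a b) <= 2 * M * (b - a).
Proof.
by move=> /rcderiv_exists[G dG] ab gM; rewrite (cintE _ _ dG); exact: rcderiv_bound gM.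
Qed.

Lemma cint_shift g a b (s : R) : ccont g ->
  cint (fun t => g (t + s)) a b = cint g (a + s) (b + s).
Proof.
move=> /rcderiv_exists[G dG].
by rewrite (cintE _ _ dG) (cintE _ _ (rcderiv_shift s dG)).
Qed.

Lemma cint_periodic g (s : R) : ccont g -> (forall t, g (t + 1) = g t) ->
  cint (fun t => g (t + s)) 0 1 = cint g 0 1.
Proof.
move=> cg per; rewrite cint_shift// add0r (cint_chasles s 1 (1 + s) cg).
rewrite [in RHS](cint_chasles 0 s 1 cg) [RHS]addrC; congr (_ + _).
have := cint_shift 0 s 1 cg; rewrite add0r addrC => <-; congr cint.
exact/funext.
Qed.

End Antiderivatives.

(** * Goursat's lemma *)

Local Notation iC := (Complex 0 1).

Section Goursat.
Variable R : realType.
Implicit Types (f g : R[i] -> R[i]) (a b c d x y : R).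

Definition entire f := forall z : R[i]^o, cdiff (f : R[i]^o -> R[i]) z.

Lemma entire_cvg f z (e : R) : entire f -> 0 < e ->
  exists2 d : R, 0 < d & forall w, cabs (w - z) < d -> cabs (f w - f z) <= e.
Proof.
move=> /(_ z) /cdiff_continuous /cvgrPdist_le H e0.
have /H /nearC_cabs[d d0 {}H] : 0 < e%:C by rewrite ltcR.
by exists d => // w /H; rewrite normC_cabs lecR cabsB.
Qed.

Lemma entireB f g : entire f -> entire g -> entire (fun z => f z - g z).
Proof. by move=> ef eg z; exact: cdiffB. Qed.

Lemma cabs_hline x x' y : cabs (x +i* y - x' +i* y) = `|x - x'|.
Proof.
rewrite (_ : _ - _ = (x - x')%:C) ?cabs_real//.
by apply: complex_eq; rewrite !ReImE /= ?subrr.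
Qed.

Lemma cabs_vline x y y' : cabs (x +i* y - x +i* y') = `|y - y'|.
Proof.
rewrite (_ : _ - _ = iC * (y - y')%:C).
  by rewrite cabsM cabs_real /cabs /= expr0n expr1n add0r sqrtr1 mul1r.
by apply: complex_eq; rewrite !ReImE /= ?subrr; ring.
Qed.

Lemma ccont_hline f y : entire f -> ccont (fun x => f (x +i* y)).
Proof.
move=> ef x e e0; have [d d0 H] := entire_cvg (x +i* y) ef e0.
by exists d => // t td; apply: H; rewrite cabs_hline.
Qed.

Lemma ccont_vline f x : entire f -> ccont (fun y => f (x +i* y)).
Proof.
move=> ef y e e0; have [d d0 H] := entire_cvg (x +i* y) ef e0.
by exists d => // t td; apply: H; rewrite cabs_vline.
Qed.

(** The contour integral over the boundary of the rectangle [a, b] x [c, d], counterclockwise; the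
    factor i on the vertical sides is dz = i dy. *)
Definition rect f a b c d : R[i] :=
  cint (fun x => f (x +i* c)) a b + iC * cint (fun y => f (b +i* y)) c d
  - cint (fun x => f (x +i* d)) a b - iC * cint (fun y => f (a +i* y)) c d.

Lemma rect_splitx f a m b c d : entire f ->
  rect f a b c d = rect f a m c d + rect f m b c d.
Proof.
move=> ef; rewrite /rect (cint_chasles a m b (ccont_hline c ef)).
by rewrite (cint_chasles a m b (ccont_hline d ef)); ring.
Qed.

Lemma rect_splity f a b c m d : entire f ->
  rect f a b c d = rect f a b c m + rect f a b m d.
Proof.
move=> ef; rewrite /rect (cint_chasles c m d (ccont_vline a ef)).
by rewrite (cint_chasles c m d (ccont_vline b ef)); ring.
Qed.

Lemma rectB f g a b c d : entire f -> entire g ->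
  rect (fun z => f z - g z) a b c d = rect f a b c d - rect g a b c d.
Proof.
move=> ef eg.
have B (F G : R -> R[i]) u v : ccont F -> ccont G ->
    cint (fun t => F t - G t) u v = cint F u v - cint G u v.
  move=> cF cG; rewrite -[cint G u v]mul1r -mulNr -cintZ// -cintD//.
    by congr cint; apply/funext => t; rewrite mulN1r.
  exact: ccontZ.
rewrite /rect !B; try exact: ccont_hline; try exact: ccont_vline.
by ring.
Qed.

(** An affine function has the primitive [P]; in [goursat] it is the first-order part of f. *)
Lemma rect_affine (p q : R[i]) a b c d : rect (fun z => p + q * z) a b c d = 0.
Proof.
pose P z := p * z + q * z ^+ 2 / 2.
have hE x y : x +i* y = x%:C + y%:C * iC by simpc.
have dh y : rcderiv (fun x => P (x +i* y)) (fun x => p + q * (x +i* y)).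
  have d1 : rcderiv (fun x => x +i* y) (fun=> 1).
    have := rcderivD (@rcderiv_id R) (rcderiv_cst (y%:C * iC)).
    by apply: rcderiv_ext => x; [exact/esym/hE|rewrite addr0].
  have := rcderivD (rcderivZ p d1) (rcderivZ (q / 2) (rcderivM d1 d1)).
  by apply: rcderiv_ext => x; rewrite /P; field.
have dv x : rcderiv (fun y => - iC * P (x +i* y)) (fun y => p + q * (x +i* y)).
  have d1 : rcderiv (fun y => x +i* y) (fun=> iC).
    have := rcderivD (rcderiv_cst x%:C) (rcderivM (@rcderiv_id R) (rcderiv_cst iC)).
    by apply: rcderiv_ext => y; [exact/esym/hE|rewrite mul1r mulr0 addr0 add0r].
  have := rcderivZ (- iC) (rcderivD (rcderivZ p d1) (rcderivZ (q / 2) (rcderivM d1 d1))).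
  apply: rcderiv_ext => y; first by rewrite /P; field.
  rewrite (_ : _ * _ = - (iC ^+ 2) * (p + q * (x +i* y))); last by field.
  by rewrite sqr_i opprK mul1r.
rewrite /rect !(cintE _ _ (dh _)) !(cintE _ _ (dv _)).
rewrite (_ : forall A B C D E F G H : R[i], A - B + iC * (- iC * C - - iC * D)
  - (E - F) - iC * (- iC * G - - iC * H)
  = A - B - iC ^+ 2 * (C - D) - (E - F) + iC ^+ 2 * (G - H)); last by move=> *; ring.
by rewrite sqr_i; ring.
Qed.

Lemma rect_bound f a b c d (M : R) : entire f -> a <= b -> c <= d ->
  (forall x y, a <= x <= b -> c <= y <= d -> cabs (f (x +i* y)) <= M) ->
  cabs (rect f a b c d) <= 4 * M * ((b - a) + (d - c)).
Proof.
move=> ef ab cd fM.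
have ci : cabs (iC : R[i]) = 1 by rewrite /cabs /= expr0n expr1n add0r sqrtr1.
have ac : a <= a <= b by rewrite lexx. have bc : a <= b <= b by rewrite lexx ab.
have cc : c <= c <= d by rewrite lexx. have dc : c <= d <= d by rewrite lexx cd.
have H1 := cint_bound (ccont_hline c ef) ab (fun x h => fM x c h cc).
have H2 := cint_bound (ccont_vline b ef) cd (fun y h => fM b y bc h).
have H3 := cint_bound (ccont_hline d ef) ab (fun x h => fM x d h dc).
have H4 := cint_bound (ccont_vline a ef) cd (fun y h => fM a y ac h).
rewrite /rect (le_trans (ler_cabsB _ _))//.
rewrite (_ : 4 * _ * _ = 2 * M * (b - a) + 2 * M * (d - c) + 2 * M * (b - a)
   + 2 * M * (d - c)); last by ring.
rewrite lerD//; last by rewrite cabsM ci mul1r.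
rewrite (le_trans (ler_cabsB _ _))// lerD// (le_trans (ler_cabsD _ _))// lerD//.
by rewrite cabsM ci mul1r.
Qed.

Let quad := ((R * R) * (R * R))%type.
Let rc f (Q : quad) := cabs (rect f Q.1.1 Q.1.2 Q.2.1 Q.2.2).
Let nested (Q Q' : quad) := [/\ Q.1.1 <= Q'.1.1, Q'.1.2 <= Q.1.2, Q.2.1 <= Q'.2.1,
  Q'.2.2 <= Q.2.2 & Q'.1.2 - Q'.1.1 = (Q.1.2 - Q.1.1) / 2 /\
                    Q'.2.2 - Q'.2.1 = (Q.2.2 - Q.2.1) / 2].

(** The rectangle is halved in x, then in y; each time the half with the larger integral is kept, at
    the cost of a factor 2. *)
Lemma rect_bisect f (Q : quad) : entire f -> Q.1.1 <= Q.1.2 -> Q.2.1 <= Q.2.2 ->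
  exists Q', nested Q Q' /\ rc f Q <= 4 * rc f Q'.
Proof.
case: Q => [[a b] [c d]] ef /= ab cd.
pose m := (a + b) / 2; pose k := (c + d) / 2.
have [a' [b' [Hx1 Hx2 Hx3 Hx]]] : exists a' b', [/\ a <= a', b' <= b,
    b' - a' = (b - a) / 2 & rc f ((a, b), (c, d)) <= 2 * rc f ((a', b'), (c, d))].
  have := ler_cabsD (rect f a m c d) (rect f m b c d); rewrite -rect_splitx//.
  set u := cabs (rect f a m c d); set v := cabs (rect f m b c d) => H.
  have [uv|vu] := leP u v; [exists m, b|exists a, m].
    by split; [rewrite /m; lra|rewrite /m; lra|rewrite /m; lra|rewrite /rc /= -/u -/v; lra].
    by split; [rewrite /m; lra|rewrite /m; lra|rewrite /m; lra|rewrite /rc /= -/u -/v; lra].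
have [c' [d' [Hy1 Hy2 Hy3 Hy]]] : exists c' d', [/\ c <= c', d' <= d,
    d' - c' = (d - c) / 2 & rc f ((a', b'), (c, d)) <= 2 * rc f ((a', b'), (c', d'))].
  have := ler_cabsD (rect f a' b' c k) (rect f a' b' k d); rewrite -rect_splity//.
  set u := cabs (rect f a' b' c k); set v := cabs (rect f a' b' k d) => H.
  have [uv|vu] := leP u v; [exists k, d|exists c, k].
    by split; [rewrite /k; lra|rewrite /k; lra|rewrite /k; lra|rewrite /rc /= -/u -/v; lra].
    by split; [rewrite /k; lra|rewrite /k; lra|rewrite /k; lra|rewrite /rc /= -/u -/v; lra].
exists ((a', b'), (c', d')); split; first by split.
by rewrite (le_trans Hx)// (_ : 4 = 2 * 2 :> R) -?mulrA ?ler_wpM2l//; ring.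
Qed.

Lemma nested_segments (u v : nat -> R) : (forall n, u n <= v n) ->
  (forall n, u n <= u n.+1) -> (forall n, v n.+1 <= v n) ->
  exists x, forall n, u n <= x <= v n.
Proof.
move=> uv uS vS.
have uM n p : u n <= u (n + p)%N.
  by elim: p => [|p IH]; rewrite ?addn0// addnS (le_trans IH).
have vM n p : v (n + p)%N <= v n.
  by elim: p => [|p IH]; rewrite ?addn0// addnS (le_trans _ IH).
have uvM n p : u n <= v p.
  by rewrite (le_trans (uM n p))// (le_trans (uv _))// addnC.
have supE : has_sup (range u) by split; [exists (u 0), 0%N|exists (v 0) => _ [n _ <-]].
exists (sup (range u)) => n; apply/andP; split.
  by apply: sup_upper_bound => //; exists n.
by apply: sup_le_ub => [|_ [p _ <-]]; [exists (u 0), 0%N|].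
Qed.

Lemma goursat f a b c d : entire f -> a <= b -> c <= d -> rect f a b c d = 0.
Proof.
move=> ef ab cd; apply/eqP; rewrite -cabs_eq0; apply/eqP/le_anti.
rewrite cabs_ge0 andbT.
pose good (Q : quad) := (Q.1.1 <= Q.1.2) && (Q.2.1 <= Q.2.2).
have [Q|F HF] := @boolp.choice _ _
    (fun Q Q' : quad => good Q -> nested Q Q' /\ rc f Q <= 4 * rc f Q').
  have [/andP[H1 H2]|nG] := boolP (good Q); last by exists Q.
  by have [Q' HQ] := rect_bisect ef H1 H2; exists Q'.
pose S n := iter n F ((a, b), (c, d)).
pose L := (b - a) + (d - c).
have goodS n : good (S n).
  elim: n => [|n IH]; first by rewrite /good /= ab cd.
  have [[_ _ _ _ [H1 H2]] _] := HF _ IH; have /andP[G1 G2] := IH.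
  rewrite /S iterS -/(S n); apply/andP; split; lra.
have nestS n := (HF _ (goodS n)).1.
have size n : (S n).1.2 - (S n).1.1 + ((S n).2.2 - (S n).2.1) = L / 2 ^+ n.
  elim: n => [|n IH]; first by rewrite expr0 divr1.
  have [_ _ _ _ [-> ->]] := nestS n.
  by rewrite -mulrDl IH exprSr; field; rewrite expf_neq0.
have rcS n : rc f (S 0%N) <= 4 ^+ n * rc f (S n).
  elim: n => [|n IH]; first by rewrite expr0 mul1r.
  rewrite (le_trans IH)// exprSr -mulrA ler_wpM2l ?exprn_ge0//.
  exact: (HF _ (goodS n)).2.
have [x Hx] : exists x, forall n, (S n).1.1 <= x <= (S n).1.2.
  apply: nested_segments => n; first by have /andP[] := goodS n.
    by have [] := nestS n.
  by have [] := nestS n.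
have [y Hy] : exists y, forall n, (S n).2.1 <= y <= (S n).2.2.
  apply: nested_segments => n; first by have /andP[] := goodS n.
    by have [] := nestS n.
  by have [] := nestS n.
have L0 : 0 <= L by rewrite addr_ge0 ?subr_ge0.
apply/ler_addgt0Pr => e e0; rewrite add0r.
(* With error e' L / 2^n on a rectangle of half-perimeter L / 2^n, the factor 4^n leaves 4 e' L^2,
   at most e; L + 1 covers degenerate rectangles. *)
pose e' := e / (4 * (L + 1) ^+ 2).
have L1 : 0 < L + 1 by rewrite ltr_wpDl.
have e'0 : 0 < e' by rewrite divr_gt0// mulr_gt0// exprn_gt0.
pose p := x +i* y; have /differentiableC[A HA] := ef p.
have [dl dl0 {}HA] := HA e' e'0.
have [n Hn] : exists n, L / 2 ^+ n < dl.
  have : `|2^-1 : R| < 1 by rewrite ger0_norm// invf_lt1// ltr1n.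
  move=> /cvg_expr /cvgrPdist_lt /(_ (dl / (L + 1)) (divr_gt0 dl0 L1)) [n _ /(_ n (leqnn n))].
  rewrite /= sub0r normrN ger0_norm ?exprn_ge0// ltr_pdivlMr// => H; exists n.
  rewrite (le_lt_trans _ H)// exprVn mulrC ler_wpM2l ?invr_ge0 ?exprn_ge0//.
  by rewrite lerDl.
(* The affine approximation of f at p: its contour integral vanishes, so only the differentiability
   error remains. *)
pose g z := (f p - A * p) + A * z.
have eg : entire g by move=> z; apply: cdiffD (cdiff_cst _ _) (cdiffM (cdiff_cst _ _) (cdiff_id _)).
have : rc f (S n) <= 4 * (e' * (L / 2 ^+ n)) * (L / 2 ^+ n).
  rewrite /rc -[rect f _ _ _ _]subr0.
  rewrite -(rect_affine (f p - A * p) A (S n).1.1 (S n).1.2 (S n).2.1 (S n).2.2) -rectB//.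
  rewrite -[X in _ <= _ * X](size n); have /andP[G1 G2] := goodS n.
  apply: rect_bound => //; first exact: entireB.
  move=> u v hu hv.
  have hle : cabs (u +i* v - p) <= L / 2 ^+ n.
    rewrite -(size n) (le_trans (cabs_le_ReIm _))// lerD//=.
      by rewrite ler_norml; have := Hx n; lra.
    by rewrite ler_norml; have := Hy n; lra.
  have := HA (u +i* v - p) (le_lt_trans hle Hn).
  rewrite [p + _]addrC subrK (_ : f _ - _ - _ = f (u +i* v) - (f p - A * p + A * (u +i* v))); last by ring.
  by move=> /le_trans; apply; rewrite ler_wpM2l// ltW.
move=> H; have := rcS n; rewrite {1}/rc /= => /le_trans; apply.
rewrite (le_trans (ler_wpM2l _ H)) ?exprn_ge0//.
have -> : 4 ^+ n * (4 * (e' * (L / 2 ^+ n)) * (L / 2 ^+ n)) = 4 * e' * L ^+ 2 :> R.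
  rewrite (_ : 4 = 2 * 2 :> R); last by ring.
  by rewrite exprMn; field; rewrite expf_neq0.
rewrite /e' (_ : 4 * (e / (4 * (L + 1) ^+ 2)) * L ^+ 2 = e * (L ^+ 2 / (L + 1) ^+ 2)).
  rewrite ler_piMr ?(ltW e0)// ler_pdivrMr ?exprn_gt0// mul1r.
  by rewrite lerXn2r ?nnegrE ?(ltW L1)// lerDl.
by field; rewrite gt_eqF.
Qed.

End Goursat.

(** * Fourier coefficients of entire periodic functions *)

Section FourierUniqueness.
Variable R : realType.
Implicit Types (f h : R[i] -> R[i]) (g : R -> R[i]) (z w : R[i]) (k : int).

Definition fexp k z : R[i] := cexp (2 * ipi R * k%:~R * z).
Definition period1 h := forall z, h (z + 1) = h z.
Definition mean h : R[i] := cint (fun x : R => h x%:C) 0 1.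
Definition fcoef h k := mean (fun z => h z * fexp (- k) z).

Lemma fexpD k z w : fexp k (z + w) = fexp k z * fexp k w.
Proof. by rewrite /fexp mulrDr cexpD. Qed.

Lemma fexp_add k l z : fexp (k + l) z = fexp k z * fexp l z.
Proof. by rewrite /fexp -cexpD rmorphD /=; congr cexp; ring. Qed.

Lemma fexp_neq0 k z : fexp k z != 0. Proof. exact: cexp_neq0. Qed.

Lemma fexp0 k : fexp k 0 = 1. Proof. by rewrite /fexp mulr0 cexp0. Qed.

Lemma fexp0l z : fexp 0 z = 1. Proof. by rewrite /fexp mulr0 mul0r cexp0. Qed.

Lemma fexp1 k : fexp k 1 = 1. Proof. by rewrite /fexp mulr1 cexp2pii_int. Qed.

Lemma cabs_fexp k (x : R) : cabs (fexp k x%:C) = 1.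
Proof.
rewrite /fexp cabs_cexp (_ : Re _ = 0) ?expR0//.
by rewrite !ReImE /=; ring.
Qed.

Lemma entire_fexp k : entire (fexp k).
Proof. by move=> z; apply: cdiff_cexp; apply: cdiffM (cdiff_cst _ _) (cdiff_id _). Qed.

Lemma entireM f h : entire f -> entire h -> entire (fun z => f z * h z).
Proof. by move=> ef eh z; exact: cdiffM. Qed.

Lemma entire_cst (c : R[i]) : entire (fun=> c).
Proof. by move=> z; exact: cdiff_cst. Qed.

Lemma entire_affine f (a b : R[i]) : entire f -> entire (fun z => f (a * z + b)).
Proof.
move=> ef z; apply: (@cdiff_comp1 _ (R[i]^o) f (fun w => a * w + b)); last exact: ef.
exact: cdiffD (cdiffM (cdiff_cst _ _) (cdiff_id _)) (cdiff_cst _ _).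
Qed.

Lemma entire_shift f (w : R[i]) : entire f -> entire (fun z => f (z + w)).
Proof.
by move=> ef; have := entire_affine 1 w ef; congr entire; apply/funext => z; rewrite mul1r.
Qed.

Lemma ccont_real f : entire f -> ccont (fun x : R => f x%:C).
Proof. exact: ccont_hline. Qed.

Lemma meanD f h : entire f -> entire h ->
  mean (fun z => f z + h z) = mean f + mean h.
Proof. by move=> ef eh; rewrite /mean cintD//; exact: ccont_real. Qed.

Lemma meanZ (c : R[i]) f : entire f -> mean (fun z => c * f z) = c * mean f.
Proof. by move=> ef; rewrite /mean cintZ//; exact: ccont_real. Qed.

(* Contour shift: the vertical sides of the rectangle cancel by periodicity. *)
Lemma mean_shift f w : entire f -> period1 f -> mean (fun z => f (z + w)) = mean f.
Proof.
move=> ef pf; case: w => u v.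
have E : (fun x : R => f (x%:C + u +i* v)) = (fun x => f ((x + u) +i* v)).
  by apply/funext => x; congr f; apply: complex_eq; rewrite ReImE /= ?add0r.
rewrite /mean E (cint_periodic u (ccont_hline v ef)); last first.
  by move=> t; rewrite -[RHS]pf; congr f; apply: complex_eq; rewrite ReImE /= ?addr0.
have side y : f (1 +i* y) = f (0 +i* y).
  by rewrite -[RHS]pf; congr f; apply: complex_eq; rewrite ReImE /= ?addr0 ?add0r.
have aux c d : c <= d ->
    cint (fun x => f (x +i* c)) 0 1 = cint (fun x => f (x +i* d)) 0 1.
  move=> cd; have := goursat ef (ler01 : (0 : R) <= 1) cd; rewrite /rect.
  have -> : (fun y => f (1 +i* y)) = (fun y => f (0 +i* y)) by apply/funext.
  set A := cint _ 0 1; set B := cint _ c d; set D := cint _ 0 1.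
  rewrite (_ : _ - _ = A - D); last by ring.
  by move=> /eqP; rewrite subr_eq0 => /eqP.
by have [/aux|/ltW/aux] := leP v 0.
Qed.

Lemma mean_fexp k : k != 0 -> mean (fexp k) = 0.
Proof.
move=> k0; pose s : R[i] := 2 * ipi R * k%:~R.
have s0 : s != 0.
  rewrite !mulf_neq0 ?pnatr_eq0 ?intr_eq0//.
  by apply/eqP => -[] /eqP; rewrite gt_eqF// pi_gt0.
have dG : rcderiv (fun t : R => s^-1 * cexp (t%:C * s + 0)) (fun t => fexp k t%:C).
  have := rcderivZ s^-1 (rcderiv_cexp s 0); apply: rcderiv_ext => t //.
  by rewrite addr0 mulrA mulVf// mul1r /fexp -/s mulrC.
rewrite /mean (cintE _ _ dG) !addr0 mul0r mul1r cexp0 mulr1.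
by rewrite /s cexp2pii_int mulr1 subrr.
Qed.

Lemma mean1 : mean (fun=> 1) = 1.
Proof.
by rewrite /mean (cintE _ _ (@rcderiv_id R)) subr0.
Qed.

Lemma ccont_uniform g (e : R) : ccont g -> 0 < e -> exists2 d : R, 0 < d &
  forall s x, `|s| < d -> 0 <= x <= 1 -> cabs (g x - g (x + s)) <= e.
Proof.
move=> cg e0; have := @segment_compact R 0 1 => /compact_near_coveringP.
move=> /(_ _ (nbhs (0 : R)) (fun s x => cabs (g x - g (x + s)) <= e)).
move=> /(_ (nbhs_filter _) _)/wrap[x _|]; last first.
  move=> /nbhs_ballP[d /= d0 H]; exists d => // s x sd x01.
  by apply: H; rewrite /ball /= ?sub0r ?normrN ?in_itv.
have e20 : 0 < e / 2 by rewrite divr_gt0.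
have [d d0 H] := cg x _ e20.
exists (ball x (d / 2), ball (0 : R) (d / 2)).
  by split; apply: nbhsx_ballx; rewrite divr_gt0.
move=> [x' s] [/=]; rewrite /ball /= sub0r normrN => xx' sd.
have H1 : cabs (g x' - g x) <= e / 2 by apply: H; rewrite distrC; lra.
have H2 : cabs (g (x' + s) - g x) <= e / 2.
  apply: H; rewrite addrAC (le_lt_trans (ler_normD _ _))// distrC.
  by lra.
rewrite (_ : g x' - g (x' + s) = (g x' - g x) - (g (x' + s) - g x)); last by ring.
by rewrite (le_trans (ler_cabsB _ _))// [leRHS]splitr lerD.
Qed.

Lemma ccontM_fexp g k : ccont g -> ccont (fun x => g x * fexp k x%:C).
Proof.
move=> cg x e e0.
have e30 : 0 < e / 2 by rewrite divr_gt0.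
have [d1 d10 H1] := cg x _ e30.
have M0 : 0 < cabs (g x) + 1 by rewrite ltr_wpDl ?cabs_ge0.
have [d2 d20 H2] := ccont_real (entire_fexp k) x (divr_gt0 e30 M0).
exists (Num.min d1 d2) => [|t]; first by rewrite lt_min d10.
rewrite lt_min => /andP[/H1 {}H1 /H2 {}H2].
rewrite (_ : _ - _ = (g t - g x) * fexp k t%:C + g x * (fexp k t%:C - fexp k x%:C)); last by ring.
rewrite (le_trans (ler_cabsD _ _))// !cabsM cabs_fexp mulr1 [leRHS]splitr lerD//.
move: H2; rewrite ler_pdivlMr// => /(le_trans _); apply.
by rewrite mulrC ler_wpM2l ?cabs_ge0// lerDl.
Qed.

(* The translation by half a period of the character changes its sign. *)
Lemma riemann_lebesgue g (e : R) : ccont g -> (forall x, g (x + 1) = g x) -> 0 < e ->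
  exists N, forall k, (N < `|k|)%N -> cabs (cint (fun x => g x * fexp k x%:C) 0 1) <= e.
Proof.
move=> cg pg e0; have [d d0 H] := ccont_uniform cg e0.
exists (Num.truncn d^-1).+1 => k Nk.
have k0 : k != 0 by rewrite -absz_gt0 (leq_ltn_trans _ Nk).
have kR : (k%:~R : R) != 0 by rewrite intr_eq0.
pose s : R := (2 * k%:~R)^-1.
have sd : `|s| < d.
  rewrite /s normfV normrM normr_nat -intr_norm -natr_absz.
  rewrite invf_plt ?posrE ?mulr_gt0// ?ltr0n ?absz_gt0//.
  have : d^-1 < (Num.truncn d^-1).+1%:R by exact: truncnS_gt.
  have : (Num.truncn d^-1).+1%:R <= (`|k|%N)%:R :> R by rewrite ler_nat ltnW.
  have : 0 < d^-1 by rewrite invr_gt0.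
  by lra.
pose h x := g x * fexp k x%:C.
have ch : ccont h by exact: ccontM_fexp.
have ph x : h (x + 1) = h x by rewrite /h pg rmorphD /= fexpD fexp1 mulr1.
have hs x : h (x + s) = - (g (x + s) * fexp k x%:C).
  rewrite /h rmorphD /= fexpD mulrA mulrC (_ : fexp k s%:C = -1) ?mulN1r//.
  rewrite /fexp /s (_ : _ * _ = ipi R).
    by apply: complex_eq; rewrite /cexp /= expR0 ?cospi ?sinpi !mul1r// oppr0.
  rewrite fmorphV rmorphM rmorph_nat rmorph_int /= -mulrA; field.
  by rewrite intr_eq0.
have E : 2 * cint h 0 1 = cint (fun x => (g x - g (x + s)) * fexp k x%:C) 0 1.
  rewrite mulr_natl mulr2n -{2}(cint_periodic s ch ph) -cintD//; last exact: ccont_shift.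
  by congr cint; apply/funext => x; rewrite hs /h -mulrBl.
have : cabs (2 * cint h 0 1) <= 2 * e * (1 - 0).
  rewrite E; apply: cint_bound.
  - apply: (@ccontM_fexp (fun x => g x - g (x + s))).
    have := ccontD cg (ccontZ (-1) (ccont_shift s cg)).
    by congr ccont; apply/funext => x; rewrite mulN1r.
  - exact: ler01.
  - by move=> x x01; rewrite cabsM cabs_fexp mulr1 H.
by rewrite cabsM cabs_nat subr0 mulr1 ler_pM2l.
Qed.

(** Writing f - f 0 = (e_1 - 1) g makes each coefficient of f, apart from f 0 at k = 0, a difference
    of consecutive coefficients of g; this is Chernoff's device for pointwise Fourier
    convergence. *)
Lemma fourier_uniqueness0 f : entire f -> period1 f -> (forall k, fcoef f k = 0) ->
  f 0 = 0.
Proof.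
move=> ef pf f0.
have /differentiableC[A HA] := ef 0.
have B0 : 2 * ipi R != 0.
  rewrite mulf_neq0 ?pnatr_eq0//.
  by apply/eqP => -[] /eqP; rewrite gt_eqF// pi_gt0.
set B := 2 * ipi R in B0.
(* A / B is f' (0) / (2 pi i), the limit of the quotient at the integers, where the denominator
   vanishes; it makes g continuous. *)
pose g (x : R) := if fexp 1 x%:C == 1 then A / B else (f x%:C - f 0) / (fexp 1 x%:C - 1).
have pg x : g (x + 1) = g x.
  by rewrite /g rmorphD /= fexpD fexp1 mulr1 pf.
have fE x : f x%:C = f 0 + (fexp 1 x%:C - 1) * g x.
  rewrite /g; case: eqP => [|/eqP ne]; last by field; rewrite subr_eq0.
  rewrite {1}/fexp mulr1 => /cexp_eq1[k /(mulfI B0) ->].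
  rewrite {1}(_ : fexp _ _ = 1); last by rewrite /fexp mulr1 cexp2pii_int.
  rewrite subrr mul0r addr0.
  have Pn n : f n%:R = f 0 by elim: n => [|n IH]//; rewrite -addn1 natrD pf.
  case: k => n; first exact: Pn.
  rewrite NegzE rmorphN /= -[n.+1%:~R]/(n.+1%:R : R[i]).
  have Q m : f (- m%:R) = f 0.
    by elim: m => [|m IH]; rewrite ?oppr0// -IH -addn1 natrD opprD -(pf (_ - 1)) subrK.
  exact: Q.
have cg0 e : 0 < e -> exists2 d : R, 0 < d & forall t, `|t| < d -> cabs (g t - A / B) <= e.
  move=> e0; pose K := 1 + cabs (A / B).
  have K0 : 0 < K by rewrite ltr_wpDr ?cabs_ge0.
  have eK : 0 < Num.min 1 (e / K) by rewrite lt_min ltr01 divr_gt0.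
  have [d1 d10 H1] := HA _ eK.
  have Bpi : cabs B = 2 * pi by rewrite -[B]mulr1 /B cabs_2ipi cabs1 mulr1.
  have : is_cderiv (fexp 1) 0 B.
    apply: (@is_cderiv_quad _ _ _ _ (4 * cabs B ^+ 2 * expR (cabs B))) => h h1.
    rewrite add0r fexp0 /fexp mulr1 -/B (le_trans (cexp_taylor2 _))// cabsM exprMn.
    rewrite (_ : 4 * cabs B ^+ 2 * expR (cabs B) * cabs h ^+ 2
       = 4 * (cabs B ^+ 2 * cabs h ^+ 2) * expR (cabs B)); last by ring.
    rewrite ler_wpM2l ?mulr_ge0 ?exprn_ge0 ?cabs_ge0// ler_expR.
    by rewrite ler_piMr ?cabs_ge0 ?(ltW h1).
  move=> /(_ _ eK)[d2 d20 H2]; exists (Num.min d1 d2) => [|t]; first by rewrite lt_min d10.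
  rewrite lt_min => /andP[t1 t2].
  rewrite /g; case: eqP => [_|/eqP ne]; first by rewrite subrr cabs0 ltW.
  have ct : cabs t%:C = `|t| by rewrite cabs_real.
  have := H1 t%:C; have := H2 t%:C; rewrite ct !add0r fexp0 => /(_ t2) {}H2 /(_ t1) {}H1.
  have den : 0 < cabs (fexp 1 t%:C - 1) by rewrite cabs_gt0 subr_eq0.
  (* |B t| = 2 pi |t| is at least 4 |t|, while the remainder is at most |t|. *)
  have tden : `|t| <= cabs (fexp 1 t%:C - 1).
    have := ler_cabsB (fexp 1 t%:C - 1) (fexp 1 t%:C - 1 - B * t%:C).
    rewrite opprB addrC subrK cabsM Bpi ct.
    have : Num.min 1 (e / K) * `|t| <= `|t| by rewrite ler_piMl// ge_min lexx.
    have : 2 * `|t| <= pi * `|t| by rewrite ler_wpM2r// pi_ge2.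
    have := normr_ge0 t.
    by lra.
  rewrite (_ : (f t%:C - f 0) / _ - _ = ((f t%:C - f 0 - A * t%:C) - A / B * (fexp 1 t%:C - 1 - B * t%:C))
     / (fexp 1 t%:C - 1)); last first.
    by move: (fexp 1 t%:C) (B) ne B0 => E1 B1 ne1 B10; field; rewrite B10 subr_eq0 ne1.
  rewrite cabsM cabsV ler_pdivrMr// (le_trans (ler_cabsB _ _))// cabsM.
  have H3 := ler_wpM2l (cabs_ge0 (A / B)) H2.
  rewrite (le_trans (lerD H1 H3))//.
  rewrite (_ : _ + _ = K * (Num.min 1 (e / K) * `|t|)); last by rewrite /K; ring.
  rewrite mulrA (@le_trans _ _ (e * `|t|)) ?ler_wpM2l ?(ltW e0)// ler_wpM2r//.
  by rewrite mulrC -ler_pdivlMr// ge_min lexx orbT.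
have cg : ccont g.
  move=> x e e0; case: (eqVneq (fexp 1 x%:C) 1) => [x1|x1].
    have [d d0 H] := cg0 e e0; exists d => // t td.
    have gx : g x = A / B by rewrite /g x1 eqxx.
    have /cexp_eq1[k] : cexp (2 * ipi R * 1%:~R * x%:C) = 1 := x1.
    rewrite mulr1 => /(mulfI B0) xk.
    have {}xk : x = k%:~R.
      by have := congr1 (@Re R) xk; rewrite Re_int.
    have gk u : g (u + k%:~R) = g u.
      have Pn (n : nat) v : g (v + n%:R) = g v.
        elim: n v => [|n IH] v; first by rewrite addr0.
        by rewrite -addn1 natrD addrA pg.
      case: k {xk} => n; first exact: Pn.
      by rewrite NegzE rmorphN /= -(Pn n.+1) subrK.
    rewrite gx; have -> : g t = g (t - x) by rewrite -[in LHS](subrK x t) {2}xk gk.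
    exact: H.
  have := ccont_real ef; have := ccont_real (entire_fexp 1) => c1 c2.
  set D := cabs (fexp 1 x%:C - 1).
  have D0 : 0 < D by rewrite cabs_gt0 subr_eq0.
  (* D / 2 keeps the denominator at t away from 0; the second bound makes the numerator at most e
     D^2 / 2. *)
  have e1 : 0 < Num.min (D / 2) (e * D * D / (2 * (D + cabs (f x%:C - f 0)))).
    rewrite lt_min !divr_gt0// ?mulr_gt0// ltr_wpDr ?cabs_ge0//.
  have [d1 d10 H1] := c1 x _ e1.
  have [d2 d20 H2] := c2 x _ e1.
  exists (Num.min d1 d2) => [|t]; first by rewrite lt_min d10.
  rewrite lt_min => /andP[/H1 {}H1 /H2 {}H2].
  set m := Num.min _ _ in e1 H1 H2.
  have m1 : m <= D / 2 by rewrite ge_min lexx.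
  have m2 : m * (2 * (D + cabs (f x%:C - f 0))) <= e * D * D.
    by rewrite -ler_pdivlMr ?ge_min ?lexx ?orbT// mulr_gt0// ltr_wpDr ?cabs_ge0.
  have Dt : D / 2 <= cabs (fexp 1 t%:C - 1).
    have := lerB_cabs (fexp 1 x%:C - 1) (fexp 1 x%:C - fexp 1 t%:C).
    rewrite -/D (cabsB (fexp 1 x%:C) (fexp 1 t%:C)).
    rewrite (_ : fexp 1 x%:C - 1 - _ = fexp 1 t%:C - 1); last by ring.
    by lra.
  have nt : fexp 1 t%:C - 1 != 0 by rewrite -cabs_gt0 (lt_le_trans _ Dt)// divr_gt0.
  have nx : fexp 1 x%:C - 1 != 0 by rewrite subr_eq0.
  rewrite /g (negPf x1) -[fexp 1 t%:C == 1]subr_eq0 (negPf nt).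
  rewrite (_ : _ - _ = ((f t%:C - f x%:C) * (fexp 1 x%:C - 1)
     - (f x%:C - f 0) * (fexp 1 t%:C - fexp 1 x%:C))
       / ((fexp 1 t%:C - 1) * (fexp 1 x%:C - 1))); last by field; rewrite nt nx.
  rewrite cabsM cabsV ler_pdivrMr; last by rewrite cabs_gt0 mulf_neq0.
  rewrite (le_trans (ler_cabsB _ _))// !cabsM -/D.
  rewrite (@le_trans _ _ (m * D + cabs (f x%:C - f 0) * m))//.
    by rewrite lerD// ?ler_wpM2r ?ler_wpM2l ?cabs_ge0// ltW.
  rewrite (@le_trans _ _ (e * (D / 2 * D)))//; first by lra.
  by rewrite ler_wpM2l ?(ltW e0)// ler_wpM2r// ltW.
pose G k := cint (fun x => g x * fexp k x%:C) 0 1.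
(* For k != 0 this reads G (1 - k) = G (- k), so G is constant on the indices >= 1 and on those <=
   0; k = 0 compares the two constants and isolates f 0. *)
have rec k : f 0 * mean (fexp (- k)) + (G (1 - k) - G (- k)) = 0.
  have cgk l : ccont (fun x => g x * fexp l x%:C) by exact: ccontM_fexp.
  have ce : ccont (fun x => fexp (- k) x%:C) by apply: ccont_real; exact: entire_fexp.
  have cm := ccontZ (-1) (cgk (- k)).
  have <- : fcoef f k = f 0 * mean (fexp (- k)) + (G (1 - k) - G (- k)).
    rewrite -[X in _ + (_ + X)]mulN1r /fcoef /mean /G -!cintZ// -!cintD//.
    - by congr cint; apply/funext => x; rewrite fexp_add {1}fE; ring.
    - exact: ccontZ.
    - exact: ccontD.
  exact: f0.
have rec0 k : k != 0 -> G (1 - k) = G (- k).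
  move=> k0; have := rec k; rewrite mean_fexp ?oppr_eq0// mulr0 add0r.
  by move=> /eqP; rewrite subr_eq0 => /eqP.
have Gpos (n : nat) : G 1 = G n.+1%:Z.
  elim: n => // n ->.
  have E : G (1 - - n.+1%:Z) = G (- - n.+1%:Z) by exact: rec0.
  by rewrite opprK in E; rewrite -E.
have Gneg (n : nat) : G 0 = G (- n%:Z).
  elim: n => [|n ->]; first by rewrite oppr0.
  have <- : G (1 - n.+1%:Z) = G (- n.+1%:Z) by exact: rec0.
  by rewrite intS opprD addrA subrr add0r.
have small (k0 : int) : (forall N, exists2 k, (N < `|k|)%N & G k = G k0) -> G k0 = 0.
  move=> Hk; apply/eqP; rewrite -cabs_eq0; apply/eqP/le_anti; rewrite cabs_ge0 andbT.
  apply/ler_addgt0Pr => e e0; rewrite add0r.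
  have [N HN] := riemann_lebesgue cg pg e0; have [k /HN H <-] := Hk N.
  exact: H.
have G1 : G 1 = 0 by apply: small => N; exists N.+1%:Z.
have G0 : G 0 = 0 by apply: small => N; exists (- N.+1%:Z); rewrite ?abszN.
have := rec 0; rewrite subr0 oppr0 G1 G0 subrr addr0.
by rewrite (_ : fexp 0 = fun=> 1) ?mean1 ?mulr1//; apply/funext => z; exact: fexp0l.
Qed.

(** By contour shift, a complex translation acts on Fourier coefficients as a real one does. *)
Lemma fcoef_shift f k w : entire f -> period1 f ->
  fcoef (fun z => f (z + w)) k = fexp k w * fcoef f k.
Proof.
move=> ef pf; pose h z := f z * fexp (- k) z.
have eh : entire h by apply: entireM => //; exact: entire_fexp.
have ph : period1 h by move=> z; rewrite /h pf fexpD fexp1 mulr1.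
rewrite /fcoef -/h -(mean_shift w eh ph) -meanZ; last exact: entire_shift.
congr mean; apply/funext => z; rewrite /h fexpD.
have E : fexp k w * fexp (- k) w = 1 by rewrite -fexp_add subrr fexp0l.
by rewrite -[LHS]mulr1 -E; ring.
Qed.

Lemma fourier_uniqueness f : entire f -> period1 f -> (forall k, fcoef f k = 0) ->
  forall z, f z = 0.
Proof.
move=> ef pf f0 z; rewrite -[z]add0r; apply: (@fourier_uniqueness0 (fun w => f (w + z))).
- exact: entire_shift.
- by move=> w; rewrite addrAC pf.
- by move=> k; rewrite fcoef_shift// f0 mulr0.
Qed.

(** Translation by tau multiplies the k-th coefficient by exp (2 pi i k tau), of modulus different
    from 1 for k != 0, so only the constant coefficient survives. *)
Lemma doubly_periodic_cst f (tau : R[i]) : 0 < Im tau -> entire f -> period1 f ->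
  (forall z, f (z + tau) = f z) -> forall z w, f z = f w.
Proof.
move=> tau0 ef pf pt.
have fk k : k != 0 -> fcoef f k = 0.
  move=> k0; have := fcoef_shift k tau ef pf.
  rewrite (_ : (fun z => f (z + tau)) = f); last exact/funext.
  rewrite -[X in X = _]mul1r => /eqP; rewrite -subr_eq0 -mulrBl mulf_eq0.
  case/orP => [|/eqP//]; rewrite subr_eq0 eq_sym => /eqP/(congr1 (@cabs R)).
  rewrite cabs1 cabs_cexp -expR0 => /expR_inj/eqP.
  rewrite (_ : Re _ = - (2 * pi * (k%:~R * Im tau))); last by rewrite !ReImE /=; ring.
  by rewrite oppr_eq0 !mulf_eq0 pnatr_eq0 intr_eq0 (negPf k0) !gt_eqF ?pi_gt0.
pose c := fcoef f 0; suff H z : f z - c = 0.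
  by move=> z w; have /eqP := H z; have /eqP := H w; rewrite !subr_eq0 => /eqP-> /eqP->.
apply: (@fourier_uniqueness (fun z => f z - c)).
- exact: entireB (entire_cst _).
- by move=> w; rewrite pf.
- move=> k; have eF := entireM ef (entire_fexp (- k)).
  rewrite /fcoef (_ : (fun _ => _) = fun z => f z * fexp (- k) z + - c * fexp (- k) z).
    rewrite meanD//; last exact: entireM (entire_cst _) (entire_fexp _).
    rewrite meanZ; last exact: entire_fexp.
    have [->|k0] := eqVneq k 0.
      rewrite oppr0 (_ : fexp 0 = fun=> 1) ?mean1 ?mulr1.
        by rewrite /c /fcoef oppr0 (_ : fexp 0 = fun=> 1) ?subrr//; apply/funext => ?; exact: fexp0l.
      by apply/funext => ?; exact: fexp0l.
    by rewrite mean_fexp ?oppr_eq0// mulr0 addr0; exact: fk.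
  by apply/funext => w; rewrite mulrBl mulNr.
Qed.

End FourierUniqueness.

(** * Theta functions of degree m *)

Section DegreeM.
Variables (R : realType) (m : nat) (xi tau : R[i]).
Hypotheses (m0 : (0 < m)%N) (tau0 : 0 < Im tau).
Implicit Types (f : R[i] -> R[i]) (z w : R[i]) (j l : 'I_m).

(** The multiplier of degree m under translation by tau; its slope - 2 pi i m in the exponent is the
    source of the index shift by m below. *)
Definition theta_mult z : R[i] :=
  cexp (- (ipi R * (m%:R * tau)) - 2 * ipi R * (m%:R * z + xi)).

Definition Theta j w : R[i] :=
  theta_char (j%:R / m%:R) 0 (m%:R * w + xi) (m%:R * tau).

Let mC : m%:R != 0 :> R[i]. Proof. by rewrite pnatr_eq0 -lt0n. Qed.

Let mtau0 : 0 < Im (m%:R * tau).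
Proof. by rewrite !ReImE mul0r addr0 mulr_gt0// ltr0n. Qed.

Lemma entire_Theta j : entire (Theta j).
Proof.
have e : entire (fun w => theta_char (j%:R / m%:R) 0 w (m%:R * tau)).
  by move=> w; exact: theta_char_differentiable.
exact: (entire_affine m%:R xi e).
Qed.

Let omega (j : nat) : R[i] := cexp (2 * ipi R * (j%:R / m%:R)).

Let alphaE j : (j%:R / m%:R : R)%:C = j%:R / m%:R.
Proof. by rewrite rmorphM fmorphV !rmorph_nat. Qed.

(** An eigenvector of translation by 1 / m: this separates the m functions by the residue modulo m
    of their Fourier indices. *)
Lemma Theta_add_invm j w : Theta j (w + m%:R^-1) = omega j * Theta j w.
Proof.
rewrite /Theta mulrDr mulfV// addrAC theta_char_add1//.
by rewrite alphaE.
Qed.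

Lemma Theta_period1 j : period1 (Theta j).
Proof.
move=> w; have P n : Theta j (w + n%:R * m%:R^-1) = omega j ^+ n * Theta j w.
  elim: n => [|n IH]; first by rewrite mul0r addr0 mul1r.
  by rewrite -natr1 mulrDl mul1r addrA Theta_add_invm IH exprS mulrA.
have := P m; rewrite mulfV// => ->; rewrite /omega -cexpMn.
have -> : m%:R * (2 * ipi R * (j%:R / m%:R)) = 2 * ipi R * j%:Z%:~R.
  by rewrite mulrCA; congr (_ * _); rewrite mulrC divfK.
by rewrite cexp2pii_int mul1r.
Qed.

Lemma Theta_addtau j w : Theta j (w + tau) = theta_mult w * Theta j w.
Proof.
by rewrite /Theta mulrDr addrAC theta_char_addtau// addr0.
Qed.

Lemma Theta_neq0 j : exists w, Theta j w != 0.
Proof.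
have [w Ew] : exists w, Theta j w = cexp (ipi R * (m%:R * tau) * ((j%:R / m%:R)%:C - 2^-1) ^+ 2
        + 2 * ipi R * ((j%:R / m%:R)%:C - 2^-1) * (m%:R * w + xi + 0%:C))
    * theta (m%:R * tau) 2^-1.
  (* This w brings the argument of theta to 1 / 2, which is no lattice point for m tau: imaginary
     parts force b = 0, and then 1 / 2 would be an integer. *)
  exists ((1 - ((j%:R / m%:R)%:C - 2^-1) * (m%:R * tau) - xi) / m%:R).
  rewrite /Theta theta_char_theta//; congr (_ * theta _ _).
  rewrite [m%:R * (_ / _)]mulrCA mulfV//.
  by field.
exists w; rewrite Ew mulf_neq0 ?cexp_neq0// theta_neq0// => -[a [b E]].
have := congr1 (@Im R) E; have := congr1 (@Re R) E.
rewrite -half_real Re_add Im_add [Re (b%:~R * _)]Re_mul [Im (b%:~R * _)]Im_mul !Re_int !Im_int.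
rewrite !mul0r subr0 addr0 add0r [Re _%:C]/= [Im _%:C]/= => E1 /esym/eqP.
rewrite mulf_eq0 (gt_eqF mtau0) orbF intr_eq0 => /eqP b0.
move: E1; rewrite b0 mul0r addr0 => /(congr1 (fun x => x * 2)).
rewrite mulVf ?pnatr_eq0// => H.
have : (1%:Z%:~R : R) = (a * 2%:Z)%:~R by rewrite intrM.
by move=> /intr_inj; lia.
Qed.

(** The k-th coefficient of f (z + tau) is computed twice: by translation it is exp (2 pi i k tau)
    times the k-th of f, by quasi-periodicity a constant times the (k + m)-th. *)
Lemma fcoef_step f k : entire f -> period1 f ->
  (forall z, f (z + tau) = theta_mult z * f z) ->
  exists2 c : R[i], c != 0 & fcoef f k = c * fcoef f (k + m%:Z).
Proof.
move=> ef pf tf.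
exists (fexp (- k) tau * cexp (- (ipi R * (m%:R * tau)) - 2 * ipi R * xi)).
  by apply: mulf_neq0; [exact: fexp_neq0|exact: cexp_neq0].
have E := fcoef_shift k tau ef pf.
have F : fcoef (fun z => f (z + tau)) k =
    cexp (- (ipi R * (m%:R * tau)) - 2 * ipi R * xi) * fcoef f (k + m%:Z).
  rewrite /fcoef -meanZ; last exact: entireM ef (entire_fexp _).
  congr mean; apply/funext => z; rewrite tf opprD fexp_add.
  rewrite (_ : theta_mult z = cexp (- (ipi R * (m%:R * tau)) - 2 * ipi R * xi)
     * fexp (- m%:Z) z); first by ring.
  by rewrite /theta_mult /fexp -cexpD rmorphN /=; congr cexp; ring.
rewrite -mulrA -F E mulrA -fexp_add addNr fexp0l mul1r //.
Qed.

(** Coefficients in one residue class modulo m are nonzero multiples of one another, so the indices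
    below m decide all of them. *)
Lemma fcoef_all0 f : entire f -> period1 f ->
  (forall z, f (z + tau) = theta_mult z * f z) ->
  (forall j, fcoef f j%:Z = 0) -> forall z, f z = 0.
Proof.
move=> ef pf tf f0; apply: fourier_uniqueness => // k.
have up (l : int) : fcoef f l = 0 <-> fcoef f (l + m%:Z) = 0.
  have [c c0 ->] := fcoef_step l ef pf tf; split=> [/eqP|->]; last by rewrite mulr0.
  by rewrite mulf_eq0 (negPf c0) => /eqP.
have upn (n : nat) (l : int) : fcoef f l = 0 <-> fcoef f (l + n%:Z * m%:Z) = 0.
  elim: n l => [|n IH] l; first by rewrite mul0r addr0.
  rewrite (_ : l + n.+1%:Z * m%:Z = l + m%:Z + n%:Z * m%:Z); last by rewrite intS; ring.
  exact: iff_trans (up l) (IH _).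
have mz : m%:Z != 0 by rewrite -lt0n.
have r0 : 0 <= (k %% m%:Z)%Z by exact: modz_ge0.
have rm : (k %% m%:Z)%Z < m%:Z by rewrite ltz_pmod// ltz_nat.
have [r rE] : exists r : nat, (k %% m%:Z)%Z = r%:Z.
  by exists `|(k %% m%:Z)%Z|%N; rewrite gez0_abs.
have rlt : (r < m)%N by rewrite -ltz_nat -rE.
have fr : fcoef f r%:Z = 0 := f0 (Ordinal rlt).
rewrite (divz_eq k m%:Z) rE; case: (k %/ m%:Z)%Z => n.
  by rewrite addrC; exact: (upn n r%:Z).1.
apply: (upn n.+1 _).2; rewrite NegzE.
by rewrite (_ : - n.+1%:Z * m%:Z + r%:Z + n.+1%:Z * m%:Z = r%:Z)//; ring.
Qed.

(** Translation by 1 / m multiplies the l-th coefficient by exp (2 pi i l / m), and also by exp (2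
    pi i j / m); for distinct l and j below m these differ. *)
Lemma fcoef_Theta j l : l != j -> fcoef (Theta j) l%:Z = 0.
Proof.
move=> lj; have := fcoef_shift l%:Z m%:R^-1 (entire_Theta j) (Theta_period1 j).
rewrite (_ : (fun z => _) = fun z => omega j * Theta j z); last first.
  by apply/funext => z; rewrite Theta_add_invm.
rewrite /fcoef (_ : (fun z => _) = fun z => omega j * (Theta j z * fexp (- l%:Z) z)); last first.
  by apply/funext => z; rewrite mulrA.
rewrite meanZ; last exact: entireM (entire_Theta j) (entire_fexp _).
move=> /eqP; rewrite -subr_eq0 -mulrBl mulf_eq0 => /orP[|/eqP//].
have -> : fexp l%:Z m%:R^-1 = omega l.
  by rewrite /fexp /omega -mulrA.
rewrite subr_eq0 => /eqP E; exfalso.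
have : cexp (2 * ipi R * ((j%:R - l%:R) / m%:R)) = 1.
  by rewrite mulrBl mulrBr cexpB -/(omega j) -/(omega l) E divff// cexp_neq0.
have B0 : 2 * ipi R != 0.
  by rewrite mulf_neq0 ?pnatr_eq0//; apply/eqP => -[] /eqP; rewrite gt_eqF// pi_gt0.
move=> /cexp_eq1[k /(mulfI B0)] /(congr1 (fun x => x * m%:R)); rewrite divfK//.
have -> : j%:R - l%:R = (j%:Z - l%:Z)%:~R :> R[i] by rewrite rmorphB.
rewrite -[m%:R]/(m%:Z%:~R) -intrM => /eqP; rewrite eqr_int => /eqP H.
move/eqP: lj; apply; apply/val_inj => /=.
have := ltn_ord j; have := ltn_ord l; move: H; move: (nat_of_ord j) (nat_of_ord l) => a b.
have [->|k0] := eqVneq k 0; first by rewrite mul0r; lia.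
by nia.
Qed.

Lemma fcoefB_sum f (c : 'I_m -> R[i]) k : entire f ->
  fcoef (fun z => f z - \sum_(j < m) c j * Theta j z) k
    = fcoef f k - \sum_(j < m) c j * fcoef (Theta j) k.
Proof.
move=> ef; have eT j := entireM (entire_Theta j) (entire_fexp (- k)).
have eS (s : seq 'I_m) : entire (fun z => \sum_(j <- s) - c j * (Theta j z * fexp (- k) z)).
  by move=> z; apply: cdiff_sum => j _; apply: cdiffM (cdiff_cst _ _) _; exact: eT.
have mS (s : seq 'I_m) : mean (fun z => \sum_(j <- s) - c j * (Theta j z * fexp (- k) z))
    = \sum_(j <- s) - c j * fcoef (Theta j) k.
  elim: s => [|j s IH].
    rewrite big_nil (_ : (fun z => _) = fun=> 0 * 1); last first.
      by apply/funext => z; rewrite big_nil mul0r.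
    by rewrite (@meanZ _ 0 (fun=> 1)) ?mul0r//; exact: entire_cst.
  rewrite big_cons (_ : (fun z => _) = fun z => - c j * (Theta j z * fexp (- k) z)
    + \sum_(j <- s) - c j * (Theta j z * fexp (- k) z)); last first.
    by apply/funext => z; rewrite big_cons.
  by rewrite meanD// ?meanZ// ?IH//; exact: entireM (entire_cst _) (eT j).
rewrite {1}/fcoef (_ : (fun z => _) = fun z => f z * fexp (- k) z
  + \sum_(j < m) - c j * (Theta j z * fexp (- k) z)); last first.
  apply/funext => z; rewrite mulrBl mulr_suml -sumrN; congr (_ + _).
  by apply: eq_bigr => j _; ring.
rewrite meanD//; last exact: entireM ef (entire_fexp _).
by rewrite mS -sumrN; congr (_ + _); apply: eq_bigr => j _; rewrite mulNr.
Qed.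

Lemma theta_span f : entire f -> period1 f ->
  (forall z, f (z + tau) = theta_mult z * f z) ->
  exists c : 'I_m -> R[i], forall z, f z = \sum_(j < m) c j * Theta j z.
Proof.
move=> ef pf tf.
(* Otherwise all coefficients with index below m vanish, and [Theta j] would be zero. *)
have T0 j : fcoef (Theta j) j%:Z != 0.
  apply/eqP => T0; have [w /eqP] := Theta_neq0 j; apply.
  apply: fcoef_all0; [exact: entire_Theta|exact: Theta_period1|exact: Theta_addtau|].
  by move=> l; have [->//|] := eqVneq l j; exact: fcoef_Theta.
pose c j := fcoef f j%:Z / fcoef (Theta j) j%:Z; exists c => z.
suff H w : f w - \sum_(j < m) c j * Theta j w = 0.
  by apply/eqP; rewrite -subr_eq0 H.
apply: (@fcoef_all0 (fun w => f w - \sum_(j < m) c j * Theta j w)).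
- move=> x; apply: cdiffB; first exact: ef.
  by apply: cdiff_sum => j _; apply: cdiffM (cdiff_cst _ _) _; exact: entire_Theta.
- move=> x; rewrite pf; congr (_ - _); apply: eq_bigr => j _.
  by rewrite Theta_period1.
- move=> x; rewrite tf mulrBr mulr_sumr; congr (_ - _); apply: eq_bigr => j _.
  by rewrite Theta_addtau; ring.
- move=> l; rewrite fcoefB_sum// (bigD1 l)//= big1 ?addr0.
    by rewrite /c divfK ?subrr.
  by move=> j jl; rewrite fcoef_Theta ?mulr0// eq_sym.
Qed.

End DegreeM.

(** * Transformation laws in several variables *)

Section PairProducts.
Variables (A : comPzRingType) (n : nat).

(* The pairs containing i are indexed by their other element. *)
Lemma prod_pairs_with (c : 'I_n -> A) (i : 'I_n) :
  \prod_(p < n) \prod_(q < n | (p < q)%N)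
     (if p == i then c q else if q == i then c p else 1)
  = \prod_(r < n | r != i) c r.
Proof.
rewrite (bigD1 i)//= [RHS](bigID (fun r : 'I_n => (i < r)%N)) /=; congr (_ * _).
  rewrite [RHS](eq_bigl (fun r : 'I_n => (i < r)%N)); last first.
    by move=> r; rewrite andb_idl// => ir; apply: contraTneq ir => ->; rewrite ltnn.
  by apply: eq_bigr => q _; rewrite eqxx.
rewrite big_mkcondr /=; apply: eq_bigr => p /negPf pi.
have [ip|pi'] := ltnP i p; rewrite ?ip ?pi' /=.
  rewrite big1// => q pq; rewrite pi; case: eqP => // qi.
  by move: pq; rewrite qi ltnNge (ltnW ip).
rewrite leq_eqVlt in pi'.
have {}pi' : (p < i)%N by move: pi'; rewrite -(inj_eq val_inj)/= in pi *; rewrite pi.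
rewrite (bigD1 i)//= eqxx pi big1 ?mulr1// => q /andP[_ /negPf qi].
by rewrite qi.
Qed.

Lemma prod_pairsM (F G : 'I_n -> 'I_n -> A) :
  (\prod_(p < n) \prod_(q < n | (p < q)%N) (F p q * G p q)) =
  (\prod_(p < n) \prod_(q < n | (p < q)%N) F p q) *
  (\prod_(p < n) \prod_(q < n | (p < q)%N) G p q).
Proof. by rewrite -big_split /=; apply: eq_bigr => p _; rewrite big_split. Qed.

End PairProducts.

Section Vandermonde.
Variables (R : realType) (m n : nat) (xi tau : R[i]).
Hypotheses (m0 : (0 < m)%N) (n0 : (0 < n)%N) (tau0 : 0 < Im tau).
Implicit Types (z a v : 'rV[R[i]]_n) (f : 'rV[R[i]]_n -> R[i]) (i p q r : 'I_n).

Definition wsum z : R[i] := \sum_(p < n) z 0 p.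
Definition disc z : R[i] :=
  (\prod_(p < n) \prod_(q < n | (p < q)%N) theta tau (z 0 p - z 0 q)) ^+ m.
(** Under either period of one coordinate, each of the n - 1 theta factors containing it contributes
    a sign, to the power m; this sign selects the bundle in the definition of W. *)
Definition wsign : R[i] := (-1) ^+ (m * n.-1).
Definition disc_mult i z : R[i] :=
  (\prod_(r < n | r != i) phi tau (z 0 i - z 0 r)) ^+ m.
Definition W_mult (x : R[i]) : R[i] :=
  cexp (- (2 * ipi R * xi)) * phi tau x ^+ (m * n).

Lemma PhiE (j : 'I_m) z : Phi xi tau j z = Theta xi tau j (wsum z) * disc z.
Proof. by []. Qed.

Lemma wsumD z v : wsum (z + v) = wsum z + wsum v.
Proof. by rewrite /wsum -big_split /=; apply: eq_bigr => p _; rewrite mxE. Qed.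

Lemma wsumZ (c : R[i]) v : wsum (c *: v) = c * wsum v.
Proof. by rewrite /wsum mulr_sumr; apply: eq_bigr => p _; rewrite mxE. Qed.

Lemma wsum_delta i : wsum (delta_mx 0 i) = 1.
Proof.
rewrite /wsum (bigD1 i)//= mxE !eqxx big1 ?addr0// => p /negPf pi.
by rewrite mxE pi.
Qed.

Lemma wsign_neq0 : wsign != 0.
Proof. by rewrite /wsign signr_eq0. Qed.

Lemma theta_add1 (x : R[i]) : theta tau (x + 1) = - theta tau x.
Proof.
rewrite /theta theta_char_add1// half_real (_ : cexp _ = -1) ?mulN1r//.
rewrite (_ : _ * _ = ipi R); last by field.
by apply: complex_eq; rewrite /cexp /= expR0 ?cospi ?sinpi !mul1r// oppr0.
Qed.

Lemma theta_sub1 (x : R[i]) : theta tau (x - 1) = - theta tau x.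
Proof. by rewrite -{2}(subrK 1 x) theta_add1 opprK. Qed.

Lemma theta_addtau (x : R[i]) : theta tau (x + tau) = - phi tau x * theta tau x.
Proof.
rewrite /theta theta_char_addtau// half_real; congr (_ * _).
rewrite (_ : - (ipi R * tau) - 2 * ipi R * (x + 2^-1) =
  (- (ipi R * tau) - 2 * ipi R * x) + - ipi R); last by field.
rewrite cexpD mulrC (_ : cexp (- ipi R) = -1) ?mulN1r//.
by apply: complex_eq; rewrite /cexp /= oppr0 expR0 ?cosN ?sinN ?cospi ?sinpi !mul1r// oppr0.
Qed.

Lemma theta_subtau (x : R[i]) : theta tau (x - tau) = - phi tau (- x) * theta tau x.
Proof.
rewrite -[x - tau]opprK opprB addrC theta_opp// theta_addtau.
by rewrite theta_opp//; ring.
Qed.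

(** One computation for both periods: [c r] is the multiplier of the factor pairing i with r,
    whichever of the two comes first. *)
Lemma prod_theta_delta (c : 'I_n -> R[i]) i z (t : R[i]) :
  (forall q, theta tau (z 0 i - z 0 q + t) = c q * theta tau (z 0 i - z 0 q)) ->
  (forall p, theta tau (z 0 p - z 0 i - t) = c p * theta tau (z 0 p - z 0 i)) ->
  \prod_(p < n) \prod_(q < n | (p < q)%N)
     theta tau ((z + t *: delta_mx 0 i) 0 p - (z + t *: delta_mx 0 i) 0 q) =
  (\prod_(r < n | r != i) c r) *
  \prod_(p < n) \prod_(q < n | (p < q)%N) theta tau (z 0 p - z 0 q).
Proof.
move=> H1 H2; rewrite -prod_pairs_with -prod_pairsM; apply: eq_bigr => p _.
apply: eq_bigr => q pq; rewrite !mxE eqxx /=.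
have [pi|pi] := eqVneq p i.
  have /negPf qi : q != i by apply: contraTneq pq => ->; rewrite pi ltnn.
  by rewrite qi pi mulr0 addr0 mulr1 addrAC H1.
have [qi|qi] := eqVneq q i; last by rewrite !mulr0 !addr0 mul1r.
by rewrite qi mulr0 addr0 mulr1 opprD addrA H2.
Qed.

Lemma disc_add1 i z : disc (z + delta_mx 0 i) = wsign * disc z.
Proof.
rewrite /disc -[delta_mx 0 i]scale1r (@prod_theta_delta (fun=> -1) i z 1).
- rewrite exprMn; congr (_ * _); rewrite prodr_const /wsign mulnC exprM.
  by congr (_ ^+ _ ^+ _); have := cardC1 i; rewrite card_ord => <-.
- by move=> q; rewrite theta_add1 mulN1r.
- by move=> q; rewrite theta_sub1 mulN1r.
Qed.

Lemma disc_addtau i z :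
  disc (z + tau *: delta_mx 0 i) = wsign * disc_mult i z * disc z.
Proof.
rewrite /disc (@prod_theta_delta (fun r => - phi tau (z 0 i - z 0 r)) i z tau).
- rewrite exprMn; congr (_ * _); rewrite prodrN exprMn /wsign mulnC exprM; congr (_ * _).
  by congr (_ ^+ _ ^+ _); have := cardC1 i; rewrite card_ord => <-.
- by move=> q; rewrite theta_addtau.
- by move=> q; rewrite theta_subtau opprB.
Qed.

Lemma phi_neq0 (x : R[i]) : phi tau x != 0.
Proof. exact: cexp_neq0. Qed.

Lemma disc_mult_neq0 i z : disc_mult i z != 0.
Proof. by apply: expf_neq0; apply/prodf_neq0 => r _; exact: phi_neq0. Qed.

Lemma cexp_sum (I : Type) (s : seq I) (P : pred I) (F : I -> R[i]) :
  cexp (\sum_(k <- s | P k) F k) = \prod_(k <- s | P k) cexp (F k).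
Proof. exact: (big_morph _ (@cexpD R) (@cexp0 R)). Qed.

(** The sum over r of z_i - z_r is n z_i - w, so the dependence on the other coordinates cancels and
    degree mn in z_i alone remains. *)
Lemma theta_mult_disc_mult i z :
  theta_mult m xi tau (wsum z) * disc_mult i z = W_mult (z 0 i).
Proof.
rewrite /theta_mult /disc_mult /W_mult /phi -cexp_sum -!cexpMn -!cexpD; congr cexp.
(* The sum is completed by its term r = i, which is - pi i tau. *)
have -> : \sum_(r < n | r != i) (- (ipi R * tau) - 2 * ipi R * (z 0 i - z 0 r)) =
    ipi R * tau + \sum_(r < n) (- (ipi R * tau) - 2 * ipi R * (z 0 i - z 0 r)).
  by rewrite [in RHS](bigD1 i)//= subrr mulr0 subr0 addrA subrr add0r.
have -> : \sum_(r < n) (- (ipi R * tau) - 2 * ipi R * (z 0 i - z 0 r)) =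
    - (n%:R * (ipi R * tau)) - 2 * ipi R * (n%:R * z 0 i - wsum z).
  rewrite sumrB sumr_const card_ord -mulr_sumr sumrB sumr_const card_ord.
  by rewrite -[_ *+ n]mulr_natl mulrN -[z 0 i *+ n]mulr_natl.
by rewrite natrM; ring.
Qed.

(** Merges the two cases of the bundle into one formula, with the sign as a factor. *)
Lemma bundle_W_factorE (x : R[i]) :
  mult_1 (bundle_W_factor m n xi tau) x = wsign /\
  mult_tau (bundle_W_factor m n xi tau) x = wsign * W_mult x.
Proof.
rewrite /bundle_W_factor /wsign /W_mult -(signr_odd int) -(signr_odd R[i]).
by case: (odd _); rewrite /= ?expr0 ?expr1 ?mulN1r ?mul1r.
Qed.

Lemma sections_WP f : sections_W m xi tau f <->
  holomorphic f /\ forall i z, f (z + delta_mx 0 i) = wsign * f z /\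
    f (z + tau *: delta_mx 0 i) = wsign * W_mult (z 0 i) * f z.
Proof.
split=> -[hf H]; split=> // i z; have [H1 H2] := H i z.
  by have [<- <-] := bundle_W_factorE (z 0 i).
by have [-> ->] := bundle_W_factorE (z 0 i).
Qed.

Definition hol_at f z := cdiff (f : 'rV[R[i]^o]_n -> R[i]) (z : 'rV[R[i]^o]_n).

Lemma hol_coord p z : hol_at (fun z => z 0 p) z.
Proof. exact: (@differentiable_coord R[i] 1 n z 0 p). Qed.

Lemma holomorphicW f : (forall z, hol_at f z) -> holomorphic f.
Proof. by move=> hf a; apply: filterE => z; exact: hf. Qed.

Lemma holomorphic_hol f z : holomorphic f -> hol_at f z.
Proof. by move=> /(_ z) /nbhs_singleton. Qed.

Lemma hol_comp (h : R[i] -> R[i]) f z : entire h -> hol_at f z -> hol_at (fun z => h (f z)) z.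
Proof. by move=> eh hf; exact: cdiff_comp1 hf (eh _). Qed.

Lemma hol_diff p q z : hol_at (fun z => z 0 p - z 0 q) z.
Proof. exact: cdiffB (hol_coord p z) (hol_coord q z). Qed.

Lemma hol_wsum z : hol_at wsum z.
Proof. by apply: cdiff_sum => p _; exact: hol_coord. Qed.

Lemma entire_theta : entire (theta tau).
Proof. by move=> z; exact: theta_char_differentiable. Qed.

Lemma hol_disc z : hol_at disc z.
Proof.
apply: cdiffX; apply: cdiff_prod => p _; apply: cdiff_prod => q _.
exact: hol_comp entire_theta (hol_diff p q z).
Qed.

Lemma hol_Sigma_eqn p q a z : hol_at (Sigma_eqn p q a) z.
Proof. exact: cdiffB (hol_diff p q z) (cdiff_cst _ _). Qed.

Lemma haldane_rezayi_W f : haldane_rezayi m xi tau f -> sections_W m xi tau f.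
Proof.
move=> [c Hc]; apply/sections_WP; split.
  apply: holomorphicW => z.
  rewrite (_ : f = fun z => \sum_(j < m) c j * Phi xi tau j z); last exact/funext.
  apply: cdiff_sum => j _; apply: cdiffM (cdiff_cst _ _) _.
  exact: cdiffM (hol_comp (entire_Theta xi m0 tau0 j) (hol_wsum z)) (hol_disc z).
move=> i z; rewrite !Hc !mulr_sumr; split; apply: eq_bigr => j _; rewrite !PhiE.
  by rewrite wsumD wsum_delta Theta_period1// disc_add1; ring.
rewrite wsumD wsumZ wsum_delta mulr1 Theta_addtau// disc_addtau -theta_mult_disc_mult.
by ring.
Qed.

Lemma haldane_rezayi_twist f : haldane_rezayi m xi tau f ->
  sections_W_twist m xi tau f.
Proof.
move=> hf; split; first exact: haldane_rezayi_W.
case: hf => c Hc a.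
(* For every pair at once: the cofactor of theta after removal of the local equation, or theta
   itself when a is off that hypersurface. *)
have [pq|U HU] := @boolp.choice ('I_n * 'I_n)%type (R[i] -> R[i]) (fun pq u => entire u /\
   forall x, theta tau x = (if a \in Sigma tau pq.1 pq.2 then x - (a 0 pq.1 - a 0 pq.2) else 1) * u x).
  have [|nS] := boolP (a \in Sigma tau pq.1 pq.2).
    move=> /set_mem/(theta_factor tau0)[u [eu _ Hu]]; exists u; split=> //.
  by exists (theta tau); split=> [|x]; [exact: entire_theta|rewrite mul1r].
exists (fun z => (\sum_(j < m) c j * Theta xi tau j (wsum z)) *
  (\prod_(p < n) \prod_(q < n | (p < q)%N) U (p, q) (z 0 p - z 0 q)) ^+ m); split.
  apply: filterE => z; apply: cdiffM.
    apply: cdiff_sum => j _; apply: cdiffM (cdiff_cst _ _) _.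
    exact: hol_comp (entire_Theta xi m0 tau0 j) (hol_wsum z).
  apply: cdiffX; apply: cdiff_prod => p _; apply: cdiff_prod => q _.
  exact: hol_comp (HU (p, q)).1 (hol_diff p q z).
apply: filterE => z; rewrite Hc mulrCA -exprMn.
under eq_bigr do rewrite PhiE mulrA.
rewrite -mulr_suml; congr (_ * _ ^+ m).
under [X in X * _]eq_bigr do rewrite big_mkcondr /=.
rewrite -prod_pairsM; apply: eq_bigr => p _; apply: eq_bigr => q _.
exact: (HU (p, q)).2.
Qed.

Lemma twist_vanishes f p q : sections_W_twist m xi tau f -> (p < q)%N ->
  vanishes_to_order tau p q m f.
Proof.
move=> [_ H] pq a aS; have [g [hg Hg]] := H a.
have aS' : a \in Sigma tau p q by exact/mem_set.
pose A z := \prod_(q' < n | ((p < q')%N && (a \in Sigma tau p q')) && (q' != q)) Sigma_eqn p q' a z.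
pose B z := \prod_(p' < n | p' != p) \prod_(q' < n | (p' < q')%N && (a \in Sigma tau p' q'))
  Sigma_eqn p' q' a z.
exists (fun z => (A z * B z) ^+ m * g z); split.
  apply: filterS hg => z dg; apply: cdiffM => //; apply: cdiffX; apply: cdiffM.
    by apply: cdiff_prod => q' _; exact: hol_Sigma_eqn.
  apply: cdiff_prod => p' _; apply: cdiff_prod => q' _; exact: hol_Sigma_eqn.
apply: filterS Hg => z ->; rewrite (bigD1 p)//= (bigD1 q)/=; last by rewrite pq aS'.
by rewrite -/(A z) -/(B z) !exprMn; ring.
Qed.

End Vandermonde.

(** * Removable singularities *)

Section PuncturedNeighbourhoods.
Variable R : realType.
Implicit Types (f h k : R[i]^o -> R[i]) (s t : R[i]^o).

Lemma near_neq0 f t : cdiff f t -> f t != 0 -> \forall s \near t, f s != 0.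
Proof.
move=> /cdiff_continuous cf ft; have ft0 : 0 < cabs (f t) by rewrite cabs_gt0.
have fC : (0 : R[i]) < (cabs (f t))%:C by rewrite ltcR.
move: cf => /cvgrPdist_lt /(_ _ fC); apply: filterS => s; rewrite normC_cabs ltcR => H.
by apply/eqP => fs; move: H; rewrite fs subr0 ltxx.
Qed.

Lemma near_dnbhs t (P : R[i]^o -> Prop) : (\forall s \near t, P s) -> \forall s \near t^', P s.
Proof. exact: nbhs_dnbhs. Qed.

Lemma punctured_eq0 f t : cdiff f t -> (\forall s \near t^', f s = 0) -> f t = 0.
Proof.
move=> cf f0; have [//|/(near_neq0 cf)/near_dnbhs ft] := eqVneq (f t) 0.
have PF : ProperFilter t^' by exact: Proper_dnbhs_numFieldType.
by have /filter_ex[s [-> /eqP]] := @filterI _ _ PF _ _ f0 ft.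
Qed.

(* Neighbourhoods of t0, with t0 removed, are neighbourhoods of their points. *)
Lemma near_dnbhs_open t0 (P : R[i]^o -> Prop) : (\forall s \near t0^', P s) ->
  \forall t \near t0, t <> t0 -> \forall s \near t, P s.
Proof.
rewrite /dnbhs /within /= => /nearC_cabs[d d0 H]; apply/nearC_cabs; exists d => // t td tt0.
have t0' : 0 < cabs (t - t0) by rewrite cabs_gt0 subr_eq0; apply/eqP.
apply/nearC_cabs; exists (Num.min (d - cabs (t - t0)) (cabs (t - t0))).
  by rewrite lt_min subr_gt0 td.
move=> s; rewrite lt_min => /andP[s1 s2]; apply: H.
  rewrite (_ : s - t0 = (s - t) + (t - t0)); last by ring.
  by rewrite (le_lt_trans (ler_cabsD _ _))// -ltrBrDr.
by apply/eqP => st; move: s2; rewrite st cabsB ltxx.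
Qed.

(** [h] may have junk values at its singularities, such as those of a division by 0. The glued
    function takes at t the value of the extension chosen at t; two extensions agree off a point,
    hence at it by continuity. *)
Lemma removable_glue h : (forall t0, exists k,
    (\forall t \near t0, cdiff k t) /\ (\forall t \near t0^', h t = k t)) ->
  exists H : R[i] -> R[i], entire H /\
    (forall t0, \forall t \near t0^', H t = h t) /\
    (forall t, cdiff h t -> H t = h t).
Proof.
move=> ext; have [K HK] := @boolp.choice _ _ _ ext.
have agree k t : cdiff k t -> (\forall s \near t^', h s = k s) -> K t t = k t.
  move=> dk hk; apply/eqP; rewrite -subr_eq0; apply/eqP.
  apply: (@punctured_eq0 (fun s => K t s - k s)).
    by apply: cdiffB => //; exact: (nbhs_singleton (HK t).1).
  by have [_ hK] := HK t; near=> s; rewrite -(near hK s)// -(near hk s)// subrr.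
pose H (t : R[i]) := K t t.
have loc t0 : \forall t \near t0, H t = K t0 t.
  have [dk hk] := HK t0; apply: filterS2 dk (near_dnbhs_open hk) => t dkt hkt.
  have [->//|/eqP tt0] := eqVneq t t0.
  exact: (agree (K t0) t dkt (near_dnbhs (hkt tt0))).
exists H; split=> [t0|].
  have [dk _] := HK t0; apply: (@near_cdiff1 R (K t0)).
    by apply: filterS (loc t0) => t ->.
  exact: (nbhs_singleton dk).
split=> [t0|t dh]; last by apply: agree => //; apply: filterE.
have [_ hk] := HK t0; near=> t; rewrite (near hk t)//.
by near: t; apply: near_dnbhs; exact: loc.
Unshelve. all: by end_near. Qed.

End PuncturedNeighbourhoods.

Section IsolatedZeros.
Variables (R : realType) (tau : R[i]).
Hypothesis tau0 : 0 < Im tau.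

(** A zero at s = 0 is simple, with a cofactor that stays nonzero nearby. This provides the density
    of generic points. *)
Lemma theta_isolated (d l : R[i]) : l != 0 ->
  \forall s \near (0 : R[i]^o)^', theta tau (d + s * l) != 0.
Proof.
move=> l0.
have lin (u : R[i] -> R[i]) : entire u -> entire (fun s => u (d + s * l)).
  move=> eu; have := entire_affine l d eu; congr entire; apply/funext => s.
  by rewrite addrC mulrC.
have [dz|dz] := eqVneq (theta tau d) 0; last first.
  apply: near_dnbhs; apply: (@near_neq0 _ (fun s => theta tau (d + s * l))).
    exact: lin (entire_theta tau0) _.
  by rewrite mul0r addr0.
have /(theta_factor tau0)[u [eu u0 Hu]] : lattice tau d by apply/(theta_eq0 tau0).
have nu : \forall s \near (0 : R[i]^o), u (d + s * l) != 0.
  apply: (@near_neq0 _ (fun s => u (d + s * l))); first exact: lin eu _.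
  by rewrite mul0r addr0.
have s0 := @nbhs_dnbhs_neq (R[i]^o) 0.
have FF : Filter (0 : R[i]^o)^' by exact: dnbhs_filter.
apply: filterS2 s0 (near_dnbhs nu) => s s0 us.
by rewrite Hu addrAC subrr add0r !mulf_neq0.
Qed.

End IsolatedZeros.

(** * Division by the Vandermonde product of theta functions *)

Section Lattice.
Variables (R : realType) (tau : R[i]).
Implicit Types x y : R[i].

Lemma latticeN x : lattice tau x -> lattice tau (- x).
Proof. by move=> [a [b ->]]; exists (- a), (- b); rewrite !rmorphN /=; ring. Qed.

Lemma latticeD x y : lattice tau x -> lattice tau y -> lattice tau (x + y).
Proof.
move=> [a [b ->]] [c [d ->]]; exists (a + c), (b + d); rewrite !rmorphD /=; ring.
Qed.

End Lattice.

Section Divisibility.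
Variables (R : realType) (m n : nat) (xi tau : R[i]).
Hypotheses (m0 : (0 < m)%N) (n0 : (0 < n)%N) (tau0 : 0 < Im tau).
Implicit Types (z x v e : 'rV[R[i]]_n) (i p q r a b c d : 'I_n) (t : R[i]).

Local Notation disc := (disc m tau).

Lemma disc_neq0 z : (forall a b, (a < b)%N -> theta tau (z 0 a - z 0 b) != 0) -> disc z != 0.
Proof.
move=> H; apply: expf_neq0; apply/prodf_neq0 => a _; apply/prodf_neq0 => b ab.
exact: H.
Qed.

Lemma disc_eq0 z : disc z = 0 ->
  exists a b, (a < b)%N /\ theta tau (z 0 a - z 0 b) = 0.
Proof.
move=> /eqP dz; have [/existsP[a /existsP[b /andP[ab /eqP tab]]]|] :=
  boolP [exists a : 'I_n, exists b : 'I_n, (a < b)%N && (theta tau (z 0 a - z 0 b) == 0)].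
  by exists a, b.
move=> /existsPn H; exfalso; move/eqP: dz; apply/eqP; apply: disc_neq0 => a b ab.
by have /existsPn/(_ b) := H a; rewrite ab.
Qed.

Definition disc_rest a b z : R[i] :=
  (\prod_(q < n | (a < q)%N && (q != b)) theta tau (z 0 a - z 0 q)) *
  \prod_(p < n | p != a) \prod_(q < n | (p < q)%N) theta tau (z 0 p - z 0 q).

Lemma disc_split a b z : (a < b)%N ->
  disc z = (theta tau (z 0 a - z 0 b) * disc_rest a b z) ^+ m.
Proof.
move=> ab; rewrite /disc (bigD1 a)//= (bigD1 b)//= /disc_rest mulrA.
by [].
Qed.

Lemma hol_disc_rest a b z : hol_at (disc_rest a b) z.
Proof.
apply: cdiffM; first by apply: cdiff_prod => q _; exact: hol_comp (entire_theta tau0) (hol_diff a q z).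
by apply: cdiff_prod => p _; apply: cdiff_prod => q _; exact: hol_comp (entire_theta tau0) (hol_diff p q z).
Qed.

Lemma disc_rest_neq0 a b z : (forall c d, (c < d)%N ->
    theta tau (z 0 c - z 0 d) = 0 -> c = a /\ d = b) -> disc_rest a b z != 0.
Proof.
move=> H; apply: mulf_neq0.
  apply/prodf_neq0 => q /andP[aq qb]; apply/eqP => /(H _ _ aq)[_ E].
  by rewrite E eqxx in qb.
apply/prodf_neq0 => p pa; apply/prodf_neq0 => q pq; apply/eqP => /(H _ _ pq)[E _].
by rewrite E eqxx in pa.
Qed.

Lemma lineE z v t a : (z + t *: v) 0 a = z 0 a + t * v 0 a.
Proof. by rewrite !mxE. Qed.

Lemma differentiable_line z v (t : R[i]^o) :
  differentiable (fun s : R[i]^o => z + s *: v : 'rV[R[i]^o]_n) t.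
Proof.
by apply: (@differentiableD _ _ _ (cst (z : 'rV[R[i]^o]_n)) (fun s : R[i]^o => s *: (v : 'rV[R[i]^o]_n))).
Qed.

Lemma cdiff_line (F : 'rV[R[i]]_n -> R[i]) z v (t : R[i]^o) :
  hol_at F (z + t *: v) -> cdiff (fun s : R[i]^o => F (z + s *: v)) t.
Proof. by move=> hF; exact: cdiff_comp (differentiable_line z v t) hF. Qed.

Lemma near_line (P : 'rV[R[i]]_n -> Prop) z v (t : R[i]^o) :
  (\forall y \near (z + t *: v : 'rV[R[i]^o]_n), P y) ->
  \forall s \near t, P (z + s *: v).
Proof.
move=> H; have /differentiable_continuous cl := differentiable_line z v t.
exact: cl H.
Qed.

Definition dirv p q : 'rV[R[i]]_n := delta_mx 0 p - delta_mx 0 q.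

Lemma dirvE p q r : dirv p q 0 r = (r == p)%:R - (r == q)%:R.
Proof. by rewrite !mxE eqxx. Qed.

(** The first condition excludes pairs that are congruent all along the line. The second excludes
    that z_p + t and z_q - t are congruent to z_r and z_s for the same t, which drops out of the
    sum; r = s is included. *)
Definition generic p q z :=
  (forall a b, a != b -> theta tau (z 0 a - z 0 b) != 0) /\
  (forall r s, r != p -> r != q -> s != p -> s != q ->
     theta tau (z 0 r + z 0 s - z 0 p - z 0 q) != 0).

Lemma theta_eq0W t : theta tau t = 0 -> lattice tau t.
Proof. exact: (theta_eq0 tau0 t).1. Qed.

Lemma set2_ord_inj a b c d : (a < b)%N -> (c < d)%N ->
  [set a; b]%SET = [set c; d]%SET :> {set 'I_n} -> a = c /\ b = d.
Proof.
move=> ab cd E.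
have ha : a \in [set c; d]%SET by rewrite -E !inE eqxx.
have hb : b \in [set c; d]%SET by rewrite -E !inE eqxx orbT.
move: ha hb ab; rewrite !inE => /orP[]/eqP-> /orP[]/eqP-> //; rewrite ?ltnn//.
by move=> dc; have := ltn_trans cd dc; rewrite ltnn.
Qed.

(* On a generic line in the direction e_p - e_q at most one of the hypersurfaces
   is met at a time. *)
Lemma generic_one_pair p q z t a b c d : p != q -> generic p q z ->
  let x := z + t *: dirv p q in (a < b)%N -> (c < d)%N ->
  theta tau (x 0 a - x 0 b) = 0 -> theta tau (x 0 c - x 0 d) = 0 ->
  c = a /\ d = b.
Proof.
move=> pq [G1 G2] x ab cd /theta_eq0W tab /theta_eq0W tcd.
pose sim r s := lattice tau (x 0 r - x 0 s).
have simC r s : sim r s -> sim s r by move=> /latticeN; rewrite opprB.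
have simT r s u : sim r s -> sim s u -> sim r u.
  by move=> H1 H2; have := latticeD H1 H2; rewrite addrA subrK.
have xo r : r != p -> r != q -> x 0 r = z 0 r.
  by move=> /negPf rp /negPf rq; rewrite mxE [X in _ + X]mxE dirvE rp rq subrr mulr0 addr0.
have xp : x 0 p = z 0 p + t.
  by rewrite mxE [X in _ + X]mxE dirvE eqxx (negPf pq) subr0 mulr1.
have xq : x 0 q = z 0 q - t.
  by rewrite mxE [X in _ + X]mxE dirvE eqxx eq_sym (negPf pq) sub0r mulrN1.
have N1 r s : r != p -> r != q -> s != p -> s != q -> sim r s -> r = s.
  move=> rp rq sp sq; rewrite /sim !xo// => /(theta_lattice0 tau0) rs.
  by apply/eqP; apply: contraTT (_ : theta tau (z 0 r - z 0 s) == 0) => [/G1//|]; exact/eqP.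
have N2 r s : r != p -> r != q -> s != p -> s != q -> sim p r -> sim q s -> False.
  move=> rp rq sp sq /latticeN H1 /latticeN H2; have := latticeD H1 H2.
  rewrite xp xq !xo// (_ : _ + _ = z 0 r + z 0 s - z 0 p - z 0 q); last by ring.
  by move=> /(theta_lattice0 tau0)/eqP; apply/negP; exact: G2.
(* A congruent pair must meet {p, q}. Two different ones would give two congruent coordinates
   outside {p, q}, against [N1], or make both p and q congruent to such coordinates, against
   [N2]. *)
have form u w : u != w -> sim u w ->
   [set u; w]%SET = [set p; q]%SET /\ sim p q
   \/ (exists r, [/\ r != p, r != q, sim p r & [set u; w]%SET = [set p; r]%SET])
   \/ (exists r, [/\ r != p, r != q, sim q r & [set u; w]%SET = [set q; r]%SET]).
  move=> uw uw'; have wu : w != u by rewrite eq_sym.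
  have wu' := simC _ _ uw'.
  have [up|up] := eqVneq u p.
    rewrite up in uw uw' wu wu' *.
    have [wq|wq] := eqVneq w q; first by left; rewrite wq in uw' *.
    by right; left; exists w.
  have [uq|uq] := eqVneq u q.
    rewrite uq in uw uw' wu wu' *.
    have [wp|wp] := eqVneq w p; first by left; rewrite wp in wu' *; rewrite finset.setUC.
    by right; right; exists w.
  have [wp|wp] := eqVneq w p.
    by rewrite wp in uw uw' wu wu' *; right; left; exists u; rewrite finset.setUC.
  have [wq|wq] := eqVneq w q.
    by rewrite wq in uw uw' wu wu' *; right; right; exists u; rewrite finset.setUC.
  by move: uw; rewrite (N1 u w)// eqxx.
have nab : a != b by rewrite -(inj_eq val_inj) neq_ltn ab.
have ncd : c != d by rewrite -(inj_eq val_inj) neq_ltn cd.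
apply: set2_ord_inj => //.
case: (form _ _ nab tab) => [[-> pq1]|[[r [rp rq sr ->]]|[r [rp rq sr ->]]]];
  case: (form _ _ ncd tcd) => [[-> pq2]|[[s [sp sq ss ->]]|[s [sp sq ss ->]]]] //.
- by exfalso; apply: (N2 s s) => //; apply: simT ss; exact: simC.
- by exfalso; apply: (N2 s s) => //; apply: simT ss.
- by exfalso; apply: (N2 r r) => //; apply: simT sr; exact: simC.
- by rewrite (N1 s r)//; apply: simT sr; exact: simC.
- by exfalso; apply: (N2 r s).
- by exfalso; apply: (N2 r r) => //; apply: simT sr.
- by exfalso; apply: (N2 s r).
- by rewrite (N1 s r)//; apply: simT sr; exact: simC.
Qed.

Variable f : 'rV[R[i]]_n -> R[i].
Hypothesis fW : sections_W m xi tau f.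
Hypothesis fvan : forall p q, (p < q)%N -> vanishes_to_order tau p q m f.

(** The value is 0 where [disc] vanishes; with this convention the transformation laws below hold at
    every point. *)
Let rho z : R[i] := f z / disc z.

Lemma hol_f z : hol_at f z.
Proof. by case: fW => hf _; exact: holomorphic_hol. Qed.

Lemma rho_add1 i z : rho (z + delta_mx 0 i) = rho z.
Proof.
have /sections_WP[_ /(_ i z)[H _]] := fW.
by rewrite /rho H disc_add1// -mulf_div divff ?mul1r// wsign_neq0.
Qed.

Lemma rho_addtau i z : rho (z + tau *: delta_mx 0 i) = theta_mult m xi tau (wsum z) * rho z.
Proof.
have /sections_WP[_ /(_ i z)[_ H]] := fW.
rewrite /rho H disc_addtau// -(theta_mult_disc_mult m xi tau i z).
have s0 := wsign_neq0 R m n; have K0 := disc_mult_neq0 m tau i z.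
have [->|D0] := eqVneq (disc z) 0; first by rewrite mulr0 !invr0 !mulr0.
by field; rewrite s0 K0 D0.
Qed.

Lemma rho_dirv p q z : rho (z + dirv p q) = rho z.
Proof. by rewrite -(rho_add1 q) /dirv addrA subrK rho_add1. Qed.

Lemma wsum_dirv p q : wsum (dirv p q) = 0.
Proof.
have := wsumD (dirv p q) (delta_mx 0 q); rewrite /dirv subrK !wsum_delta => /eqP.
by rewrite -subr_eq subrr eq_sym => /eqP.
Qed.

(** The direction has coordinate sum 0, so the multipliers, which depend on w alone, cancel. *)
Lemma rho_tau_dirv p q z : rho (z + tau *: dirv p q) = rho z.
Proof.
apply: (mulfI (cexp_neq0 _ : theta_mult m xi tau (wsum z) != 0)).
rewrite -[RHS](rho_addtau p).
rewrite (_ : z + tau *: delta_mx 0 p = (z + tau *: dirv p q) + tau *: delta_mx 0 q); last first.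
  by rewrite /dirv scalerBr addrA subrK.
by rewrite rho_addtau wsumD wsumZ wsum_dirv mulr0 addr0.
Qed.

(** Where [disc] vanishes, exactly one pair is responsible; with its local equation s one has f =
    s^m g and [disc] = (s U)^m with U nonzero, and the quotient extends by g / U^m. *)
Lemma rho_local p q z (t0 : R[i]^o) : p != q -> generic p q z ->
  exists k : R[i]^o -> R[i], (\forall t \near t0, cdiff k t) /\
    (\forall t \near t0^', rho (z + t *: dirv p q) = k t).
Proof.
move=> pq gz; pose v := dirv p q; pose x := z + t0 *: v.
have [dx|dx] := eqVneq (disc x) 0; last first.
  exists (fun t => rho (z + t *: v)); split; last by apply: near_dnbhs; apply: filterE.
  have nd : \forall t \near t0, disc (z + t *: v) != 0.
    by apply: (@near_neq0 _ (fun t => disc (z + t *: v))) => //; apply: cdiff_line; exact: hol_disc.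
  apply: filterS nd => t dt; apply: cdiffM; first by apply: cdiff_line; exact: hol_f.
  by apply: cdiffV => //; apply: cdiff_line; exact: hol_disc.
have [a [b [ab tab]]] := disc_eq0 dx.
have [|g [hg fg]] := fvan ab (_ : Sigma tau a b x); first exact: theta_eq0W.
have [u [eu u0 Hu]] := theta_factor tau0 (theta_eq0W tab).
(* The line is transversal to the hypersurface: otherwise z_a - z_b would itself be a zero of theta,
   against genericity. *)
have vab : v 0 a - v 0 b != 0.
  apply/eqP => vab; have nab : a != b by rewrite -(inj_eq val_inj) neq_ltn ab.
  have /eqP := gz.1 a b nab; apply.
  move/eqP: vab; rewrite subr_eq0 => /eqP vab.
  by rewrite -tab /x !lineE vab; congr theta; ring.
have rest0 : disc_rest a b x != 0.
  by apply: disc_rest_neq0 => c d cd tcd; exact: (generic_one_pair pq gz ab cd tab tcd).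
pose U (y : 'rV[R[i]]_n) := u (y 0 a - y 0 b) * disc_rest a b y.
have hU y : hol_at U y.
  by apply: cdiffM; [exact: hol_comp eu (hol_diff a b y)|exact: hol_disc_rest].
have nU : \forall t \near t0, U (z + t *: v) != 0.
  apply: (@near_neq0 _ (fun t => U (z + t *: v))); first by apply: cdiff_line; exact: hU.
  exact: mulf_neq0.
exists (fun t => g (z + t *: v) / U (z + t *: v) ^+ m); split.
  apply: filterS2 nU (near_line hg) => t Ut gt; apply: cdiffM; first exact: cdiff_line.
  apply: cdiffV; last by rewrite expf_neq0.
  by apply: cdiffX; apply: cdiff_line; exact: hU.
have nt := @nbhs_dnbhs_neq (R[i]^o) t0.
have FF : Filter (t0 : R[i]^o)^' by exact: dnbhs_filter.
apply: filterS3 nt (near_dnbhs nU) (near_dnbhs (near_line fg)) => t tt0 Ut E.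
set y := z + t *: v in Ut E *; set w := Sigma_eqn a b x y in E.
have w0 : w != 0.
  have -> : w = (t - t0) * (v 0 a - v 0 b).
    rewrite /w /Sigma_eqn (lineE z v t a) (lineE z v t b) (lineE z v t0 a) (lineE z v t0 b).
    by ring.
  by rewrite mulf_neq0// subr_eq0.
have Ed : disc y = (w * U y) ^+ m by rewrite (disc_split _ ab) Hu /w /U /Sigma_eqn mulrA.
rewrite /rho E Ed.
by rewrite exprMn -mulf_div divff ?mul1r// expf_neq0.
Qed.

Lemma rho_generic p q z t : p != q -> generic p q z -> disc z != 0 ->
  disc (z + t *: dirv p q) != 0 -> rho (z + t *: dirv p q) = rho z.
Proof.
move=> pq gz dz dt.
have [H [eH [nearH HE]]] := removable_glue (fun t0 => rho_local t0 pq gz).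
have drho (s : R[i]) : disc (z + s *: dirv p q) != 0 ->
    cdiff (fun s : R[i]^o => rho (z + s *: dirv p q)) (s : R[i]^o).
  move=> ds; apply: cdiffM; first by apply: cdiff_line; exact: hol_f.
  by apply: cdiffV => //; apply: cdiff_line; exact: hol_disc.
(* Periods of [rho] pass to H, which agrees with it near every point, the point itself excepted. *)
have per (c : R[i]) : (forall y, rho (y + c *: dirv p q) = rho y) ->
    forall s, H (s + c) = H s.
  move=> rc s; apply/eqP; rewrite -subr_eq0; apply/eqP.
  apply: (@punctured_eq0 _ (fun s => H (s + c) - H s)).
    by apply: cdiffB; [exact: (entire_shift c eH)|exact: eH].
  have FF : Filter (s : R[i]^o)^' by exact: dnbhs_filter.
  have nc : \forall w \near (s : R[i]^o)^', H (w + c) = rho (z + (w + c) *: dirv p q).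
    have := nearH (s + c); rewrite /dnbhs /within /= => /nearC_cabs[d d0 Hd].
    apply/nearC_cabs; exists d => // w wd ws; apply: Hd.
      by rewrite opprD addrACA subrr addr0.
    by rewrite (inj_eq (addIr c)).
  apply: filterS2 nc (nearH s) => w -> ->.
  by rewrite scalerDl addrA rc subrr.
have Hc := doubly_periodic_cst tau0 eH
  (per 1 (fun y => etrans (congr1 (fun w => rho (y + w)) (scale1r _)) (rho_dirv p q y)))
  (per tau (rho_tau_dirv p q)).
have := Hc t 0; rewrite (HE t (drho t dt)) HE; last by apply: drho; rewrite scale0r addr0.
by rewrite scale0r addr0.
Qed.

Lemma near_disc_neq0 z e : (forall a b, a != b -> e 0 a - e 0 b != 0) ->
  \forall s \near (0 : R[i]^o)^', disc (z + s *: e) != 0.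
Proof.
move=> He; have FF : Filter (0 : R[i]^o)^' by exact: dnbhs_filter.
have H : \forall s \near (0 : R[i]^o)^', forall ab : 'I_n * 'I_n, ab.1 != ab.2 ->
    theta tau (z 0 ab.1 - z 0 ab.2 + s * (e 0 ab.1 - e 0 ab.2)) != 0.
  apply: filter_forall => -[a b] /=; have [->|ab] := eqVneq a b; first by apply: filterE.
  by apply: filterS (theta_isolated tau0 (z 0 a - z 0 b) (He a b ab)).
apply: filterS H => s Hs; apply: disc_neq0 => a b ab.
have nab : a != b by rewrite -(inj_eq val_inj) neq_ltn ab.
have := Hs (a, b) nab; rewrite !mxE /=; congr (theta _ _ != 0).
by ring.
Qed.

Lemma near_generic p q z e : (forall a b, a != b -> e 0 a - e 0 b != 0) ->
  (forall r s, r != p -> r != q -> s != p -> s != q ->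
     e 0 r + e 0 s - e 0 p - e 0 q != 0) ->
  \forall s \near (0 : R[i]^o)^', generic p q (z + s *: e).
Proof.
move=> He1 He2; have FF : Filter (0 : R[i]^o)^' by exact: dnbhs_filter.
have H1 : \forall s \near (0 : R[i]^o)^', forall ab : 'I_n * 'I_n, ab.1 != ab.2 ->
    theta tau (z 0 ab.1 - z 0 ab.2 + s * (e 0 ab.1 - e 0 ab.2)) != 0.
  apply: filter_forall => -[a b] /=; have [->|ab] := eqVneq a b; first by apply: filterE.
  by apply: filterS (theta_isolated tau0 (z 0 a - z 0 b) (He1 a b ab)).
have H2 : \forall s \near (0 : R[i]^o)^', forall rs : 'I_n * 'I_n,
    [&& rs.1 != p, rs.1 != q, rs.2 != p & rs.2 != q] ->
    theta tau (z 0 rs.1 + z 0 rs.2 - z 0 p - z 0 q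
       + s * (e 0 rs.1 + e 0 rs.2 - e 0 p - e 0 q)) != 0.
  apply: filter_forall => -[r s] /=.
  have [/and4P[rp rq sp sq]|_] := boolP [&& r != p, r != q, s != p & s != q]; last by apply: filterE.
  by apply: filterS (theta_isolated tau0 (z 0 r + z 0 s - z 0 p - z 0 q) (He2 r s rp rq sp sq)).
apply: filterS2 H1 H2 => s Hs1 Hs2; split=> [a b ab|r u rp rq up uq].
  by have := Hs1 (a, b) ab; rewrite !mxE /=; congr (theta _ _ != 0); ring.
have := Hs2 (r, u); rewrite /= rp rq up uq => /(_ isT); rewrite !mxE; congr (theta _ _ != 0).
by ring.
Qed.

(* Distinct integer coordinates, with the sum of two coordinates outside {p, q}
   never equal to the sum -3 of the coordinates p and q. *)
Lemma generic_direction p q : p != q -> exists e : 'rV[R[i]]_n,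
  (forall a b, a != b -> e 0 a - e 0 b != 0) /\
  (forall r s, r != p -> r != q -> s != p -> s != q ->
     e 0 r + e 0 s - e 0 p - e 0 q != 0).
Proof.
move=> pq.
pose c (r : 'I_n) : int := if r == p then - 1 else if r == q then - 2%:Z else r%:Z.
exists (\row_r (c r)%:~R); split=> [a b ab|r s rp rq sp sq]; rewrite !mxE.
  rewrite -rmorphB intr_eq0 subr_eq0 /c.
  have [ap|ap] := eqVneq a p; have [bp|bp] := eqVneq b p; rewrite ?ap ?bp ?eqxx // in ab *.
    by case: (b == q).
    by case: (a == q).
  have [aq|aq] := eqVneq a q; have [bq|bq] := eqVneq b q; rewrite ?aq ?bq ?eqxx // in ab *.
rewrite -rmorphD -!rmorphB intr_eq0 /c eqxx (negPf rp) (negPf rq) (negPf sp) (negPf sq).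
by rewrite [q == p]eq_sym (negPf pq) eqxx; lia.
Qed.

(** Invariance of f / [disc] under translation by e, multiplied out: it makes sense on the zeros of
    [disc], and both sides are holomorphic in z. *)
Definition proportional e := forall z, f (z + e) * disc z = f z * disc (z + e).

(** The density argument: continuity along a single line through z suffices. *)
Lemma perturb (F : 'rV[R[i]]_n -> R[i]) e z : (forall y, hol_at F y) ->
  (\forall s \near (0 : R[i]^o)^', F (z + s *: e) = 0) -> F z = 0.
Proof.
move=> hF F0; have := @punctured_eq0 _ (fun s => F (z + s *: e)) 0 (cdiff_line (hF _)) F0.
by rewrite scale0r addr0.
Qed.

Lemma hol_shift (F : 'rV[R[i]]_n -> R[i]) e z : (forall y, hol_at F y) ->
  hol_at (fun y => F (y + e)) z.
Proof.
move=> hF.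
have d : differentiable (fun y : 'rV[R[i]^o]_n => y + (e : 'rV[R[i]^o]_n)) (z : 'rV[R[i]^o]_n).
  by apply: (@differentiableD _ _ _ id (cst (e : 'rV[R[i]^o]_n))).
exact: cdiff_comp d (hF _).
Qed.

Lemma hol_proportional e z :
  hol_at (fun z => f (z + e) * disc z - f z * disc (z + e)) z.
Proof.
apply: cdiffB; apply: cdiffM.
- by apply: hol_shift; exact: hol_f.
- exact: hol_disc.
- exact: hol_f.
- by apply: hol_shift; exact: hol_disc.
Qed.

Lemma proportional_dirv p q t : p != q -> proportional (t *: dirv p q).
Proof.
move=> pq z; apply/eqP; rewrite -subr_eq0; apply/eqP.
have [e [He1 He2]] := generic_direction pq.
apply: (perturb (hol_proportional _) (e := e)).
have FF : Filter (0 : R[i]^o)^' by exact: dnbhs_filter.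
apply: filterS3 (near_generic z He1 He2) (near_disc_neq0 z He1)
  (near_disc_neq0 (z + t *: dirv p q) He1) => s gs ds ds'.
rewrite addrAC in ds'; have := rho_generic pq gs ds ds'; rewrite /rho => /eqP.
by rewrite eqr_div// => /eqP ->; rewrite subrr.
Qed.

Lemma distinct_direction : exists e : 'rV[R[i]]_n, forall a b, a != b -> e 0 a - e 0 b != 0.
Proof.
exists (\row_r (r : nat)%:R) => a b ab; rewrite !mxE subr_eq0 eqr_nat.
by rewrite (inj_eq val_inj).
Qed.

(** Composing the two identities means cancelling [disc] at z + e1, which is nonzero after a small
    perturbation of z. *)
Lemma proportionalD e1 e2 : proportional e1 -> proportional e2 -> proportional (e1 + e2).
Proof.
move=> H1 H2 z; apply/eqP; rewrite -subr_eq0; apply/eqP.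
have [e He] := distinct_direction.
apply: (perturb (hol_proportional _) (e := e)).
apply: filterS (near_disc_neq0 (z + e1) He) => s ds; rewrite addrAC in ds.
apply: (mulIf ds); rewrite mul0r mulrBl.
have := H2 (z + s *: e + e1); have := H1 (z + s *: e); rewrite !addrA => E1 E2.
by rewrite mulrAC E2 mulrAC E1; ring.
Qed.

Lemma proportional0 : proportional 0.
Proof. by move=> z; rewrite addr0. Qed.

Lemma proportional_wsum0 e : wsum e = 0 -> proportional e.
Proof.
move=> e0; pose o : 'I_n := Ordinal n0.
(* The differences of basis vectors e_r - e_o span the hyperplane of coordinate sum 0. *)
have -> : e = \sum_(r < n) e 0 r *: dirv r o.
  rewrite /dirv (eq_bigr (fun r => e 0 r *: delta_mx 0 r - e 0 r *: delta_mx 0 o)).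
    by rewrite sumrB -row_sum_delta -scaler_suml -/(wsum e) e0 scale0r subr0.
  by move=> r _; rewrite scalerBr.
elim/big_rec: _ => [|r y _ IH]; first exact: proportional0.
apply: proportionalD => //; have [->|ro] := eqVneq r o.
  by rewrite /dirv subrr scaler0; exact: proportional0.
exact: proportional_dirv.
Qed.

Lemma vanishing_in_haldane_rezayi : haldane_rezayi m xi tau f.
Proof.
have [e He] := distinct_direction.
have PF : ProperFilter (0 : R[i]^o)^' by exact: Proper_dnbhs_numFieldType.
have [s] := filter_ex (near_disc_neq0 0 He); rewrite add0r.
set zs := s *: e => dzs.
pose one : 'rV[R[i]]_n := const_mx 1.
have nC : n%:R != 0 :> R[i] by rewrite pnatr_eq0 -lt0n.
have wone : wsum one = n%:R.
  by rewrite /wsum (eq_bigr (fun=> 1)) ?sumr_const ?card_ord// => r _; rewrite mxE.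
(* A line in the direction (1, ..., 1), parametrized by w. As [disc] depends only on differences, it
   is constant and nonzero there, so G is entire without removing any singularity. *)
pose zh (w : R[i]) := zs + ((w - wsum zs) / n%:R) *: one.
have wzh w : wsum (zh w) = w.
  by rewrite wsumD wsumZ wone divfK// addrC subrK.
have dzh w : disc (zh w) = disc zs.
  congr (_ ^+ _); apply: eq_bigr => a _; apply: eq_bigr => b _; congr theta.
  by rewrite !mxE; ring.
pose G w := rho (zh w).
have GE z : f z = G (wsum z) * disc z.
  have := @proportional_wsum0 (z - zh (wsum z)) _ (zh (wsum z)).
  rewrite wsumD -scaleN1r wsumZ wzh mulN1r subrr scaleN1r addrC subrK.
  move=> /(_ erefl) E; rewrite /G /rho mulrAC -E mulfK//.
  by rewrite dzh.
have rG z : disc z != 0 -> rho z = G (wsum z) by move=> dz; rewrite /rho GE mulfK.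
pose o : 'I_n := Ordinal n0.
have eG : entire G.
  have -> : G = fun w => (disc zs)^-1 * f (zs + (n%:R^-1 * w + - (wsum zs / n%:R)) *: one).
    apply/funext => w; rewrite /G /rho dzh mulrC; congr (_ * f (_ + _ *: _)).
    by rewrite mulrBl mulrC.
  have e1 : entire (fun t => f (zs + t *: one)) by move=> t; apply: cdiff_line; exact: hol_f.
  by move=> w; apply: cdiffM (cdiff_cst _ _) _; exact: (entire_affine n%:R^-1 _ e1).
have [||c Hc] := @theta_span R m xi tau m0 tau0 G eG.
- move=> w; have := rG (zh w + delta_mx 0 o); rewrite wsumD wsum_delta wzh => <-.
    by rewrite rho_add1.
  by rewrite disc_add1// mulf_neq0 ?wsign_neq0// dzh.
- move=> w; have := rG (zh w + tau *: delta_mx 0 o); rewrite wsumD wsumZ wsum_delta mulr1 wzh => <-.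
    by rewrite rho_addtau wzh.
  by rewrite disc_addtau// !mulf_neq0 ?wsign_neq0 ?disc_mult_neq0// dzh.
exists c => z; rewrite GE Hc mulr_suml; apply: eq_bigr => j _.
by rewrite PhiE mulrA.
Qed.

End Divisibility.

(** * The Haldane-Rezayi space *)

Theorem lemma3p3 (R : realType) (m n : nat) (xi tau : R[i]) :
  (0 < m)%N -> (0 < n)%N -> 0 < complex.Im tau ->
  @haldane_rezayi R m n xi tau = @sections_W_twist R m n xi tau /\
  @haldane_rezayi R m n xi tau =
    [set f | @sections_W R m n xi tau f /\
       forall p q : 'I_n, (p < q)%N -> vanishes_to_order tau p q m f].
Proof.
move=> m0 n0 tau0.
(* The inclusions form a circle: Haldane-Rezayi, twisted sections, vanishing along each component.
   Closing it shows that separate vanishing controls the crossings of the components too. *)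
have twist f : haldane_rezayi m xi tau f -> @sections_W_twist R m n xi tau f.
  exact: haldane_rezayi_twist.
have vanishes f : @sections_W_twist R m n xi tau f ->
    forall p q : 'I_n, (p < q)%N -> vanishes_to_order tau p q m f.
  by move=> tf p q; exact: twist_vanishes tf.
have contained f : @sections_W R m n xi tau f ->
    (forall p q : 'I_n, (p < q)%N -> vanishes_to_order tau p q m f) ->
    haldane_rezayi m xi tau f.
  exact: vanishing_in_haldane_rezayi.
split; apply/seteqP; split => f.
- exact: twist.
- by move=> tf; apply: contained (vanishes f tf); exact: tf.1.
- by move=> /twist tf; split; [exact: tf.1|exact: vanishes].
- by case; exact: contained.
Qed.
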